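(* Let $n\geq 1$, $\beta\in(0,2]$, and let $p,q>0$ be such that $p+q>2$. Let $\mathcal{K}:(0,\infty)\to(0,\infty)$ be a continuous function such that $\mathcal{K}(|\cdot|)\in L^1_{\mathrm{loc}}(\mathbb{R}^n)$ and such that there exists $R_0>1$ with $\inf_{r\in(0,R)}\mathcal{K}(r)=\mathcal{K}(R)$ for all $R>R_0$. Consider the Cauchy problem $$u_t+(-\Delta)^{\frac{\beta}{2}}u=(\mathcal{K}\ast|u|^p)|u|^q\quad (x\in\mathbb{R}^n,\ t>0),\qquad u(x,0)=u_0(x)\quad (x\in\mathbb{R}^n).\qquad (P)$$ (i) If $u_0\in L^1(\mathbb{R}^n)$, $$\int_{\mathbb{R}^n}u_0(x)\,dx>0\qquad\text{and}\qquad \limsup_{R\to\infty}\left(\mathcal{K}(R)\,R^{-n(p+q-2)+\beta}\right)=\infty,$$ then problem (P) has no global weak solutions. (ii) Let $\gamma>0$. If $u_0\in L^1_{\mathrm{loc}}(\mathbb{R}^n)$, $$u_0(x)\geq\varepsilon(1+|x|^2)^{-\gamma/2}\quad (x\in\mathbb{R}^n)\qquad\text{and}\qquad \liminf_{R\to\infty}\left(\mathcal{K}(R)^{-1}R^{\gamma(p+q-1)-n-\beta}\right)=0$$ for some constant $\varepsilon>0$, then problem (P) has no global weak solutions.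
   Context: Convolution: $(\mathcal{K}\ast|u|^p)(x)=\int_{\mathbb{R}^n}\mathcal{K}(|x-y|)|u(y)|^p\,dy$ (convolution in the space variable only). Fractional Laplacian: for $\beta=2$, $(-\Delta)^{\beta/2}=-\Delta$. For $\beta\in(0,2)$, with $s=\beta/2\in(0,1)$, $$(-\Delta)^s v(x)=C_{n,s}\,\mathrm{p.v.}\int_{\mathbb{R}^n}\frac{v(x)-v(y)}{|x-y|^{n+2s}}\,dy,\qquad C_{n,s}=\frac{4^s\,\Gamma(\frac n2+s)}{\pi^{n/2}|\Gamma(-s)|}.$$ Weak solution: let $u_0\in L^1_{\mathrm{loc}}(\mathbb{R}^n)$ and $T>0$. A (real-valued) function $u\in L^1_{\mathrm{loc}}((0,T)\times\mathbb{R}^n)$ is a weak solution of (P) on $[0,T)\times\mathbb{R}^n$ if $(\mathcal{K}\ast|u|^p)|u|^q\in L^1_{\mathrm{loc}}((0,T)\times\mathbb{R}^n)$ and $$\int_{\mathbb{R}^n}u(\tau,x)\psi(\tau,x)\,dx-\int_{\mathbb{R}^n}u_0(x)\psi(0,x)\,dx=\int_0^\tau\!\!\int_{\mathbb{R}^n}(\mathcal{K}\ast|u|^p)|u|^q\psi\,dx\,dt-\int_0^\tau\!\!\int_{\mathbb{R}^n}u\,(-\Delta)^{\frac\beta2}\psi\,dx\,dt+\int_0^\tau\!\!\int_{\mathbb{R}^n}u\,\psi_t\,dx\,dt$$ holds (in particular, all the integrals are meaningful) for all compactly supported test functions $\psi\in C^{1,2}_{t,x}([0,T)\times\mathbb{R}^n)$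 and all $0\leq\tau<T$. If $T=\infty$, $u$ is called a global (in time) weak solution. *)

(* Defs.v *)
From HB Require Import structures.
From mathcomp Require Import all_boot all_order all_algebra.
From mathcomp Require Import all_classical all_reals all_analysis.

Set Implicit Arguments.
Unset Strict Implicit.
Unset Printing Implicit Defensive.

Import Order.TTheory GRing.Theory Num.Theory.
Import numFieldNormedType.Exports.

Local Open Scope classical_set_scope.
Local Open Scope ring_scope.

(* R^n is 'rV[R]_n with the topology of the library.  Its sigma-algebra is
   generated by the coordinates, so it is the Borel sigma-algebra. *)

Definition rV_display : measure_display -> measure_display.
Proof. exact. Qed.

Section measurable_rV.
Context {R : realType} (n : nat).

Let coord (i : 'I_n) (v : 'rV[R]_n) : measurableTypeR R := v ord0 i.

Let rV_set0 : g_sigma_preimage coord set0.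
Proof. exact: sigma_algebra0. Qed.

Let rV_setC A : g_sigma_preimage coord A -> g_sigma_preimage coord (~` A).
Proof. exact: sigma_algebraC. Qed.

Let rV_bigcup (F : _^nat) : (forall i, g_sigma_preimage coord (F i)) ->
  g_sigma_preimage coord (\bigcup_i (F i)).
Proof. exact: sigma_algebra_bigcup. Qed.

HB.instance Definition _ := @isMeasurable.Build
  (rV_display default_measure_display) 'rV[R]_n (g_sigma_preimage coord)
  rV_set0 rV_setC rV_bigcup.

Lemma measurable_coord (i : 'I_n) : measurable_fun [set: 'rV[R]_n] (coord i).
Proof.
move=> _ Y mY; rewrite setTI; apply: sub_sigma_algebra => /=.
rewrite -bigcup_seq/=; exists i => /=; first by rewrite mem_index_enum.
by exists Y => //; rewrite setTI.
Qed.

Lemma measurable_fun_rVP d (T : measurableType d) (f : T -> 'rV[R]_n) :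
  (forall i, measurable_fun [set: T] (coord i \o f)) ->
  measurable_fun [set: T] f.
Proof.
move=> mf _ A mA; rewrite setTI.
have : g_sigma_preimage coord `<=` [set B | measurable (f @^-1` B)].
  apply: smallest_sub; first split => /=.
  - by rewrite preimage_set0.
  - by move=> B mB; rewrite setTD preimage_setC; exact: measurableC.
  - by move=> F mF; rewrite preimage_bigcup; exact: bigcup_measurable.
  move=> B; rewrite -bigcup_seq/= => -[i _ [C mC <-]] /=.
  by rewrite setTI -comp_preimage -[X in measurable X]setTI; exact: mf.
exact.
Qed.

End measurable_rV.

Section lebesgue_rV_succ.
Context {R : realType} {n : nat}.
Variable mu : {sigma_finite_measure set 'rV[R]_n -> \bar R}.
Local Open Scope ereal_scope.

Definition cons_rV (z : measurableTypeR R * 'rV[R]_n) : 'rV[R]_n.+1 :=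
  row_mx (z.1 : R)%:M z.2.

Lemma measurable_cons_rV : measurable_fun setT cons_rV.
Proof.
apply: measurable_fun_rVP => i /=.
case: (@split_ordP 1 n i) => j ->.
- rewrite [X in measurable_fun _ X](_ : _ = fst)//.
  by apply/funext => -[x v] /=; rewrite [LHS](row_mxEl x%:M v) mxE !ord1 eqxx mulr1n.
- rewrite [X in measurable_fun _ X](_ : _ =
      (fun v : 'rV[R]_n => v ord0 j : measurableTypeR R) \o snd).
    by apply: measurableT_comp => //; exact: measurable_coord.
  by apply/funext => -[x v] /=; rewrite [LHS](row_mxEr x%:M v).
Qed.

Definition lebesgue_rV_succ : set 'rV[R]_n.+1 -> \bar R :=
  pushforward (lebesgue_measure \x mu) cons_rV.

HB.instance Definition _ := Measure.copy lebesgue_rV_succ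
  (measure_function_pushforward__canonical__measure_function_Measure
     (lebesgue_measure \x mu) measurable_cons_rV).

Let lebesgue_rV_succ_sigma_finite : sigma_finite setT lebesgue_rV_succ.
Proof.
have /sigma_finiteP[F [TF ndF F_oo]] := sigma_finiteT (@lebesgue_measure R).
have /sigma_finiteP[G [TG ndG G_oo]] := sigma_finiteT mu.
pose g (v : 'rV[R]_(1 + n)) : measurableTypeR R * 'rV[R]_n :=
  (lsubmx v ord0 ord0, rsubmx v).
have mg : measurable_fun [set: 'rV[R]_n.+1] g.
  apply/measurable_fun_pairP; split.
    rewrite [X in measurable_fun _ X](_ : _ =
      fun v : 'rV[R]_n.+1 => v ord0 ord0 : measurableTypeR R).
      exact: measurable_coord.
    by apply/funext => v /=; rewrite mxE; congr (v _ _); exact/val_inj.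
  apply: measurable_fun_rVP => i.
  rewrite [X in measurable_fun _ X](_ : _ =
    fun v : 'rV[R]_n.+1 => v ord0 (rshift 1 i) : measurableTypeR R).
    exact: measurable_coord.
  by apply/funext => v /=; rewrite mxE.
have gK : cancel cons_rV g.
  by move=> [x v]; rewrite /g /cons_rV row_mxKl row_mxKr mxE eqxx mulr1n.
exists (fun k => g @^-1` (F k `*` G k)).
  rewrite -preimage_bigcup (_ : \bigcup_k _ = setT) ?preimage_setT//.
  apply/seteqP; split=> [//|[x v] _].
  have [i _ Fix] : (\bigcup_k F k) x by rewrite -TF.
  have [j _ Gjv] : (\bigcup_k G k) v by rewrite -TG.
  exists (maxn i j) => //; split => /=.
    by move: x Fix; exact/subsetPset/ndF/leq_maxl.
  by move: v Gjv; exact/subsetPset/ndG/leq_maxr.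
move=> k; have [mFk Fk_oo] := F_oo k; have [mGk Gk_oo] := G_oo k.
split; first by rewrite -[X in measurable X]setTI; apply: mg => //; exact: measurableX.
rewrite /lebesgue_rV_succ /pushforward -comp_preimage.
rewrite (_ : g \o cons_rV = id); last exact/funext.
by rewrite product_measure1E// lte_mul_pinfty// ge0_fin_numE.
Qed.

HB.instance Definition _ := Measure_isSigmaFinite.Build _ _ _ lebesgue_rV_succ
  lebesgue_rV_succ_sigma_finite.

End lebesgue_rV_succ.

Fixpoint lebesgue_rV {R : realType} (n : nat) :
    {sigma_finite_measure set 'rV[R]_n -> \bar R} :=
  if n is m.+1 then
    [the {sigma_finite_measure set 'rV[R]_m.+1 -> \bar R} of
       lebesgue_rV_succ (lebesgue_rV m)]
  else [the {sigma_finite_measure set 'rV[R]_0 -> \bar R} of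
       dirac (0 : 'rV[R]_0)].

Lemma lebesgue_rV_box {R : realType} (n : nat)
    (A : 'I_n -> set (measurableTypeR R)) :
  (forall i, measurable (A i)) ->
  lebesgue_rV n [set v : 'rV[R]_n | forall i, A i (v ord0 i)] =
  (\prod_(i < n) lebesgue_measure (A i))%E.
Proof.
elim: n A => [|n IHn] A mA.
  by rewrite big_ord0 /= diracE mem_set//; case.
rewrite big_ord_recl /= /lebesgue_rV_succ /pushforward.
pose B i := A (lift ord0 i).
rewrite (_ : _ @^-1` _ = A ord0 `*` [set v : 'rV[R]_n | forall i, B i (v ord0 i)]).
  rewrite product_measure1E//.
    by congr (_ * _)%E; apply: IHn => i; exact: mA.
  rewrite (_ : [set v | _] = \bigcap_(i : 'I_n)
    ((fun v : 'rV[R]_n => v ord0 i : measurableTypeR R) @^-1` B i)).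
    apply: fin_bigcap_measurable => // i _.
    by rewrite -[X in measurable X]setTI; apply: measurable_coord => //; exact: mA.
  by apply/seteqP; split=> [v Bv i _|v Bv i]; exact: Bv.
have e0 (x : R) (v : 'rV[R]_n) : cons_rV (x, v) ord0 ord0 = x.
  rewrite (_ : ord0 = @lshift 1 n ord0); last exact/val_inj.
  by rewrite [LHS](row_mxEl x%:M v) mxE eqxx mulr1n.
have eS (x : R) (v : 'rV[R]_n) i : cons_rV (x, v) ord0 (lift ord0 i) = v ord0 i.
  rewrite (_ : lift ord0 i = @rshift 1 n i); last exact/val_inj.
  by rewrite [LHS](row_mxEr x%:M v).
apply/seteqP; split=> [[x v] /= Axv|[x v] /= [Ax Bv] i].
  by split=> [|i]; [move: (Axv ord0); rewrite e0|
    move: (Axv (lift ord0 i)); rewrite eS].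
by case: (unliftP ord0 i) => [j|] ->; rewrite ?eS ?e0//; exact: Bv.
Qed.

Definition lebesgue_spacetime {R : realType} (n : nat) :
    set (measurableTypeR R * 'rV[R]_n)%type -> \bar R :=
  (lebesgue_measure \x lebesgue_rV n)%E.
Arguments lebesgue_spacetime {R} n _.

HB.instance Definition _ (R : realType) (n : nat) :=
  Measure.copy (@lebesgue_spacetime R n) (lebesgue_measure \x lebesgue_rV n)%E.

(* The measures above live on Borel sigma-algebras.  Lebesgue measurable
   functions are recovered as the functions that agree almost everywhere with a
   Borel measurable one; the library integral, a difference of suprema over
   simple functions, gives both the same value. *)
Definition ae_integrable d (T : measurableType d) (R : realType)
    (mu : {measure set T -> \bar R}) (D : set T) (f : T -> \bar R) : Prop :=
  exists2 g : T -> \bar R, mu.-integrable D g &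
    {ae mu, forall x, D x -> f x = g x}.

Section weak_solutions.
Context {R : realType} (n : nat).
Implicit Types (beta s p q : R) (T : \bar R) (K : R -> R).

Definition enorm (x : 'rV[R]_n) : R := Num.sqrt (\sum_(i < n) x ord0 i ^+ 2).

Definition Lone (f : 'rV[R]_n -> \bar R) : Prop :=
  ae_integrable (lebesgue_rV n) setT f.

Definition Lone_loc (f : 'rV[R]_n -> \bar R) : Prop :=
  forall A : set 'rV[R]_n, compact A -> ae_integrable (lebesgue_rV n) A f.

(* L^1_loc of the open set (0,T) x R^n *)
Definition Lone_loc_spacetime T (f : R -> 'rV[R]_n -> \bar R) : Prop :=
  forall A : set (R * 'rV[R]_n), compact A ->
    A `<=` [set z | 0 < z.1 /\ (z.1%:E < T)%E] ->
    ae_integrable (lebesgue_spacetime n) A (fun z => f z.1 z.2).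

(* Euler's integral for 0 < z, and for the other z the continuation
   Gamma(z) = Gamma(z + k) / (z (z + 1) ... (z + k - 1)), with k such that
   0 < z + k. *)
Definition euler_gamma (z : R) : R :=
  \int[lebesgue_measure]_(t in `]0, +oo[) (t `^ (z - 1) * expR (- t)).

Definition Gamma_fun (z : R) : R :=
  let k := if 0 < z then 0%N else (Num.truncn (- z)).+1 in
  euler_gamma (z + k%:R) / \prod_(i < k) (z + i%:R).

Definition fraclap_const s : R :=
  4 `^ s * Gamma_fun (n%:R / 2 + s) / (pi `^ (n%:R / 2) * `|Gamma_fun (- s)|).

Definition fraclap s (v : 'rV[R]_n -> R) (x : 'rV[R]_n) : R :=
  fraclap_const s *
  lim ((fun e : R => \int[lebesgue_rV n]_(y in [set y | e < enorm (x - y)])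
          ((v x - v y) / enorm (x - y) `^ (n%:R + 2 * s))) @ 0^'+).

Definition partial_x (i : 'I_n) (v : 'rV[R]_n -> R) (x : 'rV[R]_n) : R :=
  'D_(delta_mx ord0 i) v x.

Definition laplacian (v : 'rV[R]_n -> R) (x : 'rV[R]_n) : R :=
  \sum_(i < n) partial_x i (partial_x i v) x.

(* (-Delta)^(beta/2) for beta in (0,2] *)
Definition neg_laplacian_pow beta (v : 'rV[R]_n -> R) (x : 'rV[R]_n) : R :=
  if beta == 2 then - laplacian v x else fraclap (beta / 2) v x.

(* [0,T) x R^n *)
Definition cylinder T : set (R * 'rV[R]_n) :=
  [set z | 0 <= z.1 /\ (z.1%:E < T)%E].

(* Compactly supported functions of class C^{1,2}_{t,x} on [0,T) x R^n.  The
   values of psi outside the cylinder are irrelevant; at t = 0 the derivative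
   in t is one-sided. *)
Definition test_function T (psi : R -> 'rV[R]_n -> R) : Prop :=
  [/\ {within cylinder T, continuous (fun z => psi z.1 z.2)},
      exists psi_t : R -> 'rV[R]_n -> R,
        {within cylinder T, continuous (fun z => psi_t z.1 z.2)} /\
        forall t x, cylinder T (t, x) ->
          h^-1 * (psi (t + h) x - psi t x)
            @[h --> within [set h | 0 <= t + h] 0^'] --> psi_t t x,
      forall i : 'I_n,
        (forall t x, cylinder T (t, x) ->
           derivable (psi t) x (delta_mx ord0 i)) /\
        {within cylinder T, continuous (fun z => partial_x i (psi z.1) z.2)},
      forall i j : 'I_n,
        (forall t x, cylinder T (t, x) ->
           derivable (partial_x i (psi t)) x (delta_mx ord0 j)) /\
        {within cylinder T,
           continuous (fun z => partial_x j (partial_x i (psi z.1)) z.2)} &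
      exists A : set (R * 'rV[R]_n),
        [/\ compact A, A `<=` cylinder T &
            forall z, cylinder T z -> ~ A z -> psi z.1 z.2 = 0]].

(* Values in [0,+oo], since the convolution may diverge; 0 * +oo = 0. *)
Definition nonlocal_term p q K (u : R -> 'rV[R]_n -> R) (t : R)
    (x : 'rV[R]_n) : \bar R :=
  ((\int[lebesgue_rV n]_y (K (enorm (x - y)) * `|u t y| `^ p)%:E)
    * (`|u t x| `^ q)%:E)%E.

Definition weak_solution beta p q K (u0 : 'rV[R]_n -> R) T
    (u : R -> 'rV[R]_n -> R) : Prop :=
  [/\ Lone_loc_spacetime T (fun t x => (u t x)%:E),
      Lone_loc_spacetime T (nonlocal_term p q K u) &
      forall psi, test_function T psi ->
      forall tau : R, 0 <= tau -> (tau%:E < T)%E ->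
      let Q : set (measurableTypeR R * 'rV[R]_n)%type :=
        `]0, tau[ `*` setT in
      let f_tau x := (u tau x * psi tau x)%:E in
      let f_0 x := (u0 x * psi 0 x)%:E in
      let f_nl (z : measurableTypeR R * 'rV[R]_n) :=
        (nonlocal_term p q K u z.1 z.2 * (psi z.1 z.2)%:E)%E in
      let f_lap (z : measurableTypeR R * 'rV[R]_n) :=
        (u z.1 z.2 * neg_laplacian_pow beta (psi z.1) z.2)%:E in
      let f_t (z : measurableTypeR R * 'rV[R]_n) :=
        (u z.1 z.2 * derive1 (psi ^~ z.2) z.1)%:E in
      [/\ Lone f_tau /\ Lone f_0,
          ae_integrable (lebesgue_spacetime n) Q f_nl,
          ae_integrable (lebesgue_spacetime n) Q f_lap,
          ae_integrable (lebesgue_spacetime n) Q f_t &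
          (\int[lebesgue_rV n]_x f_tau x - \int[lebesgue_rV n]_x f_0 x =
           \int[lebesgue_spacetime n]_(z in Q) f_nl z
           - \int[lebesgue_spacetime n]_(z in Q) f_lap z
           + \int[lebesgue_spacetime n]_(z in Q) f_t z)%E]].

Definition global_weak_solution beta p q K (u0 : 'rV[R]_n -> R)
    (u : R -> 'rV[R]_n -> R) : Prop :=
  weak_solution beta p q K u0 +oo%E u.

End weak_solutions.

(* Main.v *)
(** Test the equation with [time_cutoff * bump], the bump having radius [r] and the
    cutoff time scale [r ^ beta].  On the support of a bump the kernel is at least
    [K (4 n r)], so the source dominates [K (4 n r)] times a product of a [p]-th and a
    [q]-th moment, and Young's inequality lets it absorb [r ^ (- beta)] times the
    integral of [|u|] against a power of the test function, up to the remainder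
    [r ^ n (K (4 n r) r ^ (n + beta)) ^ (- 1 / (p + q - 1))] ([decay_bound]).  For
    [beta = 2] this absorbs all the linear terms.  For [beta < 2] the fractional
    Laplacian of a bump has a tail [(1 + |x| / r) ^ (- n - beta)], which is not
    controlled by the bump itself.  Averaging the inequality over the centres [a] with
    the weight [(1 + |a| / r) ^ (- n - beta)] restores it: this weight is
    subconvolutive, so the averaged tails are of the size of the weight, and the
    averaged bumps cover the weight.  Finiteness of the weighted mass, needed to cancel
    it, follows from the integrability of [u (-Delta)^(beta/2) psi] for a single bump.

    Hence the mass of [u0] against a bump is at most [C * decay_bound], up to the mass
    of the negative part far from the origin.  This contradicts, along a sequence of
    radii, [\int u0 > 0] in (i), and the lower bound [r ^ (n - gamma)] of this mass
    in (ii). *)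

Require Import Defs.
From HB Require Import structures.
From mathcomp Require Import all_boot all_order all_algebra.
From mathcomp Require Import all_classical all_reals all_analysis.
From mathcomp Require Import measurable_realfun ring lra.
Set Implicit Arguments.
Unset Strict Implicit.
Unset Printing Implicit Defensive.
Import Order.TTheory GRing.Theory Num.Theory.
Import numFieldNormedType.Exports.
Local Open Scope classical_set_scope.
Local Open Scope ring_scope.

(** * Integrals of functions that agree almost everywhere with a measurable one *)

(** The obstacle is that [u] has no sign: the linear terms can only be estimated through [|u|], and
    only the source, which is nonnegative, can absorb them. The source controls the product of a
    [p]-th and a [q]-th moment, hence the moment of order [sigma = (p + q) / 2], and [p + q > 2]
    says that [sigma > 1], so that [|u|] lies below [theta * |u|^sigma] plus a constant. For this
    the linear terms must be bounded by the power [1 / sigma] of the test function, whence the high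
    order of vanishing of the bump. The definition of a weak solution makes the source integral
    finite, so it cancels after the absorption.

    In the nonlocal case the factor [L] in front of the absorbed mass is free: enlarging it only
    enlarges the constant of the remainder. It is chosen after the constants of the subconvolution
    and of the covering, so that the weighted mass produced by the linear terms is exactly
    compensated. *)

Section integral_nonmeasurable.
Import HBNNSimple.
Context d (T : measurableType d) (R : realType).
Variables (mu : {measure set T -> \bar R}) (D : set T) (mD : measurable D).
Implicit Types f g h : T -> \bar R.
Local Open Scope ereal_scope.

(** The integral of a nonnegative function is a supremum over the simple functions below it, hence
    monotone for arbitrary functions. The terms of the weak formulation agree only almost everywhere
    with Borel functions. *)
Lemma ge0_le_integral_nonmeasurable (A B : set T) f g : A `<=` B ->
  (forall x, A x -> 0 <= f x) -> (forall x, B x -> 0 <= g x) ->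
  (forall x, A x -> f x <= g x) ->
  \int[mu]_(x in A) f x <= \int[mu]_(x in B) g x.
Proof.
move=> AB f0 g0 fg; rewrite !ge0_integralE//.
apply: le_ereal_sup => _ [h /= hf <-]; exists h => //= x.
apply: le_trans (hf x) _; rewrite !patchE.
case: ifPn => [|_]; first by rewrite inE => Ax; rewrite mem_set ?fg//; exact: AB.
by case: ifPn => //; rewrite inE => /g0.
Qed.

(** Off the exceptional null set the comparison is pointwise; measurability of the smaller function
    allows this set to be removed. *)
Lemma ae_ge0_le_integral_measurablel h f : measurable_fun D h ->
  (forall x, D x -> 0 <= h x) -> {ae mu, forall x, D x -> h x <= f x} ->
  (forall x, D x -> 0 <= f x) ->
  \int[mu]_(x in D) h x <= \int[mu]_(x in D) f x.
Proof.
move=> mh h0 [N [mN N0 hfN]] f0.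
rewrite (ge0_negligible_integral mN mD mh _ N0)//.
apply: ge0_le_integral_nonmeasurable => //.
- by move=> x [Dx _]; exact: h0.
- move=> x [Dx Nx]; apply: contrapT => hf; apply/Nx/hfN => /=.
  by apply/not_implyP; split.
Qed.

(** Here the larger function is the measurable one: each simple function below [f] is measurable, so
    the usual almost everywhere comparison applies to it. *)
Lemma ae_ge0_le_integral_measurabler f g : measurable_fun D g ->
  (forall x, D x -> 0 <= g x) -> {ae mu, forall x, D x -> f x <= g x} ->
  (forall x, D x -> 0 <= f x) ->
  \int[mu]_(x in D) f x <= \int[mu]_(x in D) g x.
Proof.
move=> mg g0 fg f0; rewrite ge0_integralE//.
apply: ub_ereal_sup => _ [h /= hf <-].
rewrite -integralT_nnsfun [leRHS]integral_mkcond.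
apply: ae_ge0_le_integral => //.
- by move=> x _; rewrite lee_fin.
- exact: measurableT_comp.
- by move=> x _; rewrite patchE; case: ifPn => //; rewrite inE => /g0.
- exact/(measurable_restrictT g mD).1.
- case: fg => N [mN N0 fgN]; exists N; split => // x /= /not_implyP[_ hx].
  apply: fgN => /= fgx; apply: hx; apply: le_trans (hf x) _.
  by rewrite !patchE; case: ifPn => //; rewrite inE => /fgx.
Qed.

(** [f] may be negative on the exceptional set; its negative part is zero almost everywhere and
    contributes nothing. *)
Lemma ae_le_integral_nonmeasurable h f : measurable_fun D h ->
  (forall x, D x -> 0 <= h x) -> {ae mu, forall x, D x -> h x <= f x} ->
  \int[mu]_(x in D) h x <= \int[mu]_(x in D) f x.
Proof.
move=> mh h0 hf; rewrite [leRHS]integralE.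
rewrite (_ : \int[mu]_(x in D) f^\- x = 0) ?sube0.
  apply: ae_ge0_le_integral_measurablel => //.
  case: hf => N [mN N0 hfN]; exists N; split => // x /= hx; apply: hfN => /= fhx.
  by apply: hx => Dx; rewrite funeposE le_max fhx.
apply/eqP; rewrite eq_le; apply/andP; split; last exact: integral_ge0.
rewrite -[leRHS](integral0 mu D); apply: ae_ge0_le_integral_measurabler => //.
case: hf => N [mN N0 hfN]; exists N; split => // x /= hx; apply: hfN => /= fhx.
apply: hx => Dx; rewrite funenegE ge_max lexx andbT leeNl oppe0.
exact: le_trans (h0 _ Dx) (fhx Dx).
Qed.

(** Replaces the integrals of the weak formulation by those of a Borel representative. The positive
    and the negative parts are compared separately, in both directions. *)
Lemma ae_eq_integral_nonmeasurable f g : measurable_fun D g ->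
  {ae mu, forall x, D x -> f x = g x} ->
  \int[mu]_(x in D) f x = \int[mu]_(x in D) g x.
Proof.
move=> mg [N [mN N0 fgN]]; rewrite integralE [RHS]integralE.
have H (F : (T -> \bar R) -> T -> \bar R) :
    (forall f x, 0 <= F f x) -> (forall f g x, f x = g x -> F f x = F g x) ->
    measurable_fun D (F g) ->
    \int[mu]_(x in D) (F f x) = \int[mu]_(x in D) (F g x).
  move=> F0 FE mFg; apply/eqP; rewrite eq_le; apply/andP; split.
    apply: ae_ge0_le_integral_measurabler => //; exists N; split => // x /= hx.
    by apply: fgN => /= fgx; apply: hx => Dx; rewrite (FE f g) ?fgx.
  apply: ae_ge0_le_integral_measurablel => //; exists N; split => // x /= hx.
  by apply: fgN => /= fgx; apply: hx => Dx; rewrite (FE f g) ?fgx.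
congr (_ - _).
  by apply: (H (fun f => f^\+)) => [//|? ? ?|]; [rewrite !funeposE => ->|exact: measurable_funepos].
by apply: (H (fun f => f^\-)) => [//|? ? ?|]; [rewrite !funenegE => ->|exact: measurable_funeneg].
Qed.

End integral_nonmeasurable.

(** * Cubes, norms and reflections in R^n *)

Section rV_measure.
Context {R : realType}.
Implicit Types n : nat.

Lemma rV_norm_leP n (x : 'rV[R]_n) (r : R) : 0 <= r ->
  reflect (forall i, `|x ord0 i| <= r) (`|x| <= r).
Proof.
move=> r0; rewrite [`|x|]mx_normrE; apply: (iffP idP) => [+ i|h].
  by apply: le_trans; apply: (le_bigmax_cond _ (fun ij => `|x ij.1 ij.2|) (j := (ord0, i))).
by apply: bigmax_le => // -[i j] _ /=; rewrite (ord1 i).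
Qed.

Lemma rV_coord_le n (x : 'rV[R]_n) i : `|x ord0 i| <= `|x|.
Proof. by apply/(rV_norm_leP _ (normr_ge0 x)). Qed.

Lemma norm_le_enorm n (x : 'rV[R]_n) : `|x| <= enorm x.
Proof.
apply/rV_norm_leP => [|i]; first exact: sqrtr_ge0.
rewrite -sqrtr_sqr; apply: ler_wsqrtr.
by rewrite (bigD1 i)//= lerDl sumr_ge0// => j _; rewrite sqr_ge0.
Qed.

(** The norm of the library is the sup norm. The crude factor [n] instead of its square root is
    enough, since all constants may depend on the dimension. *)
Lemma enorm_le_norm n (x : 'rV[R]_n) : enorm x <= n%:R * `|x|.
Proof.
rewrite -[leRHS]ger0_norm; last by rewrite mulr_ge0.
rewrite -sqrtr_sqr; apply: ler_wsqrtr.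
apply: (@le_trans _ _ (\sum_(i < n) `|x| ^+ 2)).
  apply: ler_sum => i _; rewrite -real_normK ?num_real//.
  by rewrite lerXn2r ?nnegrE ?rV_coord_le.
rewrite sumr_const card_ord exprMn -[leLHS]mulr_natl ler_wpM2r ?sqr_ge0//.
by rewrite -natrX ler_nat; case: n x => // n _; rewrite expnS expn1 leq_pmulr.
Qed.

Lemma measurable_rV_coord n (i : 'I_n) :
  measurable_fun [set: 'rV[R]_n] (fun x => x ord0 i).
Proof. exact: measurable_coord. Qed.

Lemma measurable_bigmax d (T : measurableType d) (I : Type) (s : seq I)
    (f : I -> T -> R) (D : set T) : (forall i, measurable_fun D (f i)) ->
  measurable_fun D (fun x => \big[Num.max/0]_(i <- s) f i x).
Proof.
move=> mf; elim: s => [|i s ih].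
  by under eq_fun do rewrite big_nil; exact: measurable_cst.
by under eq_fun do rewrite big_cons; exact: measurable_maxr.
Qed.

Lemma measurable_rV_norm n (a : 'rV[R]_n) :
  measurable_fun [set: 'rV[R]_n] (fun x => `|x - a|).
Proof.
under eq_fun do rewrite [`|_|]mx_normrE.
apply: (@measurable_bigmax _ _ _ _ (fun ij (x : 'rV[R]_n) => `|(x - a) ij.1 ij.2|)) => -[i j] /=.
rewrite (_ : (fun x => _) = Num.norm \o (fun x : 'rV[R]_n => x ord0 j - a ord0 j)).
  by apply: measurableT_comp => //; apply: measurable_funB => //; exact: measurable_rV_coord.
by apply/funext => x /=; rewrite !mxE (ord1 i).
Qed.

Lemma measurable_enorm n (a : 'rV[R]_n) :
  measurable_fun [set: 'rV[R]_n] (fun x => enorm (a - x)).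
Proof.
apply: (@measurableT_comp _ _ _ _ _ _ (@Num.sqrt R)).
  by apply: continuous_measurable_fun => x; exact: sqrt_continuous.
apply: measurable_sum => i; apply: measurable_funX.
rewrite (_ : (fun x => _) = (fun x : 'rV[R]_n => a ord0 i - x ord0 i)).
  2: by apply/funext => x; rewrite !mxE.
by apply: measurable_funB => //; exact: measurable_rV_coord.
Qed.

(** [|x - a|] being the sup norm, this closed ball is a cube of side [2 * r]. *)
Definition cube n (a : 'rV[R]_n) (r : R) : set 'rV[R]_n := [set x | `|x - a| <= r].

Lemma measurable_cube n (a : 'rV[R]_n) r : measurable (cube a r).
Proof.
have := measurable_rV_norm a measurableT (measurable_itv `]-oo, r]%R).
rewrite setTI (_ : _ @^-1` _ = cube a r)//.
Qed.

Lemma lebesgue_rV_cube n (a : 'rV[R]_n) r : 0 <= r ->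
  lebesgue_rV n (cube a r) = ((2 * r) ^+ n)%:E.
Proof.
move=> r0.
have E (x : 'rV[R]_n) i : (`|(x - a) ord0 i| <= r) =
    (x ord0 i \in `[a ord0 i - r, a ord0 i + r]).
  rewrite !mxE in_itv/= ler_norml.
  by apply/idP/idP => /andP[? ?]; apply/andP; split; lra.
rewrite (_ : cube a r = [set x | forall i, `[a ord0 i - r, a ord0 i + r]%classic (x ord0 i)]); last first.
  apply/seteqP; split => x /= => [/(rV_norm_leP _ r0) h i|h]; first by rewrite -E.
  by apply/(rV_norm_leP _ r0) => i; rewrite E; exact: h.
rewrite (@lebesgue_rV_box _ _ (fun i => `[a ord0 i - r, a ord0 i + r]%classic)) => [|i]; last first.
  exact: measurable_itv.
rewrite (eq_bigr (fun=> (2 * r)%:E)) => [|i _].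
  by rewrite prodEFin prodr_const card_ord.
rewrite /= lebesgue_measure_itv/= lte_fin; case: ifPn => [_|].
  by rewrite -EFinD; congr EFin; ring.
by rewrite -leNgt => ?; congr EFin; lra.
Qed.

Lemma lebesgue_rV_set1 n (a : 'rV[R]_n) : (0 < n)%N -> lebesgue_rV n [set a] = 0%E.
Proof.
move=> n0; rewrite (_ : [set a] = cube a 0).
  by rewrite lebesgue_rV_cube// mulr0 expr0n -[n == _]negbK -lt0n n0.
apply/seteqP; split => x /= => [->|]; first by rewrite /cube/= subrr normr0.
by rewrite /cube/= normr_le0 subr_eq0 => /eqP.
Qed.

(** A pi-system generating the sigma-algebra, on which the measure is an explicit product; it serves
    to identify measures. *)
Definition boxes n : set_system 'rV[R]_n := [set A : set 'rV[R]_n | exists2 B : 'I_n -> set R,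
  (forall i, measurable (B i)) & A = [set v : 'rV[R]_n | forall i, B i (v ord0 i)]].

Lemma boxesI n : setI_closed (@boxes n).
Proof.
move=> _ _ [B mB ->] [C mC ->]; exists (fun i => B i `&` C i).
  by move=> i; exact: measurableI.
by apply/seteqP; split => v /= => [[Bv Cv] i|BCv]; [split|split => i; case: (BCv i)].
Qed.

Lemma measurable_rVE n : @measurable _ 'rV[R]_n = <<s @boxes n >>.
Proof.
apply/seteqP; split.
  apply: smallest_sub; first exact: smallest_sigma_algebra.
  move=> B; rewrite -bigcup_seq/= => -[i _ [C mC <-]].
  apply: sub_sigma_algebra; exists (fun j => if j == i then C else setT).
    by move=> j; case: ifP.
  apply/seteqP; split => v /= => [[_ Cv] j|/(_ i)]; last by rewrite eqxx.
  by case: ifPn => // /eqP ->.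
apply: smallest_sub; first exact: sigma_algebra_measurable.
move=> _ [B mB ->].
rewrite (_ : [set v | _] = \bigcap_(i : 'I_n)
    ((fun v : 'rV[R]_n => v ord0 i) @^-1` B i)).
  apply: fin_bigcap_measurable => // i _.
  by rewrite -[X in measurable X]setTI; apply: measurable_rV_coord.
by apply/seteqP; split=> [v Bv i _|v Bv i]; exact: Bv.
Qed.

(** Uniqueness of Lebesgue measure reduces this to half-open intervals: []a, b]] pulls back to [[c -
    b, c - a[], of the same length. *)
Lemma lebesgue_measure_reflect (c : R) (A : set R) : measurable A ->
  lebesgue_measure ((fun x => c - x) @^-1` A) = lebesgue_measure A.
Proof.
move=> mA; have mc : measurable_fun setT (fun x : measurableTypeR R => c - x : measurableTypeR R).
  exact: measurable_funB.
have := @lebesgue_measure_unique R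
  (measure_function_pushforward__canonical__measure_function_Measure
     lebesgue_measure mc) _ A mA.
move=> ->// _ [[a b]] _ <-.
rewrite /= /pushforward (_ : _ @^-1` _ = `[c - b, c - a[%classic); last first.
  by apply/seteqP; split => x /=; rewrite !in_itv/= => /andP[? ?]; apply/andP; split; lra.
rewrite !lebesgue_measure_itv/= !lte_fin ltrD2l ltrN2.
by case: ifPn => // _; rewrite -!EFinD; congr EFin; ring.
Qed.

Lemma measurable_rV_reflect n (c : 'rV[R]_n) :
  measurable_fun setT (fun x : 'rV[R]_n => c - x).
Proof.
apply: measurable_fun_rVP => i /=.
rewrite [X in measurable_fun _ X](_ : _ = fun x : 'rV[R]_n => c ord0 i - x ord0 i).
  by apply: measurable_funB => //; exact: measurable_rV_coord.
by apply/funext => x; rewrite /= !mxE.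
Qed.

(** Both measures agree on boxes, by the one-dimensional reflection in each factor, and the cubes
    [cube 0 k] exhaust the space with finite measure. *)
Lemma lebesgue_rV_reflect n (c : 'rV[R]_n) (A : set 'rV[R]_n) : measurable A ->
  lebesgue_rV n ((fun x => c - x) @^-1` A) = lebesgue_rV n A.
Proof.
move=> mA.
pose m2 := measure_function_pushforward__canonical__measure_function_Measure
  (lebesgue_rV n) (measurable_rV_reflect c).
apply/esym.
apply: (@measure_unique _ R _ (@boxes n) (fun k => cube 0 k%:R) (measurable_rVE n)
  (@boxesI n) _ _ (lebesgue_rV n) m2 _ _ A mA).
- move=> k; exists (fun=> `[- k%:R, k%:R]%classic) => //.
  apply/seteqP; split => x; rewrite /cube/= subr0.
    by move/(rV_norm_leP _ (ler0n _ _)) => h i; rewrite in_itv/= -ler_norml.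
  by move=> h; apply/rV_norm_leP => // i; have := h i; rewrite in_itv/= -ler_norml.
- apply/seteqP; split => // x _; exists (Num.truncn `|x|).+1 => //.
  by rewrite /cube/= subr0 ltW// truncnS_gt.
- move=> _ [B mB ->]; rewrite /m2 /= /pushforward.
  rewrite (_ : _ @^-1` _ =
      [set v : 'rV[R]_n | forall i, ((fun y => c ord0 i - y) @^-1` B i) (v ord0 i)]).
    rewrite (@lebesgue_rV_box _ _ (fun i => (fun y => c ord0 i - y) @^-1` B i)).
      rewrite lebesgue_rV_box//; apply: eq_bigr => i _.
      exact/esym/lebesgue_measure_reflect.
    by move=> i; rewrite -[X in measurable X]setTI; apply: measurable_funB.
  by apply/seteqP; split => v /= h i; have := h i; rewrite !mxE.
- by move=> k; rewrite [X in (X < _)%E]lebesgue_rV_cube// ltry.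
Qed.

Lemma ge0_integral_rV_reflect n (c : 'rV[R]_n) (f : 'rV[R]_n -> \bar R) :
  measurable_fun setT f -> (forall x, 0 <= f x)%E ->
  (\int[lebesgue_rV n]_x f (c - x)%R = \int[lebesgue_rV n]_x f x)%E.
Proof.
move=> mf f0.
have := @ge0_integral_pushforward _ _ _ _ R _ (measurable_rV_reflect c)
  (lebesgue_rV n) setT f measurableT mf (fun x _ => f0 x).
rewrite preimage_setT => /= <-.
apply: eq_measure_integral => [|mc A mA _]; first exact: measurable_rV_reflect.
exact: lebesgue_rV_reflect.
Qed.

End rV_measure.

(** * Gluing and slicing of almost everywhere equalities *)

Section almost_everywhere.
Context {R : realType}.

(** The sets [seqDU D k] are disjoint with the same union, so at each point the first [D m]
    containing it decides which [g m] is used. *)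
Lemma ae_glue d (T : measurableType d) (mu : {measure set T -> \bar R})
    (D : nat -> set T) (f : T -> R) (g : nat -> T -> R) :
  (forall m, measurable (D m)) -> (forall m, measurable_fun (D m) (g m)) ->
  (forall m, {ae mu, forall x, D m x -> f x = g m x}) ->
  exists2 h : T -> R, measurable_fun setT h &
    {ae mu, forall x, (\bigcup_m D m) x -> f x = h x}.
Proof.
move=> mD mg fg.
pose m x := xget 0%N [set k | seqDU D k x].
have mE k x : seqDU D k x -> m x = k.
  move=> kx; rewrite /m; case: xgetP => [j _ /= jx|/(_ k)//].
  have /trivIsetP/(_ j k Logic.I Logic.I) := @trivIset_seqDU _ D.
  by have [//|_ /(_ isT)/seteqP[/(_ x)] /(_ (conj jx kx))] := eqVneq j k.
have mseqDU k : measurable (seqDU D k).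
  by apply: measurableD => //; exact: bigsetU_measurable.
exists ((fun x => g (m x) x) \_ (\bigcup_k D k)).
  apply/(measurable_restrictT _ (bigcupT_measurable _ mD)).1.
  rewrite seqDU_bigcup_eq; apply/measurable_fun_bigcup => // k.
  apply: (@eq_measurable_fun _ _ _ _ (seqDU D k) (g k)).
    by move=> x /set_mem kx; rewrite (mE k).
  apply: measurable_funS (mg k) => //; exact: subset_seqDU.
have /ae_foralln H := fg.
case: H => N [mN N0 HN]; exists N; split => // x /= hx; apply: HN => /= fgx.
apply: hx => Dx; rewrite patchE mem_set//.
move: Dx; rewrite seqDU_bigcup_eq => -[k _ kx].
by rewrite (mE k x kx); apply: fgx; case: kx.
Qed.

(** Passes from space-time to almost every time slice: the sections of a null set are null for
    almost every first coordinate. *)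
Lemma ae_product d1 d2 (T1 : measurableType d1) (T2 : measurableType d2)
    (m1 : {measure set T1 -> \bar R}) (m2 : {sigma_finite_measure set T2 -> \bar R})
    (P : T1 * T2 -> Prop) :
  {ae (m1 \x m2)%E, forall z, P z} ->
  {ae m1, forall x, {ae m2, forall y, P (x, y)}}.
Proof.
move=> [N [mN N0 PN]].
have : ae_eq m1 setT (m2 \o xsection N) (cst 0%E).
  apply/(ae_eq_integral_abs m1 measurableT (measurable_fun_xsection m2 mN)).
  rewrite -[RHS]N0; apply: eq_integral => x _ /=.
  by rewrite gee0_abs.
move=> [M [mM M0 HM]]; exists M; split => // x /= hx; apply: HM => /= Nx.
apply: hx; exists (xsection N x); split; first exact: measurable_xsection.
  exact: Nx.
by move=> y /= Py; apply/mem_set/PN.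
Qed.

End almost_everywhere.

(** * Bump functions *)

Section one_variable.
Context {R : realType}.
Implicit Types (f df : R -> R) (x t a r h : R) (k l : nat).

Lemma cvg_is_derive (V : normedModType R) (g : V -> R) (a v : V) (d : R) :
  h^-1 *: (g (h *: v + a) - g a) @[h --> (0 : R)^'] --> d -> is_derive a v g d.
Proof.
move=> gd; split; first by apply/cvg_ex; exists d; exact: gd.
exact: (cvg_lim _ gd).
Qed.

Lemma is_derive_cvg (V : normedModType R) (g : V -> R) (a v : V) (d : R) :
  is_derive a v g d -> h^-1 *: (g (h *: v + a) - g a) @[h --> (0 : R)^'] --> d.
Proof. by move=> [gd <-]; exact: gd. Qed.

Lemma is_derive_quadratic f x d : (forall h, `|f (x + h) - f x - d * h| <= h ^+ 2) ->
  is_derive x 1 f d.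
Proof.
move=> H; apply: cvg_is_derive; apply/cvgrPdist_le => e e0.
near=> h.
have h0 : h != 0 by near: h; exact: nbhs_dnbhs_neq.
have he : `|h| <= e by near: h; exact: dnbhs0_le.
rewrite (_ : d - _ = - (h^-1 * (f (x + h) - f x - d * h))); last first.
  by rewrite /GRing.scale/= mulr1 addrC (addrC h); field.
rewrite normrN normrM normfV ler_pdivrMl ?normr_gt0//.
apply: le_trans (H h) _; rewrite -real_normK ?num_real// expr2.
by rewrite ler_wpM2l.
Unshelve. all: by end_near. Qed.

Definition pospart x : R := Num.max 0 x.

Lemma pospart_ge0 x : 0 <= pospart x.
Proof. by rewrite le_max lexx. Qed.

(** The kink disappears after squaring: in each of the four sign cases the first-order remainder is
    at most [h ^+ 2]. *)
Lemma is_derive_pospart2 x : is_derive x 1 (fun z => pospart z ^+ 2) (2 * pospart x).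
Proof.
apply: is_derive_quadratic => h; rewrite /pospart ler_norml.
by case: (lerP 0 x) => ?; case: (lerP 0 (x + h)) => ?; apply/andP; split; nra.
Qed.

Lemma pospartX k x : pospart x ^+ k.+1 = x ^+ k * pospart x.
Proof.
rewrite /pospart; case: (lerP 0 x) => _; first by rewrite exprSr.
by rewrite mulr0 expr0n.
Qed.

Lemma is_derive_Xn k x : is_derive x 1 (fun z => z ^+ k) (k%:R * x ^+ k.-1).
Proof.
elim: k => [|k ih]; first by rewrite mul0r; exact: is_derive_cst.
rewrite (_ : (fun z => _) = id * (fun z => z ^+ k)); last first.
  by apply/funext => z; rewrite fctE exprS.
apply: is_derive_eq; rewrite /GRing.scale/= mulr1.
case: k ih => [|k] _ /=; first by rewrite !expr0; ring.
by rewrite !exprS -[in RHS]natr1; ring.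
Qed.

(** Writing the power as [z ^+ k * pospart z ^+ 2] leaves only the square to differentiate at the
    kink. *)
Lemma is_derive_pospartX k x :
  is_derive x 1 (fun z => pospart z ^+ k.+2) (k.+2%:R * pospart x ^+ k.+1).
Proof.
rewrite (_ : (fun z => _) = (fun z => z ^+ k) * (fun z => pospart z ^+ 2)); last first.
  by apply/funext => z; rewrite pospartX fctE exprS [in RHS]pospartX expr1; ring.
apply: is_derive_eq.
  apply: is_deriveM; last exact: is_derive_pospart2.
  exact: is_derive_Xn.
rewrite /GRing.scale/=; case: k => [|k] /=.
  by rewrite !expr0 expr1; ring.
by rewrite !pospartX !exprS expr0; ring.
Qed.

Lemma continuous_pospart : continuous pospart.
Proof. by move=> x; apply: continuous_max => //; exact: cvg_cst. Qed.

End one_variable.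

Section bump_one_variable.
Context {R : realType}.
Implicit Types (f df : R -> R) (x t a r h : R) (k l : nat).

Lemma lipschitz_is_derive f df M : (forall x, is_derive x 1 f (df x)) ->
  (forall x, `|df x| <= M) -> forall x y, `|f y - f x| <= M * `|y - x|.
Proof.
move=> fdf dfM.
have H x y : x <= y -> `|f y - f x| <= M * `|y - x|.
  move=> xy; have [|c _ ->] := MVT_segment xy (fun z _ => fdf z).
    apply: continuous_subspaceT => z; apply/differentiable_continuous/derivable1_diffP.
    exact: ex_derive.
  by rewrite normrM ler_wpM2r.
move=> x y; have [/H//|/ltW/H] := leP x y.
by rewrite distrC (distrC x).
Qed.

(** By the mean value theorem the second difference is [(df c - df d) * h] with [c] and [d] at
    distance at most [2 * h], so a Lipschitz derivative suffices. *)
Lemma second_difference_is_derive f df M : (forall x, is_derive x 1 f (df x)) ->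
  (forall x y, `|df y - df x| <= M * `|y - x|) ->
  forall x h, `|f (x + h) + f (x - h) - 2 * f x| <= 2 * M * h ^+ 2.
Proof.
move=> fdf dfM.
have M0 : 0 <= M.
  by have := dfM 0 1; rewrite subr0 normr1 mulr1; apply: le_trans.
have fc : continuous f.
  by move=> z; apply/differentiable_continuous/derivable1_diffP; exact: ex_derive.
have H x h : 0 <= h -> `|f (x + h) + f (x - h) - 2 * f x| <= 2 * M * h ^+ 2.
  move=> h0; have xh : x <= x + h by rewrite lerDl.
  have hx : x - h <= x by rewrite gerBl.
  have [|c cI Ec] := MVT_segment xh (fun z _ => fdf z); first exact: continuous_subspaceT.
  have [|d dI Ed] := MVT_segment hx (fun z _ => fdf z); first exact: continuous_subspaceT.
  rewrite (_ : _ - _ = (df c - df d) * h); last first.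
    have -> : f (x + h) = f x + df c * (x + h - x) by rewrite -Ec; ring.
    have -> : f (x - h) = f x - df d * (x - (x - h)) by rewrite -Ed; ring.
    by ring.
  rewrite normrM (ger0_norm h0) expr2 mulrA ler_wpM2r//.
  apply: le_trans (dfM _ _) _; rewrite -mulrA mulrCA ler_wpM2l//.
  move: cI dI; rewrite !in_itv/= => /andP[? ?] /andP[? ?].
  by rewrite ler_norml; apply/andP; split; lra.
move=> x h; have [/H//|h0] := leP 0 h.
have := H x (- h); rewrite oppr_ge0 => /(_ (ltW h0)).
by rewrite opprK sqrrN (addrC (f (x - h))).
Qed.

(* [bump1''] is of the order of [pospart (1 - t ^ 2) ^ k.+1], hence at most a power
   [1 / sigma] of [bump1] as soon as [k.+3 <= sigma * k.+1]. *)
Definition bump1 k t : R := pospart (1 - t ^+ 2) ^+ k.+3.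
Definition dbump1 k t : R := - (2 * k.+3%:R * t * pospart (1 - t ^+ 2) ^+ k.+2).
Definition ddbump1 k t : R :=
  4 * k.+3%:R * k.+2%:R * t ^+ 2 * pospart (1 - t ^+ 2) ^+ k.+1
  - 2 * k.+3%:R * pospart (1 - t ^+ 2) ^+ k.+2.

Let eq_is_derive f x (d d' : R) : d = d' -> is_derive x 1 f d -> is_derive x 1 f d'.
Proof. by move=> <-. Qed.

Let is_derive_1Bsqr t : is_derive t 1 (fun t : R => 1 - t ^+ 2) (- (2 * t)).
Proof.
rewrite (_ : (fun t => _) = cst 1 - (fun t => t ^+ 2))//.
by apply: is_derive_eq; rewrite /GRing.scale/= mulr1; ring.
Qed.

Lemma is_derive_bump1 k t : is_derive t 1 (bump1 k) (dbump1 k t).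
Proof.
rewrite (_ : bump1 k = (fun z => pospart z ^+ k.+3) \o (fun t => 1 - t ^+ 2))//.
have := @is_derive1_comp R _ (fun t => 1 - t ^+ 2) t _ _ (is_derive_pospartX k.+1 _)
  (is_derive_1Bsqr t).
by apply: eq_is_derive; rewrite /dbump1; ring.
Qed.

Lemma is_derive_dbump1 k t : is_derive t 1 (dbump1 k) (ddbump1 k t).
Proof.
rewrite (_ : dbump1 k = (fun t => - (2 * k.+3%:R) * t ^+ 1) *
  ((fun z => pospart z ^+ k.+2) \o (fun t => 1 - t ^+ 2))); last first.
  by apply/funext => z; rewrite fctE /dbump1 /=; ring.
have := is_deriveM (is_deriveZ (- (2 * k.+3%:R)) (is_derive_Xn 1 t))
  (@is_derive1_comp R _ (fun t => 1 - t ^+ 2) t _ _ (is_derive_pospartX k _)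
    (is_derive_1Bsqr t)).
by apply: eq_is_derive; rewrite /ddbump1 /GRing.scale/= -[_ *: _]/(_ * _); ring.
Qed.

Lemma pospart_1Bsqr_le1 t : pospart (1 - t ^+ 2) <= 1.
Proof. by rewrite ge_max ler01 gerBl sqr_ge0. Qed.

Lemma pospart_1Bsqr_eq0 t : 1 <= `|t| -> pospart (1 - t ^+ 2) = 0.
Proof.
move=> t1; rewrite /pospart; apply/max_idPl; rewrite subr_le0.
by rewrite -real_normK ?num_real// expr_ge1.
Qed.

Lemma bump1_ge0 k t : 0 <= bump1 k t.
Proof. by rewrite exprn_ge0// pospart_ge0. Qed.

Lemma bump1_le1 k t : bump1 k t <= 1.
Proof. by rewrite exprn_ile1 ?pospart_ge0 ?pospart_1Bsqr_le1. Qed.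

Lemma bump1_eq0 k t : 1 <= `|t| -> bump1 k t = 0.
Proof. by move=> t1; rewrite /bump1 pospart_1Bsqr_eq0// expr0n. Qed.

Lemma bump1_ge k t c : 0 <= c -> c <= 1 - t ^+ 2 -> c ^+ k.+3 <= bump1 k t.
Proof.
by move=> c0 ct; rewrite lerXn2r ?nnegrE ?pospart_ge0// le_max ct orbT.
Qed.

Lemma dbump1_le k t : `|dbump1 k t| <= 2 * k.+3%:R.
Proof.
have [t1|t1] := leP 1 `|t|.
  by rewrite /dbump1 pospart_1Bsqr_eq0// expr0n mulr0 oppr0 normr0 mulr_ge0.
rewrite /dbump1 normrN; set P := pospart _ ^+ _.
have P0 : 0 <= P by rewrite exprn_ge0 ?pospart_ge0.
have P1 : P <= 1 by rewrite exprn_ile1 ?pospart_ge0 ?pospart_1Bsqr_le1.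
move: P P0 P1 => P P0 P1; rewrite !normrM !normr_nat (ger0_norm P0) -[leRHS]mulr1 -mulrA ler_wpM2l ?mulr_ge0//.
by rewrite mulr_ile1 ?(ltW t1).
Qed.

Lemma ddbump1_le k t :
  `|ddbump1 k t| <= 4 * k.+3%:R ^+ 2 * pospart (1 - t ^+ 2) ^+ k.+1.
Proof.
have [t1|t1] := leP 1 `|t|.
  by rewrite /ddbump1 pospart_1Bsqr_eq0// !expr0n !mulr0 subr0 normr0.
rewrite /ddbump1; have := pospart_1Bsqr_le1 t; have := pospart_ge0 (1 - t ^+ 2).
move: (pospart _) => P P0 P1.
have t2 : 0 <= t ^+ 2 <= 1.
  by rewrite sqr_ge0/= -real_normK ?num_real// exprn_ile1// ltW.
have k0 : 0 <= k%:R :> R by [].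
rewrite (exprS P k.+1); have : 0 <= P ^+ k.+1 by exact: exprn_ge0.
move: (P ^+ k.+1) => Q Q0.
rewrite (_ : _ - _ = (4 * k.+3%:R * k.+2%:R * t ^+ 2 - 2 * k.+3%:R * P) * Q); last by ring.
rewrite normrM (ger0_norm Q0) ler_wpM2r//.
rewrite -!(natr1 k.+2) -!(natr1 k.+1) -!(natr1 k).
have K0 : 0 <= (k%:R : R) + 1 by lra.
move: t2 => /andP[]; move: (t ^+ 2) (k%:R + 1 : R) P P0 P1 K0 => s K P P0 P1 K0 s0 s1.
have H1 : 0 <= (K + 1 + 1) * (K + 1) * s by rewrite !mulr_ge0//; lra.
have H2 : 0 <= (K + 1 + 1) * (1 - P) by rewrite !mulr_ge0//; lra.
have H3 : 0 <= (K + 1 + 1) * (K + 1) * (1 - s) by rewrite !mulr_ge0//; lra.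
have H4 : 0 <= (K + 1 + 1) * P by rewrite !mulr_ge0//; lra.
have H5 : 0 <= (K + 1 + 1) * (K + 1) by rewrite !mulr_ge0//; lra.
by rewrite ler_norml; apply/andP; split; nra.
Qed.

Lemma ddbump1_le_cst k t : `|ddbump1 k t| <= 4 * k.+3%:R ^+ 2.
Proof.
apply: le_trans (ddbump1_le k t) _; rewrite ler_piMr ?mulr_ge0//.
by rewrite exprn_ile1 ?pospart_ge0 ?pospart_1Bsqr_le1.
Qed.

Lemma continuous_pospart_1BsqrX k : continuous (fun t : R => pospart (1 - t ^+ 2) ^+ k).
Proof.
move=> t; apply: (@continuous_comp _ _ _ (fun t : R => pospart (1 - t ^+ 2)) (fun z => z ^+ k));
  last exact: exprn_continuous.
apply: (@continuous_comp _ _ _ (fun t : R => 1 - t ^+ 2) pospart);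
  last exact: continuous_pospart.
by apply: continuousB; [exact: cvg_cst|exact: exprn_continuous].
Qed.

Lemma continuous_bump1 k : continuous (bump1 k).
Proof. exact: continuous_pospart_1BsqrX. Qed.

Lemma continuous_dbump1 k : continuous (dbump1 k).
Proof.
move=> t; rewrite /dbump1; apply: cvgN; apply: cvgM; last exact: continuous_pospart_1BsqrX.
by apply: cvgM; [exact: cvg_cst|exact: cvg_id].
Qed.

Lemma continuous_ddbump1 k : continuous (ddbump1 k).
Proof.
move=> t; rewrite /ddbump1; apply: cvgB.
  apply: cvgM; last exact: continuous_pospart_1BsqrX.
  by apply: cvgM; [exact: cvg_cst|exact: exprn_continuous].
by apply: cvgM; [exact: cvg_cst|exact: continuous_pospart_1BsqrX].
Qed.

Lemma bump1_lipschitz k x y : `|bump1 k y - bump1 k x| <= 2 * k.+3%:R * `|y - x|.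
Proof.
exact: (lipschitz_is_derive (fun x => is_derive_bump1 k x) (fun x => dbump1_le k x)).
Qed.

Lemma bump1_second_difference k x h :
  `|bump1 k (x + h) + bump1 k (x - h) - 2 * bump1 k x|
    <= 8 * k.+3%:R ^+ 2 * h ^+ 2.
Proof.
rewrite (_ : 8 * _ = 2 * (4 * k.+3%:R ^+ 2)); last by ring.
apply: (second_difference_is_derive (fun x => is_derive_bump1 k x)) => {}x y.
exact: (lipschitz_is_derive (fun x => is_derive_dbump1 k x) (fun x => ddbump1_le_cst k x)).
Qed.

End bump_one_variable.

Section product_functions.
Context {R : realType} {n : nat}.
Implicit Types (g dg : 'I_n -> R -> R) (x z : 'rV[R]_n) (i j : 'I_n).

Definition rV_prod g x : R := \prod_i g i (x ord0 i).

Lemma is_derive_rV_prod g i d x :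
  is_derive (x ord0 i) 1 (g i) d ->
  is_derive x (delta_mx ord0 i) (rV_prod g)
    (d * \prod_(j | j != i) g j (x ord0 j)).
Proof.
move=> /is_derive_cvg gd; apply: cvg_is_derive.
rewrite (_ : (fun h => _) = (fun h => h^-1 *: (g i (h *: 1 + x ord0 i) - g i (x ord0 i)) *
    \prod_(j | j != i) g j (x ord0 j))).
  by apply: cvgM => //; exact: cvg_cst.
apply/funext => h; rewrite /rV_prod (bigD1 i)//= [X in _ - X](bigD1 i)//=.
rewrite (eq_bigr (fun j => g j (x ord0 j))) => [|j ji]; last first.
  by rewrite !mxE eqxx (negbTE ji) mulr0 add0r.
by rewrite !mxE !eqxx /GRing.scale/= -mulrBl mulrA.
Qed.

Lemma continuous_rV_coord i : continuous (fun x : 'rV[R]_n => x ord0 i).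
Proof. exact: coord_continuous. Qed.

Lemma continuous_rV_prod g : (forall i, continuous (g i)) -> continuous (rV_prod g).
Proof.
move=> cg; rewrite /rV_prod; elim: (index_enum _) => [|i s ih].
  rewrite (_ : (fun x => _) = cst 1); first exact: cst_continuous.
  by apply/funext => x; rewrite big_nil.
rewrite (_ : (fun x => _) = (fun x => g i (x ord0 i) * \prod_(j <- s) g j (x ord0 j))).
  move=> x; apply: continuousM; last exact: ih.
  exact: (@continuous_comp _ _ _ (fun x : 'rV[R]_n => x ord0 i) (g i) x
    (@continuous_rV_coord i x) (cg i _)).
by apply/funext => x; rewrite big_cons.
Qed.

Lemma measurable_rV_prod g : (forall i, continuous (g i)) ->
  measurable_fun setT (rV_prod g).
Proof.
move=> cg; apply: measurable_prod => i _.
apply: (@measurableT_comp _ _ _ _ _ _ (g i)); last exact: measurable_rV_coord.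
exact: continuous_measurable_fun.
Qed.

(** Induction on the number of factors, carrying along the bounds on the partial product and on its
    first difference, which enter the cross terms of the second difference. *)
Lemma prod_second_difference (f : 'I_n -> 'rV[R]_n -> R) (L M : R) :
  0 <= L -> 0 <= M -> (forall i x, `|f i x| <= 1) ->
  (forall i x z, `|f i (x + z) - f i x| <= L * `|z|) ->
  (forall i x z, `|f i (x + z) + f i (x - z) - 2 * f i x| <= M * `|z| ^+ 2) ->
  exists2 C, 0 <= C & forall x z,
    `|\prod_i f i (x + z) + \prod_i f i (x - z) - 2 * \prod_i f i x| <= C * `|z| ^+ 2.
Proof.
move=> L0 M0 f1 fL fM.
suff [L' [M' [L'0 M'0 H]]] : exists L' M', [/\ 0 <= L', 0 <= M' & forall x z,
    [/\ `|\prod_i f i x| <= 1,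
       `|\prod_i f i (x + z) - \prod_i f i x| <= L' * `|z| &
       `|\prod_i f i (x + z) + \prod_i f i (x - z) - 2 * \prod_i f i x| <= M' * `|z| ^+ 2]].
  by exists M' => // x z; case: (H x z).
elim: (index_enum _) => [|i s [L' [M' [L'0 M'0 ih]]]].
  exists 0, 0; split => // x z; rewrite !big_nil subrr !mul0r normr0 normr1; split => //.
  by rewrite (_ : _ - _ = 0) ?normr0//; ring.
exists (L + L'), (M + M' + 2 * L * L'); split => [||x z]; rewrite ?addr_ge0// ?mulr_ge0//.
rewrite !big_cons; move: (\prod_(j <- s) f j x) (\prod_(j <- s) f j (x + z))
  (\prod_(j <- s) f j (x - z)) (ih x z) (ih x (- z)) (f1 i x) (f1 i (x + z))
  (fL i x z) (fL i x (- z)) (fM i x z).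
rewrite normrN; move: (f i x) (f i (x + z)) (f i (x - z)) `|z| (normr_ge0 z).
move=> a b c w w0 A B C [A1 BA BCA] [_ CA _] a1 b1 ba ca bca; split.
- by rewrite normrM mulr_ile1.
- rewrite (_ : _ - _ = b * (B - A) + (b - a) * A); last by ring.
  apply: le_trans (ler_normD _ _) _; rewrite [leLHS]addrC [leRHS]mulrDl !normrM; apply: lerD.
    by rewrite -[leRHS]mulr1 ler_pM.
  by rewrite -[leRHS]mul1r ler_pM.
(* Discrete Leibniz rule: a second difference of either factor times a value of the other, plus two
   products of first differences, which account for [2 * L * L']. *)
- rewrite (_ : _ - _ = a * (B + C - 2 * A) + (b + c - 2 * a) * A
    + ((b - a) * (B - A) + (c - a) * (C - A))); last by ring.
  apply: le_trans (ler_normD _ _) _; rewrite [leRHS](_ : _ =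
    M' * w ^+ 2 + M * w ^+ 2 + (L * w * (L' * w) + L * w * (L' * w))); last by ring.
  apply: lerD; apply: le_trans (ler_normD _ _) _; apply: lerD; rewrite normrM.
  + by rewrite -[leRHS]mul1r ler_pM.
  + by rewrite -[leRHS]mulr1 ler_pM.
  + by rewrite ler_pM.
  + by rewrite ler_pM.
Qed.

End product_functions.

Section bump.
Context {R : realType} {n : nat}.
Implicit Types (x a z : 'rV[R]_n) (r c t : R) (k : nat) (i j : 'I_n).

Definition bump_factor k a r i (t : R) : R := bump1 k ((t - a ord0 i) / r).
Definition dbump_factor k a r i (t : R) : R := dbump1 k ((t - a ord0 i) / r) / r.
Definition ddbump_factor k a r i (t : R) : R := ddbump1 k ((t - a ord0 i) / r) / r ^+ 2.

Definition bump_rV k a r x : R := rV_prod (bump_factor k a r) x.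

Lemma bump_ge0 k a r x : 0 <= bump_rV k a r x.
Proof. by apply: prodr_ge0 => i _; exact: bump1_ge0. Qed.

Lemma bump_le1 k a r x : bump_rV k a r x <= 1.
Proof. by apply: prodr_ile1 => i _; rewrite bump1_ge0 bump1_le1. Qed.

Lemma bump_eq0 k a r x : 0 < r -> r <= `|x - a| -> bump_rV k a r x = 0.
Proof.
move=> r0 rx; have [i ri] : exists i, r <= `|x ord0 i - a ord0 i|.
  apply: contrapT => /forallNP h; move: rx; apply/negP; rewrite -ltNge.
  have [->//|xa0] := eqVneq (`|x - a|) 0.
  have [[i' i] /= E] := mx_norm_neq0 (xa0 : mx_norm (x - a) != 0).
  have -> : `|x - a| = `|(x - a) i' i| := E.
  by rewrite (ord1 i') !mxE ltNge; apply/negP.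
rewrite /bump_rV /rV_prod (bigD1 i)//= /bump_factor bump1_eq0 ?mul0r//.
by rewrite normrM normfV (gtr0_norm r0) ler_pdivlMr// mul1r.
Qed.

(** [7 / 16] is [1 - (3 / 4) ^+ 2], and each of the [n] factors carries the exponent [k.+3]. *)
Lemma bump_ge k a r x : 0 < r -> `|x - a| <= 3 / 4 * r ->
  (7 / 16) ^+ (k.+3 * n) <= bump_rV k a r x.
Proof.
move=> r0 xa; rewrite exprM -[X in _ ^+ X](card_ord n) -prodr_const.
apply: ler_prod => i _; apply/andP; split; first by rewrite exprn_ge0//; lra.
apply: bump1_ge; first lra.
have := le_trans (rV_coord_le (x - a) i) xa; rewrite !mxE.
have -> : (x ord0 i - a ord0 i) = ((x ord0 i - a ord0 i) / r) * r by rewrite divfK ?gt_eqF.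
rewrite mulfK ?gt_eqF//; move: (_ / r) => u.
rewrite normrM (gtr0_norm r0) ler_pM2r// ler_norml => /andP[u1 u2].
by nra.
Qed.

Lemma is_derive_bump_factor k a r i t :
  is_derive t 1 (bump_factor k a r i) (dbump_factor k a r i t).
Proof.
have H : is_derive t 1 (fun t : R => (t - a ord0 i) / r) (1 / r).
  rewrite (_ : (fun t => _) = (fun t => r^-1 *: (id t - cst (a ord0 i) t))); last first.
    by apply/funext => u; rewrite /GRing.scale/= mulrC.
  have := is_deriveZ r^-1 (is_deriveB (is_derive_id t (1 : R)) (is_derive_cst (a ord0 i) t 1)).
  by rewrite subr0 /GRing.scale/= mulr1 mul1r.
have := @is_derive1_comp R _ (fun t => (t - a ord0 i) / r) t _ _
  (is_derive_bump1 k _) H.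
by rewrite mulrA mulr1.
Qed.

Lemma is_derive_dbump_factor k a r i t :
  is_derive t 1 (dbump_factor k a r i) (ddbump_factor k a r i t).
Proof.
have H : is_derive t 1 (fun t : R => (t - a ord0 i) / r) (1 / r).
  rewrite (_ : (fun t => _) = (fun t => r^-1 *: (id t - cst (a ord0 i) t))); last first.
    by apply/funext => u; rewrite /GRing.scale/= mulrC.
  have := is_deriveZ r^-1 (is_deriveB (is_derive_id t (1 : R)) (is_derive_cst (a ord0 i) t 1)).
  by rewrite subr0 /GRing.scale/= mulr1 mul1r.
have := is_deriveZ r^-1 (@is_derive1_comp R _ (fun t => (t - a ord0 i) / r) t _ _
  (is_derive_dbump1 k _) H).
rewrite (_ : _ \*: _ = dbump_factor k a r i); last first.
  by apply/funext => u; rewrite /dbump_factor /GRing.scale/= -[_ *: _]/(_ * _) mulrC.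
rewrite (_ : r^-1 *: _ = ddbump_factor k a r i t)//.
by rewrite /ddbump_factor expr2 invfM /GRing.scale/= mul1r; ring.
Qed.

Let continuous_scale k (f : R -> R) a r i : continuous f ->
  continuous (fun t => f ((t - a ord0 i) / r)).
Proof.
move=> cf t; apply: (@continuous_comp _ _ _ (fun t => (t - a ord0 i) / r) f); last exact: cf.
by apply: cvgM; [apply: cvgB; [exact: cvg_id|exact: cvg_cst]|exact: cvg_cst].
Qed.

Lemma continuous_bump_factor k a r i : continuous (bump_factor k a r i).
Proof. by apply: (continuous_scale k); exact: continuous_bump1. Qed.

Lemma continuous_dbump_factor k a r i : continuous (dbump_factor k a r i).
Proof.
move=> t; apply: cvgM; last exact: cvg_cst.
by apply: (continuous_scale k); exact: continuous_dbump1.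
Qed.

Lemma continuous_ddbump_factor k a r i : continuous (ddbump_factor k a r i).
Proof.
move=> t; apply: cvgM; last exact: cvg_cst.
by apply: (continuous_scale k); exact: continuous_ddbump1.
Qed.

Lemma measurable_bump k a r : measurable_fun setT (bump_rV k a r).
Proof. by apply: measurable_rV_prod => i; exact: continuous_bump_factor. Qed.

(** The rescaling [(x - a) / r] reduces to the unscaled product, so [C] depends only on [k] and on
    the dimension. *)
Lemma bump_second_difference k : exists2 C, 0 < C & forall a r, 0 < r -> forall x z,
  `|bump_rV k a r (x + z) + bump_rV k a r (x - z) - 2 * bump_rV k a r x| <= C * (`|z| / r) ^+ 2.
Proof.
have [||i x|i x z|i x z|C C0 H] := @prod_second_difference R n
  (fun i x => bump1 k (x ord0 i)) (2 * k.+3%:R) (8 * k.+3%:R ^+ 2).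
- by rewrite mulr_ge0.
- by rewrite mulr_ge0.
- by rewrite ger0_norm ?bump1_ge0 ?bump1_le1.
- rewrite !mxE; apply: le_trans (bump1_lipschitz _ _ _) _.
  rewrite (_ : x ord0 i + z ord0 i - x ord0 i = z ord0 i); last by ring.
  by rewrite ler_wpM2l ?mulr_ge0// rV_coord_le.
- rewrite !mxE; apply: le_trans (bump1_second_difference _ _ _) _.
  rewrite ler_wpM2l ?mulr_ge0// -real_normK ?num_real//.
  by rewrite lerXn2r ?nnegrE// rV_coord_le.
exists (C + 1); first by rewrite ltr_wpDl.
move=> a r r0 x z; apply: (@le_trans _ _ (C * (`|z| / r) ^+ 2)); last first.
  by rewrite ler_wpM2r ?sqr_ge0// lerDl.
have -> : `|z| / r = `|r^-1 *: z| by rewrite mx_normZ normfV (gtr0_norm r0) mulrC.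
have E y : bump_rV k a r y = \prod_i bump1 k ((r^-1 *: (y - a)) ord0 i).
  by apply: eq_bigr => i _; rewrite !mxE /bump_factor mulrC.
rewrite !E; have := H (r^-1 *: (x - a)) (r^-1 *: z).
by rewrite -scalerDr -scalerBr (addrAC x z) (addrAC x (- z)).
Qed.

End bump.

(** * The fractional Laplacian of a bump *)

Section dyadic.
Context {R : realType} {n : nat}.
Implicit Types (x y : 'rV[R]_n) (B q r alpha d : R).
Local Notation mu := (@lebesgue_rV R n).

(** Stands in for polar coordinates: [g] is below the series of [B * q ^+ j / (2 * rho j) ^+ n]
    times the indicator of the cube of radius [rho j], and the [j]-th term has integral at most
    [B * q ^+ j]. *)
Lemma integral_le_dyadic x (D : set 'rV[R]_n) (g : 'rV[R]_n -> R) (rho : nat -> R) B q :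
  measurable D -> measurable_fun D g -> (forall y, D y -> 0 <= g y) ->
  0 <= B -> 0 < q < 1 -> (forall j, 0 < rho j) ->
  (forall y, D y -> exists j, `|y - x| <= rho j /\ g y * (2 * rho j) ^+ n <= B * q ^+ j) ->
  (\int[mu]_(y in D) (g y)%:E <= (B / (1 - q))%:E)%E.
Proof.
move=> mD mg g0 B0 /andP[q0 q1] rho0 H.
pose b j : R := B * q ^+ j / (2 * rho j) ^+ n.
have b0 j : 0 <= b j.
  by rewrite divr_ge0 ?exprn_ge0 ?mulr_ge0 ?exprn_ge0 ?(ltW q0)// ltW.
pose f j y : \bar R := ((b j)%:E * (\1_(cube x (rho j)) y)%:E)%E.
have f0 j y : (0 <= f j y)%E by rewrite mule_ge0 ?lee_fin.
have mf j (A : set 'rV[R]_n) : measurable_fun A (f j).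
  apply: emeasurable_funM => //; apply/measurable_EFinP.
  exact: measurable_indic (measurable_cube _ _).
apply: (@le_trans _ _ (\int[mu]_(y in D) (\sum_(0 <= j <oo) f j y))%E).
  apply: ge0_le_integral => //.
  - exact/measurable_EFinP.
  - by apply: ge0_emeasurable_sum.
  - move=> y Dy; have [j [yj gj]] := H y Dy.
    apply: (@le_trans _ _ (f j y)).
      rewrite /f indicE mem_set ?mule1; last exact: yj.
      by rewrite lee_fin /b ler_pdivlMr// exprn_gt0// mulr_gt0.
    rewrite (nneseriesD1 (n := j))//.
    by rewrite leeDl// nneseries_ge0.
rewrite integral_nneseries//.
apply: (@le_trans _ _ (\sum_(0 <= j <oo) (B * q ^+ j)%:E))%E.
  apply: lee_nneseries => j *; first exact: integral_ge0.
  apply: (@le_trans _ _ (\int[mu]_y f j y)%E); first exact: ge0_subset_integral.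
  rewrite ge0_integralZl_EFin//; last first.
    by apply/measurable_EFinP; exact: measurable_indic (measurable_cube _ _).
  rewrite integral_indic//; last exact: measurable_cube.
  rewrite setIT [X in (_ * X <= _)%E]lebesgue_rV_cube ?(ltW (rho0 j))// -EFinM lee_fin.
  by rewrite /b divfK// gt_eqF// exprn_gt0// mulr_gt0.
rewrite (cvg_lim _ (l := (B / (1 - q))%:E))//.
rewrite (_ : (fun _ => _) = EFin \o series (geometric B q)).
  by apply: cvg_EFin; [near=> k|apply: cvg_geometric_series; rewrite ger0_norm// ltW].
by apply/funext => k; rewrite /= /series/= sumEFin.
Unshelve. all: by end_near. Qed.

Lemma dyadic_up (r t : R) : 0 < r -> r < t -> exists j, r * 2 ^+ j < t <= r * 2 ^+ j.+1.
Proof.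
move=> r0 rt; have ex : exists j, t <= r * 2 ^+ j.
  exists (Num.truncn (t / r)).+1; rewrite mulrC -ler_pdivrMr//.
  apply: (le_trans (ltW (truncnS_gt _))); rewrite -natrX ler_nat.
  exact/ltnW/ltn_expl.
have := ex_minnP ex; case=> -[|j] tj jmin.
  by move: tj; rewrite expr0 mulr1 leNgt rt.
exists j; rewrite tj andbT ltNge; apply/negP => /jmin.
by rewrite ltnn.
Qed.

Lemma dyadic_down (r t : R) : 0 < t -> t <= r ->
  exists j, r * 2^-1 ^+ j.+1 < t <= r * 2^-1 ^+ j.
Proof.
move=> t0 tr; have r0 : 0 < r by exact: lt_le_trans tr.
have ex : exists j, r * 2^-1 ^+ j.+1 < t.
  exists (Num.truncn (r / t)); rewrite exprVn ltr_pdivrMr ?exprn_gt0//.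
  rewrite mulrC -ltr_pdivrMr//; apply: (lt_trans (truncnS_gt _)).
  by rewrite -natrX ltr_nat ltn_expl.
have := ex_minnP ex; case=> -[|j] tj jmin.
  by exists 0%N; rewrite tj expr0 mulr1.
exists j.+1; rewrite tj /= leNgt; apply/negP => /jmin.
by rewrite ltnn.
Qed.

Lemma le_powR (x y p : R) : 0 <= p -> 0 <= x -> x <= y -> x `^ p <= y `^ p.
Proof.
by move=> p0 x0 xy; have := ge0_ler_powR p0; apply; rewrite ?nnegrE// (le_trans x0).
Qed.

Lemma lt_powR (x y p : R) : 0 < p -> 0 <= x -> x < y -> x `^ p < y `^ p.
Proof.
move=> p0 x0 xy; have := gt0_ltr_powR p0; apply; rewrite ?nnegrE//.
by rewrite (le_trans x0)// ltW.
Qed.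

Lemma gt1_powR (x p : R) : 1 < x -> 0 < p -> 1 < x `^ p.
Proof.
by move=> x1 p0; have := lt_powR p0 ler01 x1; rewrite powR1.
Qed.

Lemma powR_ltr0 (x y p : R) : p <= 0 -> 0 < x -> x <= y -> y `^ p <= x `^ p.
Proof.
have [m ->] : exists m, p = - m by exists (- p); rewrite opprK.
rewrite oppr_le0 => m0 x0 xy; have y0 := lt_le_trans x0 xy.
by rewrite !powRN lef_pV2 ?posrE ?powR_gt0// le_powR// ltW.
Qed.

Lemma powR_exprn_mul (x p : R) k : 0 < x -> (x ^+ k) `^ p = (x `^ p) ^+ k.
Proof.
move=> x0; rewrite -powR_mulrn ?(ltW x0)// -powRrM mulrC powRrM powR_mulrn//.
exact: powR_ge0.
Qed.

Lemma measurable_powR_dist x p (D : set 'rV[R]_n) :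
  measurable_fun D (fun y => `|y - x| `^ p).
Proof.
apply: measurable_funTS.
by apply: (@measurableT_comp _ _ _ _ _ _ (@powR R ^~ p)) => //; exact: measurable_rV_norm.
Qed.

(** Size of the kernel at distance [rho] times the volume of a cube of radius [2 * rho]: the
    dimension cancels. *)
Lemma powR_dim (rho d : R) : 0 < rho -> rho `^ (- (n%:R + d)) * (2 * (2 * rho)) ^+ n =
  4 ^+ n * rho `^ (- d).
Proof.
move=> r0; rewrite opprD powRD; last by apply/implyP => _; rewrite gt_eqF.
have -> : (2 * (2 * rho)) ^+ n = 4 ^+ n * rho ^+ n by rewrite mulrA -natrM exprMn.
have -> : rho `^ (- n%:R) = (rho ^+ n)^-1 by rewrite powRN powR_mulrn ?(ltW r0).
have : rho ^+ n != 0 by rewrite expf_neq0// gt_eqF.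
by move: (rho ^+ n) (4 ^+ n) (rho `^ _) => u v w u0; field.
Qed.

(** Shells [r * 2 ^+ j < |y - x| <= r * 2 ^+ j.+1]; the bounds on consecutive shells have ratio
    [2 ^ (- d)], below 1 since [d > 0]. *)
Lemma integral_far_le d : 0 < d -> exists2 C, 0 < C & forall x r, 0 < r ->
  (\int[mu]_(y in [set y : 'rV[R]_n | (r < `|y - x|)%R]) (`|y - x| `^ (- (n%:R + d)))%R%:E
    <= (C * r `^ (- d))%:E)%E.
Proof.
move=> d0; pose q : R := 2 `^ (- d).
have q1 : 0 < q < 1.
  rewrite powR_gt0//= /q powRN invf_lt1 ?powR_gt0//.
  by apply: gt1_powR; lra.
exists (4 ^+ n / (1 - q)) => [|x r r0].
  by rewrite divr_gt0 ?exprn_gt0//; lra.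
rewrite mulrAC; apply: (@integral_le_dyadic x _ _ (fun j => r * 2 ^+ j.+1)) => //.
- have := measurable_rV_norm x measurableT (measurable_itv `]r, +oo[%R).
  rewrite setTI (_ : _ @^-1` _ = [set y | r < `|y - x|])//.
  by apply/seteqP; split => y /=; rewrite in_itv/= andbT.
- exact: measurable_powR_dist.
- by rewrite mulr_ge0 ?exprn_ge0 ?powR_ge0.
- by move=> j; rewrite mulr_gt0 ?exprn_gt0.
- move=> y /= ry; have [j /andP[j1 j2]] := dyadic_up r0 ry.
  exists j; split => //; have rj : 0 < r * 2 ^+ j by rewrite mulr_gt0 ?exprn_gt0.
  apply: (@le_trans _ _ ((r * 2 ^+ j) `^ (- (n%:R + d)) * (2 * (r * 2 ^+ j.+1)) ^+ n)).
    rewrite ler_wpM2r ?exprn_ge0 ?mulr_ge0 ?exprn_ge0 ?(ltW r0)//.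
    by rewrite powR_ltr0 ?(ltW j1)// oppr_le0 addr_ge0// ltW.
  rewrite (_ : r * 2 ^+ j.+1 = 2 * (r * 2 ^+ j)); last by rewrite exprS; ring.
  by rewrite powR_dim// powRM ?exprn_ge0 ?(ltW r0)// powR_exprn_mul// mulrA.
Qed.

(** Shells shrinking towards [x]; the extra square turns the ratio into [2^-1 ^ (2 - d)], below 1
    since [d < 2]. *)
Lemma integral_near_le d : 0 < d < 2 -> exists2 C, 0 < C & forall x r, 0 < r ->
  (\int[mu]_(y in [set y : 'rV[R]_n | (0 < `|y - x| <= r)%R])
      (`|y - x| ^+ 2 * `|y - x| `^ (- (n%:R + d)))%R%:E
    <= (C * (r ^+ 2 * r `^ (- d)))%:E)%E.
Proof.
move=> /andP[d0 d2]; pose q : R := 2^-1 `^ (2 - d).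
have q1 : 0 < q < 1.
  rewrite powR_gt0 ?invr_gt0//= /q -powR_inv1// -powRrM mulN1r powRN.
  by rewrite invf_lt1 ?powR_gt0//; apply: gt1_powR; lra.
pose C0 : R := 2 ^+ 2 * (4 ^+ n * (2^-1 ^+ 2 * 2^-1 `^ (- d))).
have C00 : 0 < C0 by rewrite !mulr_gt0 ?exprn_gt0 ?powR_gt0 ?invr_gt0.
exists (C0 / (1 - q)) => [|x r r0]; first by rewrite divr_gt0//; lra.
rewrite mulrAC; apply: (@integral_le_dyadic x _ _ (fun j => r * 2^-1 ^+ j)) => //.
- have := measurable_rV_norm x measurableT (measurable_itv `]0, r]%R).
  rewrite setTI (_ : _ @^-1` _ = [set y | 0 < `|y - x| <= r])//.
- apply: measurable_funM; last exact: measurable_powR_dist.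
  by apply: measurable_funTS; apply: measurable_funX; exact: measurable_rV_norm.
- by apply: mulr_ge0; [exact: ltW|rewrite mulr_ge0 ?exprn_ge0 ?powR_ge0 ?(ltW r0)].
- by move=> j; rewrite mulr_gt0 ?exprn_gt0 ?invr_gt0.
- move=> y /= /andP[y0 yr]; have [j /andP[j1 j2]] := dyadic_down y0 yr.
  exists j; split => //; set rho := r * 2^-1 ^+ j.+1.
  have rho0 : 0 < rho by rewrite mulr_gt0 ?exprn_gt0 ?invr_gt0.
  have E : r * 2^-1 ^+ j = 2 * rho by rewrite /rho exprS; field.
  apply: (@le_trans _ _ ((2 * rho) ^+ 2 * rho `^ (- (n%:R + d)) * (2 * (r * 2^-1 ^+ j)) ^+ n)).
    rewrite ler_wpM2r ?exprn_ge0 ?mulr_ge0 ?exprn_ge0 ?invr_ge0 ?(ltW r0)//.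
    rewrite ler_pM ?exprn_ge0 ?powR_ge0//.
      by rewrite lerXn2r ?nnegrE -?E// mulr_ge0 ?exprn_ge0 ?invr_ge0 ?(ltW r0).
    by rewrite powR_ltr0 ?(ltW j1)// oppr_le0 addr_ge0// ltW.
  rewrite E -mulrA powR_dim//.
  rewrite [leLHS](_ : _ = 2 ^+ 2 * (4 ^+ n * (rho ^+ 2 * rho `^ (- d)))); last by ring.
  have -> : rho = r * 2^-1 * 2^-1 ^+ j by rewrite /rho exprS mulrA.
  have -> : (r * 2^-1 * 2^-1 ^+ j) `^ (- d) = r `^ (- d) * 2^-1 `^ (- d) * (2^-1 `^ (- d)) ^+ j.
    rewrite powRM ?mulr_ge0 ?exprn_ge0 ?invr_ge0 ?(ltW r0)// powR_exprn_mul ?invr_gt0//.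
    by rewrite powRM ?invr_ge0 ?(ltW r0).
  have -> : q = 2^-1 ^+ 2 * 2^-1 `^ (- d).
    by rewrite /q powRD ?powR_mulrn ?invr_ge0//; apply/implyP => _; rewrite gt_eqF ?invr_gt0.
  rewrite [X in _ <= _ * X]exprMn -(exprM _ 2 j) mulnC exprM /C0.
  move: (2^-1 ^+ j) (2^-1 `^ (- d)) ((_ `^ _) ^+ j) (r `^ (- d)) => w u uj v.
  by rewrite [leLHS](_ : _ = 2 ^+ 2 * (4 ^+ n * (2^-1 ^+ 2 * u)) * (r ^+ 2 * v) * (w ^+ 2 * uj))//; ring.
Qed.

End dyadic.

(** * Upper and lower bounds through the truncated integrals *)

Section fraclap_bounds.
Context {R : realType} {n : nat} (n0 : (0 < n)%N).
Variables (s : R) (s0 : 0 < s) (s1 : s < 1).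
Implicit Types (x y z a : 'rV[R]_n) (e r c : R).
Local Notation mu := (@lebesgue_rV R n).
Let alpha : R := n%:R + 2 * s.

Let alpha0 : 0 < alpha.
Proof. by rewrite ltr_wpDl// mulr_gt0. Qed.

(** Where the limit does not exist, [lim] returns the default value 0, so that case satisfies the
    bound too. *)
Lemma norm_lim_le (F : R -> R) M : 0 <= M -> (forall e, 0 < e -> `|F e| <= M) ->
  `|lim (F e @[e --> 0^'+])| <= M.
Proof.
move=> M0 FM; have [cF|] := pselect (cvg (F e @[e --> 0^'+])); last first.
  by move=> /dvgP ->; rewrite normr0.
have nF : \forall e \near 0^'+, `|F e| <= M.
  by near=> e; apply: FM; near: e; exact: nbhs_right_gt.
rewrite ler_norml; apply/andP; split.
  by apply: limr_ge => //; apply: filterS nF => e; rewrite ler_norml => /andP[].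
by apply: limr_le => //; apply: filterS nF => e; rewrite ler_norml => /andP[].
Unshelve. all: by end_near. Qed.

Lemma enormN x : enorm (- x) = enorm x.
Proof. by congr Num.sqrt; apply: eq_bigr => i _; rewrite mxE sqrrN. Qed.

Lemma integral_rV_reflect a (f : 'rV[R]_n -> \bar R) : measurable_fun setT f ->
  (\int[mu]_y f (a - y)%R = \int[mu]_y f y)%E.
Proof.
move=> mf; rewrite integralE [RHS]integralE; congr (_ - _)%E.
  rewrite -(ge0_integral_rV_reflect a (measurable_funepos mf))//.
  by apply: eq_integral => y _; rewrite !funeposE.
rewrite -(ge0_integral_rV_reflect a (measurable_funeneg mf))//.
by apply: eq_integral => y _; rewrite !funenegE.
Qed.

Lemma integral_rV_reflect_on a (D : set 'rV[R]_n) (f : 'rV[R]_n -> \bar R) :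
  measurable D -> (forall y, D (a - y) = D y) -> measurable_fun D f ->
  (\int[mu]_(y in D) f (a - y)%R = \int[mu]_(y in D) f y)%E.
Proof.
move=> mD DE mf; rewrite [RHS]integral_mkcond -(integral_rV_reflect a); last first.
  exact: (measurable_restrictT f mD).1.
rewrite [LHS]integral_mkcond; apply: eq_integral => y _; rewrite !patchE.
have -> // : (a - y \in D) = (y \in D).
by apply/idP/idP => /set_mem; rewrite ?DE => Dy; apply/mem_set; rewrite ?DE.
Qed.

(** Symmetrization under [y -> a - y]. With [a = x + x] it cancels the first-order part of the
    difference [v x - v y] near [x]. *)
Lemma integrable_rV_symmetrize a (D : set 'rV[R]_n) (f : 'rV[R]_n -> R) :
  measurable D -> (forall y, D (a - y) = D y) -> measurable_fun setT f ->
  mu.-integrable D (EFin \o f) ->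
  2 * (\int[mu]_(y in D) f y) = \int[mu]_(y in D) (f y + f (a - y)) /\
  mu.-integrable D (EFin \o (fun y => f y + f (a - y))).
Proof.
move=> mD DE mf iF.
have iH : mu.-integrable D (EFin \o (fun y => f (a - y))).
  apply/integrableP; split.
    apply/measurable_EFinP; apply: measurable_funTS.
    by apply: (@measurableT_comp _ _ _ _ _ _ f) => //; exact: measurable_rV_reflect.
  rewrite (integral_rV_reflect_on (f := fun y => `|(f y)%:E|%E) mD DE).
    by move/integrableP : iF => [].
  by apply: measurableT_comp => //; apply/measurable_EFinP; exact: measurable_funTS.
split; last exact: (integrableD mD iF iH).
rewrite (RintegralD mD iF iH) /Rintegral.
have -> : (\int[mu]_(y in D) (f (a - y)%R)%:E = \int[mu]_(y in D) (f y)%:E)%E.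
  apply: (integral_rV_reflect_on (f := fun y => (f y)%:E) mD DE).
  by apply/measurable_EFinP; exact: measurable_funTS.
by ring.
Qed.

Lemma measurable_enorm_powR x (p : R) (D : set 'rV[R]_n) :
  measurable_fun D (fun y => (enorm (x - y) `^ p)^-1).
Proof.
under eq_fun do rewrite -powRN; apply: measurable_funTS.
by apply: (@measurableT_comp _ _ _ _ _ _ (@powR R ^~ (- p))) => //; exact: measurable_enorm.
Qed.

Definition outer e x : set 'rV[R]_n := [set y | e < enorm (x - y)].

Lemma measurable_outer e x : measurable (outer e x).
Proof.
have := measurable_enorm x measurableT (measurable_itv `]e, +oo[%R).
rewrite setTI (_ : _ @^-1` _ = outer e x)//.
by apply/seteqP; split => y /=; rewrite in_itv/= andbT.
Qed.

Lemma enorm_powRV_le x y : y != x -> (enorm (x - y) `^ alpha)^-1 <= `|y - x| `^ (- alpha).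
Proof.
move=> yx; have d0 : 0 < `|y - x| by rewrite normr_gt0 subr_eq0.
by rewrite -powRN powR_ltr0 ?oppr_le0 ?(ltW alpha0)// distrC norm_le_enorm.
Qed.

Lemma outer_norm e x y : 0 < e -> outer e x y -> e / (2 * n%:R) < `|y - x|.
Proof.
rewrite /outer/= => e0 xy; have N0 : 0 < n%:R :> R by rewrite ltr0n.
rewrite ltr_pdivrMr ?mulr_gt0//.
have := enorm_le_norm (x - y); rewrite distrC => h.
have := normr_ge0 (y - x); nra.
Qed.

Lemma measurable_far r x : measurable [set y : 'rV[R]_n | r < `|y - x|].
Proof.
have := measurable_rV_norm x measurableT (measurable_itv `]r, +oo[%R).
rewrite setTI (_ : _ @^-1` _ = [set y | r < `|y - x|])//.
by apply/seteqP; split => y /=; rewrite in_itv/= andbT.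
Qed.

Lemma measurable_near r x : measurable [set y : 'rV[R]_n | 0 < `|y - x| <= r].
Proof.
have := measurable_rV_norm x measurableT (measurable_itv `]0, r]%R).
by rewrite setTI (_ : _ @^-1` _ = [set y | 0 < `|y - x| <= r]).
Qed.

Lemma norm_fine_le (X : \bar R) M : (`|X| <= M%:E)%E -> `|fine X| <= M.
Proof.
by case: X => //= _; rewrite ?normr0 // => /(le_trans (abse_ge0 _)); rewrite lee_fin.
Qed.

Section one_function.
Variables (v : 'rV[R]_n -> R) (c : R) (mv : measurable_fun setT v).
Hypotheses (v0 : forall x, 0 <= v x) (vc : forall x, v x <= c).

Let c0 : 0 <= c.
Proof. exact: le_trans (v0 0) (vc 0). Qed.

Definition fraclap_kernel x y : R := (v x - v y) / enorm (x - y) `^ alpha.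

Lemma measurable_fraclap_kernel x (D : set 'rV[R]_n) :
  measurable_fun D (fraclap_kernel x).
Proof.
apply: measurable_funM; last exact: measurable_enorm_powR.
by apply: measurable_funB => //; exact: measurable_funTS.
Qed.

Lemma integrable_fraclap_kernel e x : 0 < e ->
  mu.-integrable (outer e x) (EFin \o fraclap_kernel x).
Proof.
move=> e0; have N0 : 0 < n%:R :> R by rewrite ltr0n.
have r0 : 0 < e / (2 * n%:R) by rewrite divr_gt0// mulr_gt0.
have d0 : 0 < 2 * s by rewrite mulr_gt0.
apply: (@le_integrable _ _ _ _ _ (measurable_outer e x) _
  (fun y => (c%:E * (`|y - x| `^ (- alpha))%:E)%E)).
- by apply/measurable_EFinP; exact: measurable_fraclap_kernel.
- move=> y xy; have yx : y != x.
    have := lt_trans r0 (outer_norm e0 xy).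
    by rewrite normr_gt0 subr_eq0.
  rewrite abse_EFin -EFinM abse_EFin lee_fin [leRHS]ger0_norm ?mulr_ge0 ?powR_ge0//.
  rewrite normrM ler_pM//; first by rewrite ler_norml; apply/andP; split;
    have := v0 x; have := v0 y; have := vc x; have := vc y; lra.
  by rewrite ger0_norm ?invr_ge0 ?powR_ge0// enorm_powRV_le.
- apply: integrableZl; first exact: measurable_outer.
  apply: (@integrableS _ _ _ _ [set y | e / (2 * n%:R) < `|y - x|]).
  + exact: measurable_far.
  + exact: measurable_outer.
  + by move=> y; exact: outer_norm.
  apply/integrableP; split; first by apply/measurable_EFinP; exact: measurable_powR_dist.
  have [C _ HC] := @integral_far_le R n _ d0.
  under eq_integral do rewrite abse_EFin (ger0_norm (powR_ge0 _ _)).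
  exact: le_lt_trans (HC x _ r0) (ltry _).
Qed.

(** [x + x - y] is the reflection of [y] about [x], so the numerator is minus a second difference of
    [v] at [x]. *)
Definition fraclap_symm_kernel x y : R :=
  (2 * v x - v y - v (x + x - y)) / enorm (x - y) `^ alpha.

Lemma fraclap_trunc_symm e x : 0 < e ->
  2 * (\int[mu]_(y in outer e x) fraclap_kernel x y) =
  \int[mu]_(y in outer e x) fraclap_symm_kernel x y /\
  mu.-integrable (outer e x) (EFin \o fraclap_symm_kernel x).
Proof.
move=> e0; have iF := integrable_fraclap_kernel x e0.
have E y : x - (x + x - y) = - (x - y).
  by rewrite !opprB opprD addrCA; congr (_ + _); rewrite addrA subrr add0r.
have outE y : outer e x (x + x - y) = outer e x y.
  by rewrite /outer/= E enormN.
have KE y : (2 * v x - v y - v (x + x - y)) / enorm (x - y) `^ alpha =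
    fraclap_kernel x y + fraclap_kernel x (x + x - y).
  rewrite /fraclap_kernel E enormN -mulrDl; congr (_ * _); ring.
have -> : fraclap_symm_kernel x =
    (fun y => fraclap_kernel x y + fraclap_kernel x (x + x - y)).
  by apply/funext => y; rewrite -KE.
apply: integrable_rV_symmetrize => //; first exact: measurable_outer.
exact: measurable_fraclap_kernel.
Qed.

End one_function.

Lemma norm_Rintegral_le (D : set 'rV[R]_n) (f : 'rV[R]_n -> R) M : measurable D ->
  measurable_fun D f -> (\int[mu]_(y in D) `|(f y)%:E| <= M%:E)%E ->
  `|\int[mu]_(y in D) f y| <= M.
Proof.
move=> mD mf h; apply: norm_fine_le; apply: le_trans h.
by apply: le_abse_integral => //; exact/measurable_EFinP.
Qed.

(** Uniform in the truncation [e], so the bound survives the principal value. For [|y - x| <= r] the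
    second difference supplies the factor [|y - x| ^+ 2], integrable against the kernel as
    [2 * s < 2]; beyond [r] the bound [v <= c] suffices. *)
Lemma fraclap_trunc_le A : 0 < A -> exists2 C, 0 < C &
  forall (v : 'rV[R]_n -> R) c r, measurable_fun setT v ->
    (forall x, 0 <= v x <= c) -> 0 < r ->
    (forall x z, `|v (x + z) + v (x - z) - 2 * v x| <= c * (A * (`|z| / r) ^+ 2)) ->
  forall x e, 0 < e ->
    `|\int[mu]_(y in outer e x) fraclap_kernel v x y| <= c * (C * r `^ (- (2 * s))).
Proof.
move=> A0; have d0 : 0 < 2 * s by rewrite mulr_gt0.
have [C1 C10 near_le] : exists2 C, 0 < C & forall x r, 0 < r ->
  (\int[mu]_(y in [set y | (0 < `|y - x| <= r)%R])
      (`|y - x| ^+ 2 * `|y - x| `^ (- alpha))%R%:E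
    <= (C * (r ^+ 2 * r `^ (- (2 * s))))%:E)%E.
  by apply: integral_near_le; rewrite d0 -[ltRHS]mulr1 ltr_pM2l.
have [C2 C20 far_le] := @integral_far_le R n _ d0.
exists (A * C1 + 4 * C2) => [|v c r mv vc r0 v2 x e e0].
  by rewrite addr_gt0 ?mulr_gt0.
have v0 y : 0 <= v y by case/andP: (vc y).
have {}vc y : v y <= c by case/andP: (vc y).
have c0 : 0 <= c := le_trans (v0 0) (vc 0).
have [E iS] := fraclap_trunc_symm mv v0 vc x e0.
have H : `|\int[mu]_(y in outer e x) fraclap_symm_kernel v x y| <=
    c * ((A * C1 + 4 * C2) * r `^ (- (2 * s))).
  have mS D : measurable_fun D (fraclap_symm_kernel v x).
    apply: measurable_funM; last exact: measurable_enorm_powR.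
    apply: measurable_funTS; apply: measurable_funB.
      by apply: measurable_funB.
    by apply: (@measurableT_comp _ _ _ _ _ _ v) => //; exact: measurable_rV_reflect.
  apply: norm_Rintegral_le => //; first exact: measurable_outer.
  have aS y : 0 < `|y - x| ->
      `|fraclap_symm_kernel v x y| <= c * (A * r ^- 2) * (`|y - x| ^+ 2 * `|y - x| `^ (- alpha)) /\
      `|fraclap_symm_kernel v x y| <= c * 4 * `|y - x| `^ (- alpha).
    move=> yx; have yx' : y != x by rewrite -subr_eq0 -normr_gt0.
    rewrite /fraclap_symm_kernel normrM [X in _ * X]ger0_norm ?invr_ge0 ?powR_ge0//.
    have e1 := enorm_powRV_le yx'.
    have e2 : 0 <= (enorm (x - y) `^ alpha)^-1 by rewrite invr_ge0 powR_ge0.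
    split.
      rewrite mulrA; apply: ler_pM => //.
      have := v2 x (y - x).
      have -> : x + (y - x) = y by rewrite addrC subrK.
      have -> : x - (y - x) = x + x - y by rewrite opprB addrA.
      have -> : 2 * v x - v y - v (x + x - y) = - (v y + v (x + x - y) - 2 * v x) by ring.
      rewrite normrN => /le_trans; apply.
      by rewrite expr_div_n; move: (r ^- 2) (`|_| ^+ 2) => w u; rewrite le_eqVlt; apply/orP; left; apply/eqP; ring.
    apply: ler_pM => //.
    have := v0 x; have := vc x; have := v0 y; have := vc y.
    have := v0 (x + x - y); have := vc (x + x - y).
    by rewrite ler_norml => *; apply/andP; split; lra.
  move: (fraclap_symm_kernel v x) mS aS {E iS} => S mS aS.
  have mAS D : measurable_fun D (fun y => `|(S y)%:E|%E).
    by apply: measurableT_comp => //; exact/measurable_EFinP.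
  apply: (@le_trans _ _ (\int[mu]_(y in [set y | (0 < `|y - x| <= r)%R] `|`
      [set y | (r < `|y - x|)%R]) `|(S y)%:E|)%E).
    apply: ge0_subset_integral => //.
    - exact: measurable_outer.
    - by apply: measurableU; [exact: measurable_near|exact: measurable_far].
    - move=> y xy; have := lt_trans _ (outer_norm e0 xy); move=> /(_ 0) /=.
      rewrite divr_gt0 ?mulr_gt0 ?ltr0n// => /(_ isT) ->.
      by have [?|?] := leP `|y - x| r; [left|right].
  rewrite ge0_integral_setU//=; last 3 first.
  - exact: measurable_near.
  - exact: measurable_far.
  - by apply/disj_setPS => y /= [/andP[_ /le_lt_trans h] /h]; rewrite ltxx.
  rewrite (_ : c * _ = c * (A * r ^- 2) * (C1 * (r ^+ 2 * r `^ (- (2 * s)))) +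
      c * 4 * (C2 * r `^ (- (2 * s)))); last first.
    by move: (_ `^ _) => w; field; rewrite gt_eqF.
  rewrite EFinD; apply: leeD.
    apply: (@le_trans _ _ (\int[mu]_(y in [set y | (0 < `|y - x| <= r)%R])
       ((c * (A * r ^- 2))%:E * (`|y - x| ^+ 2 * `|y - x| `^ (- alpha))%:E))%E).
      apply: ge0_le_integral => //; first exact: measurable_near.
      - apply: emeasurable_funM => //; apply/measurable_EFinP.
        apply: measurable_funM; last exact: measurable_powR_dist.
        by apply: measurable_funTS; apply: measurable_funX; exact: measurable_rV_norm.
      - by move=> y /= /andP[/aS[+ _] _]; rewrite -EFinM lee_fin.
    rewrite ge0_integralZl_EFin//.
    - by rewrite [leRHS]EFinM lee_wpmul2l ?lee_fin ?mulr_ge0 ?invr_ge0 ?exprn_ge0 ?(ltW A0) ?(ltW r0)// near_le.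
    - exact: measurable_near.
    - apply/measurable_EFinP; apply: measurable_funM; last exact: measurable_powR_dist.
      by apply: measurable_funTS; apply: measurable_funX; exact: measurable_rV_norm.
    - by rewrite ?mulr_ge0 ?invr_ge0 ?exprn_ge0 ?(ltW A0) ?(ltW r0).
  apply: (@le_trans _ _ (\int[mu]_(y in [set y | (r < `|y - x|)%R])
       ((c * 4)%:E * (`|y - x| `^ (- alpha))%:E))%E).
    apply: ge0_le_integral => //; first exact: measurable_far.
    - apply: emeasurable_funM => //; apply/measurable_EFinP; exact: measurable_powR_dist.
    - by move=> y /= /(lt_trans r0)/aS[_]; rewrite -EFinM lee_fin.
  rewrite ge0_integralZl_EFin//.
  - by rewrite [leRHS]EFinM lee_wpmul2l ?lee_fin ?mulr_ge0// far_le.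
  - exact: measurable_far.
  - by apply/measurable_EFinP; exact: measurable_powR_dist.
  - by rewrite mulr_ge0.
apply: le_trans H; rewrite -E normrM normr_nat.
by have := normr_ge0 (\int[mu]_(y in outer e x) fraclap_kernel v x y); lra.
Qed.

(** Only the cube of radius [r] around [a] contributes, and there [|x - y| >= |x - a| / 2]. *)
Lemma fraclap_trunc_off_support (v : 'rV[R]_n -> R) c a r x e :
  measurable_fun setT v -> (forall y, 0 <= v y <= c) -> 0 < r ->
  (forall y, r <= `|y - a| -> v y = 0) -> 2 * r <= `|x - a| -> 0 < e ->
  `|\int[mu]_(y in outer e x) fraclap_kernel v x y| <=
    c * ((2 * r) ^+ n * (`|x - a| / 2) `^ (- alpha)).
Proof.
move=> mv v0c r0 vr xa e0.
have v0 y : 0 <= v y by case/andP: (v0c y).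
have vc y : v y <= c by case/andP: (v0c y).
have c0 : 0 <= c := le_trans (v0 0) (vc 0).
have vx : v x = 0 by apply: vr; lra.
apply: norm_Rintegral_le; [exact: measurable_outer|exact: measurable_fraclap_kernel|].
pose b := c * (`|x - a| / 2) `^ (- alpha).
have b0 : 0 <= b by rewrite mulr_ge0 ?powR_ge0.
have mI D : measurable_fun D (fun y => (\1_(cube a r) y)%:E : \bar R).
  by apply/measurable_EFinP; exact: measurable_indic (measurable_cube _ _).
apply: (@le_trans _ _ (\int[mu]_(y in outer e x) (b%:E * (\1_(cube a r) y)%:E))%E).
  apply: ge0_le_integral => //; first exact: measurable_outer.
  - apply: measurableT_comp => //; apply/measurable_EFinP; exact: measurable_fraclap_kernel.
  - exact: emeasurable_funM.
  - move=> y xy; rewrite abse_EFin -EFinM lee_fin /fraclap_kernel vx sub0r mulNr normrN.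
    rewrite ger0_norm ?divr_ge0 ?powR_ge0// indicE.
    have [ya|ya] := leP `|y - a| r; last first.
      by rewrite vr ?(ltW ya)// mul0r mulr_ge0.
    rewrite mem_set// mulr1 ler_pM// ?invr_ge0 ?powR_ge0// -powRN.
    have xy2 : `|x - a| / 2 <= `|x - y|.
      have := ler_normD (x - y) (y - a); rewrite addrA subrK; lra.
    apply: powR_ltr0; [by rewrite oppr_le0 ltW|lra|].
    exact: le_trans xy2 (norm_le_enorm _).
apply: (@le_trans _ _ (\int[mu]_y (b%:E * (\1_(cube a r) y)%:E))%E).
  apply: ge0_subset_integral => //; first exact: measurable_outer.
    exact: emeasurable_funM.
  by move=> y _; rewrite mule_ge0 ?lee_fin.
rewrite ge0_integralZl_EFin// integral_indic//; last exact: measurable_cube.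
rewrite setIT [X in (_ * X <= _)%E]lebesgue_rV_cube ?(ltW r0)// -EFinM lee_fin /b.
by rewrite -mulrA [X in c * X]mulrC.
Qed.

(** Off the support the kernel has constant sign, and a truncation at [e < r] removes only points
    where it vanishes. The limit is thus an honest integral, at least as large in absolute value as
    the contribution of the inner cube. *)
Lemma fraclap_trunc_off_support_ge (v : 'rV[R]_n -> R) c m a r x :
  measurable_fun setT v -> (forall y, 0 <= v y <= c) -> 0 < r -> 0 <= m ->
  (forall y, r <= `|y - a| -> v y = 0) ->
  (forall y, `|y - a| <= 3 / 4 * r -> m <= v y) -> 2 * r <= `|x - a| ->
  m * ((3 / 2 * r) ^+ n * (2 * n%:R * `|x - a|) `^ (- alpha)) <=
    `|lim ((\int[mu]_(y in outer e x) fraclap_kernel v x y) @[e --> 0^'+])|.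
Proof.
move=> mv v0c r0 m0 vr vm xa.
have v0 y : 0 <= v y by case/andP: (v0c y).
have vc y : v y <= c by case/andP: (v0c y).
have vx : v x = 0 by apply: vr; lra.
have N0 : 0 < n%:R :> R by rewrite ltr0n.
have kE e : 0 < e -> e < r -> \int[mu]_(y in outer e x) fraclap_kernel v x y =
    \int[mu]_y fraclap_kernel v x y.
  move=> e0 er; rewrite /Rintegral integral_mkcond; congr fine; apply: eq_integral => y _.
  rewrite patchE; case: ifPn => // /negP xy; rewrite /fraclap_kernel vx sub0r vr ?oppr0 ?mul0r//.
  have {}xy : enorm (x - y) <= e by rewrite leNgt; apply/negP => h; apply: xy; exact/mem_set.
  have := le_trans (norm_le_enorm _) xy.
  have := ler_normD (x - y) (y - a); rewrite addrA subrK; lra.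
have r20 : 0 < r / 2 by rewrite divr_gt0.
have r2r : r / 2 < r by lra.
rewrite (@cvg_lim _ _ _ _ _ _ (\int[mu]_(y in outer (r / 2) x) fraclap_kernel v x y))//; last first.
  apply: cvg_near_cst; near=> e.
  have e0 : 0 < e by near: e; exact: nbhs_right_gt.
  have er : e < r by near: e; exact: nbhs_right_lt.
  by rewrite !kE.
pose b := m * (2 * n%:R * `|x - a|) `^ (- alpha).
have b0 : 0 <= b by rewrite mulr_ge0 ?powR_ge0.
suff H : \int[mu]_(y in outer (r / 2) x) fraclap_kernel v x y <= - (b * (3 / 2 * r) ^+ n).
  rewrite -[leRHS]normrN; apply: le_trans (ler_norm _).
  apply: (@le_trans _ _ (b * (3 / 2 * r) ^+ n)); [by rewrite /b; move: (_ `^ _) (_ ^+ _) => W P; rewrite mulrA mulrAC|move: H; move: (Rintegral _ _ _) (b * _) => I X; lra].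
have Db : mu.-integrable (outer (r / 2) x) (EFin \o (fun y => (- b) * \1_(cube a (3 / 4 * r)) y)).
  apply: (@integrableS _ _ _ _ setT) => //; first exact: measurable_outer.
  rewrite (_ : _ \o _ = (fun y => (- b)%:E * (\1_(cube a (3 / 4 * r)) y)%:E)%E)//.
  apply: integrableZl => //; apply/integrableP; split.
    by apply/measurable_EFinP; exact: measurable_indic (measurable_cube _ _).
  under eq_integral do rewrite gee0_abs ?lee_fin//.
  rewrite integral_indic//; last exact: measurable_cube.
  by rewrite setIT [X in (X < _)%E]lebesgue_rV_cube ?ltry// mulr_ge0 ?(ltW r0).
apply: (@le_trans _ _ (\int[mu]_(y in outer (r / 2) x) ((- b) * \1_(cube a (3 / 4 * r)) y))).
  apply: le_Rintegral => //; first exact: measurable_outer.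
    exact: integrable_fraclap_kernel.
  move=> y xy; rewrite /fraclap_kernel vx sub0r mulNr mulNr lerN2 indicE.
  have [ya|ya] := leP `|y - a| (3 / 4 * r); last first.
    rewrite memNset; first by rewrite mulr0 divr_ge0 ?powR_ge0.
    by rewrite /cube/= => /le_lt_trans/(_ ya); rewrite ltxx.
  rewrite mem_set// mulr1 ler_pM ?powR_ge0//; first exact: vm.
  rewrite -powRN; apply: powR_ltr0; first by rewrite oppr_le0 ltW.
    exact: lt_trans xy.
  (* On the inner cube [|x - y| <= 2 * |x - a|]; the Euclidean norm costs the factor [n]. *)
  apply: le_trans (enorm_le_norm _) _; rewrite -mulrA mulrCA ler_wpM2l//.
  have := ler_normD (x - a) (a - y); rewrite addrA subrK distrC (distrC a); lra.
have -> : \int[mu]_(y in outer (r / 2) x) ((- b) * \1_(cube a (3 / 4 * r)) y) =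
    - (b * (2 * (3 / 4 * r)) ^+ n).
  rewrite /Rintegral.
  have -> : (\int[mu]_(y in outer (r / 2) x) ((- b) * \1_(cube a (3 / 4 * r)) y)%:E =
      (- b)%:E * \int[mu]_(y in outer (r / 2) x) (\1_(cube a (3 / 4 * r)) y)%:E)%E.
    under eq_integral do rewrite EFinM.
    rewrite integralZl//; first exact: measurable_outer.
    apply/integrableP; split.
      by apply/measurable_EFinP; exact: measurable_indic (measurable_cube _ _).
    under eq_integral do rewrite gee0_abs ?lee_fin//.
    rewrite integral_indic; [|exact: measurable_outer|exact: measurable_cube].
    apply: le_lt_trans (ltry ((2 * (3 / 4 * r)) ^+ n)).
    rewrite -(lebesgue_rV_cube a) ?mulr_ge0 ?(ltW r0)//.
    by apply: le_measure; rewrite ?inE//; first apply: measurableI;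
      do ?[exact: measurable_cube|exact: measurable_outer].
  rewrite integral_indic; [|exact: measurable_outer|exact: measurable_cube].
  rewrite (_ : _ `&` _ = cube a (3 / 4 * r)).
    by rewrite [X in (_ * X)%E]lebesgue_rV_cube ?mulr_ge0 ?(ltW r0)//= mulNr.
  apply/seteqP; split => [y []//|y ya]; split => //; rewrite /outer/=.
  apply: lt_le_trans (norm_le_enorm _).
  have := ler_normD (x - y) (y - a); rewrite addrA subrK.
  by have : `|y - a| <= 3 / 4 * r := ya; lra.
by rewrite (_ : 2 * (3 / 4 * r) = 3 / 2 * r)//; field.
Unshelve. all: by end_near. Qed.

(** [c] will be the value of the time cutoff at a fixed time. Within [2 * r] of the centre the
    uniform bound is used, the weight being at least [3 ^ (- alpha)] there; beyond, the off-support
    bound, with [|x - a| / (2 * r) >= (1 + |x - a| / r) / 4]. *)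
Lemma fraclap_bump_le k : exists2 C, 0 < C & forall a r c, 0 < r -> 0 <= c -> forall x,
  `|fraclap s (fun y => c * bump_rV k a r y) x| <=
    c * (C * r `^ (- (2 * s)) * (1 + `|x - a| / r) `^ (- alpha)).
Proof.
have [A A0 HA] := @bump_second_difference R n k.
have [C C0 HC] := fraclap_trunc_le A0.
have q3 : 0 < 3 `^ alpha :> R by rewrite powR_gt0.
have q4 : 0 < 4 `^ alpha :> R by rewrite powR_gt0.
have q2 : 0 < 2 ^+ n :> R by rewrite exprn_gt0.
exists ((`|fraclap_const n s| + 1) * (C * 3 `^ alpha + 2 ^+ n * 4 `^ alpha)).
  by apply: mulr_gt0; [rewrite ltr_wpDl|rewrite addr_gt0 ?mulr_gt0].
move=> a r c r0 c0 x; pose v y := c * bump_rV k a r y.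
have v0c y : 0 <= v y <= c.
  by rewrite /v mulr_ge0 ?bump_ge0//= ler_piMr ?bump_le1.
have mv : measurable_fun setT v by apply: measurable_funM => //; exact: measurable_bump.
have w0 : 0 < (1 + `|x - a| / r) by rewrite ltr_wpDr// divr_ge0// ltW.
pose W := (1 + `|x - a| / r) `^ (- alpha).
have W0 : 0 < W by rewrite powR_gt0.
have rs0 : 0 < r `^ (- (2 * s)) by rewrite powR_gt0.
have key e : 0 < e -> `|\int[mu]_(y in outer e x) fraclap_kernel v x y| <=
    c * ((C * 3 `^ alpha + 2 ^+ n * 4 `^ alpha) * r `^ (- (2 * s)) * W).
  move=> e0; have [xa|xa] := leP (2 * r) `|x - a|.
    have vr y : r <= `|y - a| -> v y = 0 by move=> ?; rewrite /v bump_eq0 ?mulr0.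
    apply: le_trans (fraclap_trunc_off_support mv v0c r0 vr xa e0) _.
    rewrite ler_wpM2l//; apply: (@le_trans _ _ (2 ^+ n * 4 `^ alpha * r `^ (- (2 * s)) * W)); last first.
      by rewrite ler_pM2r// ler_pM2r// lerDr mulr_ge0 ?ltW.
    have -> : (2 * r) ^+ n * (`|x - a| / 2) `^ (- alpha) =
        2 ^+ n * r `^ (- (2 * s)) * (`|x - a| / (2 * r)) `^ (- alpha).
      have -> : `|x - a| / 2 = r * (`|x - a| / (2 * r)) by field; rewrite gt_eqF.
      rewrite [in LHS]powRM ?(ltW r0) ?divr_ge0 ?mulr_ge0 ?(ltW r0)//.
      have <- : r ^+ n * r `^ (- alpha) = r `^ (- (2 * s)).
        rewrite -powR_mulrn ?(ltW r0)// -powRD; last by apply/implyP => _; rewrite gt_eqF.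
        by congr (_ `^ _); rewrite /alpha; ring.
      by rewrite exprMn; move: (_ `^ _) (_ `^ _) (_ ^+ _) => *; ring.
    suff U : (`|x - a| / (2 * r)) `^ (- alpha) <= 4 `^ alpha * W.
      rewrite [leRHS](_ : _ = 2 ^+ n * r `^ (- (2 * s)) * (4 `^ alpha * W)).
        by rewrite ler_wpM2l// mulr_ge0 ?ltW.
      by clearbody W; move: (_ `^ _) (_ `^ _) => *; ring.
    have -> : 4 `^ alpha * W = ((1 + `|x - a| / r) / 4) `^ (- alpha).
      rewrite powRM ?(ltW w0) ?invr_ge0// mulrC -/W; congr (_ * _).
      by rewrite -powR_inv1// -powRrM mulN1r opprK.
    have ux : 2 <= `|x - a| / r by rewrite ler_pdivlMr.
    apply: powR_ltr0; first by rewrite oppr_le0 ltW.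
      by rewrite mulr_gt0// invr_gt0.
    have -> : `|x - a| / (2 * r) = `|x - a| / r / 2 by field; rewrite gt_eqF.
    by lra.
  apply: le_trans (HC v c r mv v0c r0 _ x e e0) _.
    by move=> y z; rewrite /v (mulrCA 2) -!mulrDr -mulrBr normrM (ger0_norm c0) ler_wpM2l// HA.
  rewrite ler_wpM2l//; apply: (@le_trans _ _ (C * 3 `^ alpha * r `^ (- (2 * s)) * W)); last first.
    by rewrite ler_pM2r// ler_pM2r// lerDl mulr_ge0 ?ltW.
  have W3 : 1 <= 3 `^ alpha * W.
    have W3 : 3 `^ (- alpha) <= W.
      apply: powR_ltr0 => //; first by rewrite oppr_le0 ltW.
      have : `|x - a| / r < 2 by rewrite ltr_pdivrMr.
      by lra.
    apply: le_trans (ler_wpM2l (ltW q3) W3).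
    by rewrite powRN mulfV// gt_eqF.
  have -> : C * 3 `^ alpha * r `^ (- (2 * s)) * W = C * r `^ (- (2 * s)) * (3 `^ alpha * W).
    by clearbody W; move: (3 `^ _) (r `^ _) => *; ring.
  by rewrite ler_peMr// mulr_ge0 ?(ltW C0)// ltW.
rewrite /fraclap normrM.
rewrite [leRHS](_ : _ = (`|fraclap_const n s| + 1) *
    (c * ((C * 3 `^ alpha + 2 ^+ n * 4 `^ alpha) * r `^ (- (2 * s)) * W))); last first.
  rewrite -/alpha -/W; clearbody W.
  by move: (_ `^ _) (_ `^ _) (_ `^ _) (_ ^+ _) `|fraclap_const n s| => *; ring.
apply: ler_pM => //; first by rewrite lerDl.
apply: norm_lim_le => //; rewrite !mulr_ge0 ?(ltW W0) ?(ltW rs0)//.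
by rewrite addr_ge0 ?mulr_ge0 ?ltW.
Qed.

(** Serves to read the finiteness of a weighted mass off the integrability demanded by the weak
    formulation; this is where the constant must not vanish. *)
Lemma fraclap_bump_ge k : fraclap_const n s != 0 -> exists2 C, 0 < C &
  forall a r c x, 0 < r -> 0 <= c -> 2 * r <= `|x - a| ->
  c * (C * r ^+ n * `|x - a| `^ (- alpha)) <= `|fraclap s (fun y => c * bump_rV k a r y) x|.
Proof.
move=> fc; have N0 : 0 < n%:R :> R by rewrite ltr0n.
pose m : R := (7 / 16) ^+ (k.+3 * n).
have m0 : 0 < m by rewrite exprn_gt0.
exists (`|fraclap_const n s| * (m * ((3 / 2) ^+ n * (2 * n%:R) `^ (- alpha)))).
  by rewrite !mulr_gt0 ?normr_gt0// ?exprn_gt0// ?powR_gt0// mulr_gt0.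
move=> a r c x r0 c0 xa; pose v y := c * bump_rV k a r y.
have v0c y : 0 <= v y <= c.
  by rewrite /v mulr_ge0 ?bump_ge0//= ler_piMr ?bump_le1.
have mv : measurable_fun setT v by apply: measurable_funM => //; exact: measurable_bump.
have vr y : r <= `|y - a| -> v y = 0 by move=> ?; rewrite /v bump_eq0 ?mulr0.
have vm y : `|y - a| <= 3 / 4 * r -> c * m <= v y.
  by move=> ya; rewrite /v ler_wpM2l// bump_ge.
have := @fraclap_trunc_off_support_ge v c (c * m) a r x mv v0c r0 _ vr vm xa.
rewrite mulr_ge0 ?(ltW m0)// => /(_ isT) H.
rewrite /fraclap [leRHS]normrM; apply: (@le_trans _ _ (`|fraclap_const n s| * _)); last first.
  by apply: ler_wpM2l; [exact: normr_ge0|exact: H].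
rewrite [X in _ <= _ * (_ * (_ * X))]powRM ?mulr_ge0 ?(ltW N0)// (exprMn n (3 / 2) r) -/alpha.
move: `|fraclap_const n s| (_ `^ _) (_ `^ _) (r ^+ n) ((3 / 2) ^+ n) => F A B u w.
by rewrite le_eqVlt; apply/orP; left; apply/eqP; ring.
Qed.
End fraclap_bounds.

(** * The weak formulation for a bump *)

Section test_functions.
Context {R : realType} {n : nat}.
Implicit Types (a x : 'rV[R]_n) (r c t T : R) (k : nat) (i j : 'I_n) (g : 'I_n -> R -> R).

(** A partial derivative of a product of one-variable functions is again such a product, with one
    factor replaced; iterating gives all second derivatives. *)
Definition replace_factor g i (d : R -> R) j : R -> R := if j == i then d else g j.

Lemma partial_x_rV_prod c g i d : (forall t, is_derive t 1 (g i) (d t)) ->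
  (forall x, derivable (fun x => c * rV_prod g x) x (delta_mx ord0 i)) /\
  partial_x i (fun x => c * rV_prod g x) = (fun x => c * rV_prod (replace_factor g i d) x).
Proof.
move=> gd; have H x : is_derive x (delta_mx ord0 i) (fun x => c * rV_prod g x)
    (c * rV_prod (replace_factor g i d) x).
  rewrite (_ : c * _ = c *: (d (x ord0 i) * \prod_(j | j != i) g j (x ord0 j))).
    by apply: is_deriveZ; exact: is_derive_rV_prod.
  rewrite /rV_prod (bigD1 i)//= /replace_factor eqxx; congr (_ * (_ * _)).
  by apply: eq_bigr => j /negbTE ->.
split=> [x|]; first by case: (H x).
by apply/funext => x; rewrite /partial_x; case: (H x).
Qed.

(** The square makes the cutoff of class C^1 at [T] and bounds its derivative by [2 / T] times its
    square root. *)
Definition time_cutoff T t : R := pospart (1 - t / T) ^+ 2.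
Definition dtime_cutoff T t : R := - (2 / T * pospart (1 - t / T)).

Lemma is_derive_time_cutoff T t : is_derive t 1 (time_cutoff T) (dtime_cutoff T t).
Proof.
have H : is_derive t 1 (fun t : R => 1 - t / T) (- T^-1).
  rewrite (_ : (fun t => _) = cst 1 - (fun t => T^-1 *: id t)); last first.
    by apply/funext => u; rewrite fctE /GRing.scale/= mulrC.
  have := is_deriveB (is_derive_cst (1 : R) t (1 : R)) (is_deriveZ T^-1 (is_derive_id t (1 : R))).
  by rewrite sub0r /GRing.scale/= mulr1.
have := @is_derive1_comp R _ (fun t => 1 - t / T) t _ _ (is_derive_pospart2 _) H.
by rewrite (_ : _ * - _ = dtime_cutoff T t)// /dtime_cutoff; ring.
Qed.

Let continuous_1B T : continuous (fun t : R => 1 - t / T).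
Proof.
by move=> t; apply: cvgB; [exact: cvg_cst|apply: cvgM; [exact: cvg_id|exact: cvg_cst]].
Qed.

Let continuous_pospart1B T : continuous (fun t : R => pospart (1 - t / T)).
Proof.
by move=> t; apply: (@continuous_comp _ _ _ (fun t => 1 - t / T) pospart);
  [exact: continuous_1B|exact: continuous_pospart].
Qed.

Lemma continuous_time_cutoff T : continuous (time_cutoff T).
Proof.
move=> t; apply: (@continuous_comp _ _ _ (fun t => pospart (1 - t / T)) (fun z => z ^+ 2)).
  exact: continuous_pospart1B.
exact: exprn_continuous.
Qed.

Lemma continuous_dtime_cutoff T : continuous (dtime_cutoff T).
Proof.
move=> t; rewrite /dtime_cutoff; apply: cvgN; apply: cvgM; first exact: cvg_cst.
exact: continuous_pospart1B.
Qed.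

Lemma time_cutoff_ge0 T t : 0 <= time_cutoff T t.
Proof. by rewrite exprn_ge0 ?pospart_ge0. Qed.

Lemma time_cutoff_eq0 T t : 0 < T -> T <= t -> time_cutoff T t = 0.
Proof.
move=> T0 Tt; rewrite /time_cutoff /pospart (max_idPl _) ?expr0n//.
by rewrite subr_le0 ler_pdivlMr// mul1r.
Qed.

Lemma time_cutoff_le1 T t : 0 < T -> 0 <= t -> time_cutoff T t <= 1.
Proof.
move=> T0 t0; rewrite exprn_ile1 ?pospart_ge0// ge_max ler01 gerBl.
by rewrite divr_ge0// ltW.
Qed.

Lemma time_cutoff0 T : time_cutoff T 0 = 1.
Proof. by rewrite /time_cutoff mul0r subr0 /pospart (max_idPr _)// expr1n. Qed.

Definition test k a r T t x : R := time_cutoff T t * bump_rV k a r x.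

Lemma derive1_test k a r T x t :
  derive1 (test k a r T ^~ x) t = dtime_cutoff T t * bump_rV k a r x.
Proof.
rewrite derive1E (_ : test k a r T ^~ x = bump_rV k a r x \*: time_cutoff T); last first.
  by apply/funext => u; rewrite /test mulrC.
have := is_deriveZ (bump_rV k a r x) (is_derive_time_cutoff T t).
by case=> _ ->; rewrite mulrC.
Qed.

Let continuous_prod2 (f : R -> R) (h : 'rV[R]_n -> R) : continuous f -> continuous h ->
  continuous (fun z : R * 'rV[R]_n => f z.1 * h z.2).
Proof.
move=> cf ch z; apply: cvgM.
  by apply: (@continuous_comp _ _ _ fst f); [exact: cvg_fst|exact: cf].
by apply: (@continuous_comp _ _ _ snd h); [exact: cvg_snd|exact: ch].
Qed.

Let factor k a r := bump_factor k a r.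
Let dfactor k a r i := replace_factor (factor k a r) i (dbump_factor k a r i).

Lemma partial_x_test k a r T i t :
  (forall x, derivable (test k a r T t) x (delta_mx ord0 i)) /\
  partial_x i (test k a r T t) = (fun x => time_cutoff T t * rV_prod (dfactor k a r i) x).
Proof. by apply: partial_x_rV_prod => u; exact: is_derive_bump_factor. Qed.

Let ddfactor k a r i j := replace_factor (dfactor k a r i) j
  (if j == i then ddbump_factor k a r i else dbump_factor k a r j).

Lemma partial_xx_test k a r T i j t :
  (forall x, derivable (partial_x i (test k a r T t)) x (delta_mx ord0 j)) /\
  partial_x j (partial_x i (test k a r T t)) =
    (fun x => time_cutoff T t * rV_prod (ddfactor k a r i j) x).
Proof.
rewrite (partial_x_test k a r T i t).2; apply: partial_x_rV_prod => u.
rewrite /dfactor /replace_factor; case: eqP => _.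
  exact: is_derive_dbump_factor.
exact: is_derive_bump_factor.
Qed.

Let continuous_dfactor k a r i j : continuous (dfactor k a r i j).
Proof.
rewrite /dfactor /replace_factor; case: eqP => _.
  exact: continuous_dbump_factor.
exact: continuous_bump_factor.
Qed.

Let continuous_ddfactor k a r i j m : continuous (ddfactor k a r i j m).
Proof.
rewrite /ddfactor /replace_factor; case: eqP => _; last exact: continuous_dfactor.
case: eqP => _; [exact: continuous_ddbump_factor|exact: continuous_dbump_factor].
Qed.

Lemma compact_cube a r : 0 <= r -> compact (cube a r).
Proof.
move=> r0; have := @rV_compact R n (fun i => `[a ord0 i - r, a ord0 i + r]%classic)
  (fun i => @segment_compact R _ _).
rewrite (_ : [set v | _] = cube a r)//; apply/seteqP; split => x /=.
  move=> h; apply/rV_norm_leP => // i; have := h i; rewrite in_itv/= !mxE ler_norml.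
  by move=> /andP[? ?]; apply/andP; split; lra.
move=> /(rV_norm_leP _ r0) h i; have := h i; rewrite in_itv/= !mxE ler_norml.
by move=> /andP[? ?]; apply/andP; split; lra.
Qed.

Lemma test_function_test k a r T : 0 < r -> 0 < T -> test_function +oo (test k a r T).
Proof.
move=> r0 T0; split.
- apply: continuous_subspaceT; apply: continuous_prod2; first exact: continuous_time_cutoff.
  by apply: continuous_rV_prod => i; exact: continuous_bump_factor.
- exists (fun t x => dtime_cutoff T t * bump_rV k a r x); split.
    apply: continuous_subspaceT; apply: continuous_prod2; first exact: continuous_dtime_cutoff.
    by apply: continuous_rV_prod => i; exact: continuous_bump_factor.
  (* The two-sided limit exists, hence also its restriction to [0 <= t + h]. *)
  move=> t x _; apply: cvg_within_filter.
  rewrite (_ : (fun h => _) = (fun h => h^-1 *: (time_cutoff T (h *: 1 + t) - time_cutoff T t)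
      * bump_rV k a r x)).
    by apply: cvgM; [exact: is_derive_cvg (is_derive_time_cutoff T t)|exact: cvg_cst].
  apply/funext => h; rewrite /test -mulrBl /GRing.scale/= mulr1 mulrA.
  by rewrite (addrC t).
- move=> i; split; first by move=> t x _; exact: (partial_x_test _ _ _ _ _ _).1.
  rewrite (_ : (fun z => _) = (fun z => time_cutoff T z.1 * rV_prod (dfactor k a r i) z.2)).
    apply: continuous_subspaceT; apply: continuous_prod2; first exact: continuous_time_cutoff.
    by apply: continuous_rV_prod => j; exact: continuous_dfactor.
  by apply/funext => z; rewrite (partial_x_test k a r T i z.1).2.
- move=> i j; split; first by move=> t x _; exact: (partial_xx_test _ _ _ _ _ _ _).1.
  rewrite (_ : (fun z => _) = (fun z => time_cutoff T z.1 * rV_prod (ddfactor k a r i j) z.2)).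
    apply: continuous_subspaceT; apply: continuous_prod2; first exact: continuous_time_cutoff.
    by apply: continuous_rV_prod => m; exact: continuous_ddfactor.
  by apply/funext => z; rewrite (partial_xx_test k a r T i j z.1).2.
- exists (`[0, T]%classic `*` cube a r); split.
  + by apply: compact_setX; [exact: segment_compact|apply: compact_cube; exact: ltW].
  + by move=> [t x] /= [+ _]; rewrite in_itv/= => /andP[t0 _]; split=> //=; rewrite ltry.
  + move=> [t x] [/= t0 _] /not_andP[|]; rewrite /= ?in_itv/= ?t0/=.
      by move=> /negP; rewrite -ltNge => /ltW Tt; rewrite /test time_cutoff_eq0 ?mul0r.
    by move=> /negP; rewrite -ltNge => /ltW rx; rewrite /test bump_eq0 ?mulr0.
Qed.

Lemma powR_prod (I : Type) (s : seq I) (P : pred I) (f : I -> R) (p : R) :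
  (forall e : I, 0 <= f e) ->
  (\prod_(e <- s | P e) f e) `^ p = \prod_(e <- s | P e) (f e `^ p).
Proof.
move=> f0; elim: s => [|e s ih]; first by rewrite !big_nil powR1.
by rewrite !big_cons; case: ifP => // _; rewrite powRM ?ih// prodr_ge0.
Qed.

Lemma le_powR_exponent (x p q : R) : 0 <= x <= 1 -> 0 < p -> p <= q -> x `^ q <= x `^ p.
Proof.
move=> /andP[x0 x1] p0 pq; have [->|xN0] := eqVneq x 0.
  by rewrite !powR0 ?gt_eqF// (lt_le_trans p0).
by apply: ger_powR => //; rewrite lt_def xN0 x0.
Qed.

(** In each term one factor is differentiated twice, which leaves a multiple of [pospart ^+ k.+1],
    below the power [sigma^-1] of [bump1] because [k.+3 / sigma <= k.+1]. The other factors lie in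
    [[0, 1]], so this power only increases them. *)
Lemma laplacian_test_le k a r T sigma t x : 0 < r -> 1 < sigma ->
  k.+3%:R <= sigma * k.+1%:R ->
  `|laplacian (test k a r T t) x| <=
    time_cutoff T t * (n%:R * 4 * k.+3%:R ^+ 2 / r ^+ 2) * bump_rV k a r x `^ sigma^-1.
Proof.
move=> r0 s1 ks; rewrite /laplacian; apply: le_trans (ler_norm_sum _ _ _) _.
have s0 : 0 < sigma by lra.
have -> : time_cutoff T t * (n%:R * 4 * k.+3%:R ^+ 2 / r ^+ 2) * bump_rV k a r x `^ sigma^-1 =
    \sum_(i < n) time_cutoff T t * (4 * k.+3%:R ^+ 2 / r ^+ 2 * bump_rV k a r x `^ sigma^-1).
  rewrite sumr_const card_ord -[RHS]mulr_natl.
  by move: (bump_rV _ _ _ _ `^ _) (time_cutoff _ _) (r ^- 2) => *; ring.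
apply: ler_sum => i _; rewrite (partial_xx_test k a r T i i t).2.
rewrite normrM (ger0_norm (time_cutoff_ge0 _ _)) ler_wpM2l ?time_cutoff_ge0//.
rewrite /bump_rV /rV_prod powR_prod; last by move=> j; exact: bump1_ge0.
rewrite (bigD1 i)//= [in leRHS](bigD1 i)//= normrM mulrA.
have P0 j : 0 <= pospart (1 - ((x ord0 j - a ord0 j) / r) ^+ 2) <= 1.
  by rewrite pospart_ge0 pospart_1Bsqr_le1.
apply: ler_pM => //.
  rewrite /ddfactor /replace_factor !eqxx /ddbump_factor normrM normfV.
  rewrite (ger0_norm (sqr_ge0 r)) mulrAC ler_wpM2r ?invr_ge0 ?sqr_ge0//.
  apply: le_trans (ddbump1_le _ _) _; rewrite ler_wpM2l ?mulr_ge0 ?sqr_ge0//.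
  have /andP[p0 _] := P0 i.
  rewrite /bump_factor /bump1 -(powR_mulrn k.+1 p0) -(powR_mulrn k.+3 p0) -powRrM; apply: le_powR_exponent => //.
    by rewrite mulr_gt0 ?invr_gt0.
  by rewrite ler_pdivrMr// mulrC.
rewrite ger0_norm; last first.
  apply: prodr_ge0 => j ji; rewrite /ddfactor /dfactor /replace_factor (negbTE ji).
  exact: bump1_ge0.
apply: ler_prod => j ji; rewrite /ddfactor /dfactor /replace_factor (negbTE ji).
rewrite /factor /bump_factor bump1_ge0/= -[leLHS]powRr1 ?bump1_ge0//.
apply: le_powR_exponent; first by rewrite bump1_ge0 bump1_le1.
  by rewrite invr_gt0.
by rewrite invf_le1// ltW.
Qed.

End test_functions.

(** * Testing the equation and absorbing the linear terms *)

Section weak_inequality.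
Context {R : realType} {n : nat}.
Implicit Types (a : 'rV[R]_n) (r T : R) (k : nat).
Local Notation W := (@lebesgue_spacetime R n).
Local Notation ST := (measurableTypeR R * 'rV[R]_n)%type.

Definition slab T : set ST := `]0, T[ `*` setT.

Lemma measurable_slab T : measurable (slab T).
Proof. by apply: measurableX => //; exact: measurable_itv. Qed.

Lemma ae_integrable_fin_num d (X : measurableType d) (m : {measure set X -> \bar R})
    (D : set X) (f : X -> \bar R) : measurable D -> ae_integrable m D f ->
  (\int[m]_(x in D) f x)%E \is a fin_num.
Proof.
move=> mD [g ig fg].
rewrite (ae_eq_integral_nonmeasurable mD (measurable_int _ ig) fg).
exact: integrable_fin_num.
Qed.

Variables (beta p q : R) (K : R -> R) (u0 : 'rV[R]_n -> R) (u : R -> 'rV[R]_n -> R).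
Hypothesis uS : global_weak_solution beta p q K u0 u.

(** The compact sets [A m] exhaust the open half-space [t > 0]; on each of them local integrability
    yields a Borel function, and these are glued. *)
Lemma measurable_representative : exists2 w : ST -> R, measurable_fun setT w &
  {ae W, forall z : ST, 0 < z.1 -> u z.1 z.2 = w z}.
Proof.
pose A (m : nat) : set ST := `[m.+1%:R^-1, m.+1%:R]%classic `*` cube 0 m.+1%:R.
have mA m : measurable (A m).
  by apply: measurableX; [exact: measurable_itv|exact: measurable_cube].
have [uloc _ _] := uS.
have H m : exists2 g : ST -> R, measurable_fun (A m) g &
    {ae W, forall z, A m z -> u z.1 z.2 = g z}.
  have [||g ig ug] := uloc (A m).
  - by apply: compact_setX; [exact: segment_compact|exact: compact_cube].
  - move=> [t x] [/= + _]; rewrite in_itv/= => /andP[m0 _]; split; last by rewrite ltry.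
    by apply: lt_le_trans m0; rewrite invr_gt0.
  exists (fine \o g).
    by apply: (measurable_comp (F := setT)) => //; exact: measurable_int ig.
  by apply: filterS ug => z ugz /ugz /= <-.
have /choice [g Hg] : forall m, exists g : ST -> R, measurable_fun (A m) g /\
    {ae W, forall z, A m z -> u z.1 z.2 = g z}.
  by move=> m; have [g ? ?] := H m; exists g.
have [||w mw uw] := @ae_glue R _ _ W A (fun z => u z.1 z.2) g mA.
- by move=> m; case: (Hg m).
- by move=> m; case: (Hg m).
exists w => //; apply: filterS uw => -[t x] /= uwz t0; apply: uwz.
pose m := maxn (Num.truncn t^-1) (maxn (Num.truncn t) (Num.truncn `|x|)).
have mt1 : (Num.truncn t^-1 <= m)%N by exact: leq_maxl.
have mt2 : (Num.truncn t <= m)%N by rewrite /m maxnCA leq_maxl.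
have mt3 : (Num.truncn `|x| <= m)%N by rewrite /m !leq_max leqnn !orbT.
exists m => //; split => /=.
  rewrite in_itv/=; apply/andP; split.
    rewrite invf_ple ?posrE//; apply/ltW/(lt_le_trans (truncnS_gt _)).
    by rewrite ler_nat ltnS.
  by apply/ltW/(lt_le_trans (truncnS_gt _)); rewrite ler_nat ltnS.
by rewrite /cube/= subr0; apply/ltW/(lt_le_trans (truncnS_gt _)); rewrite ler_nat ltnS.
Qed.

(** For [0 < r] and [0 < T] the weak formulation makes this integral and the next one finite, so
    [fine] loses no information. *)
Definition initial_mass k a r : R := fine (\int[lebesgue_rV n]_x (u0 x * bump_rV k a r x)%:E).

Definition source_mass k a r T : R :=
  fine (\int[W]_(z in slab T) (nonlocal_term p q K u z.1 z.2 * (test k a r T z.1 z.2)%:E))%E.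

Variables (w : ST -> R) (mw : measurable_fun setT w).
Hypothesis uw : {ae W, forall z : ST, 0 < z.1 -> u z.1 z.2 = w z}.

(** Evaluated at [tau = T], where the cutoff vanishes and the term with [u tau] drops out. *)
Lemma weak_formulation_test k a r T : 0 < r -> 0 < T ->
  [/\ Lone (fun x => (u0 x * bump_rV k a r x)%:E),
   ae_integrable W (slab T)
     (fun z => nonlocal_term p q K u z.1 z.2 * (test k a r T z.1 z.2)%:E)%E,
   ae_integrable W (slab T)
     (fun z => (u z.1 z.2 * neg_laplacian_pow beta (test k a r T z.1) z.2)%:E),
   ae_integrable W (slab T)
     (fun z => (u z.1 z.2 * (dtime_cutoff T z.1 * bump_rV k a r z.2))%:E) &
   initial_mass k a r + source_mass k a r T =
   fine (\int[W]_(z in slab T) (u z.1 z.2 * neg_laplacian_pow beta (test k a r T z.1) z.2)%:E)%E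
   - fine (\int[W]_(z in slab T) (u z.1 z.2 * (dtime_cutoff T z.1 * bump_rV k a r z.2))%:E)%E].
Proof.
move=> r0 T0; have [_ _ /(_ _ (test_function_test k a r0 T0) T (ltW T0) (ltry T))] := uS.
rewrite -/(slab T).
have E0 : (fun x => (u0 x * test k a r T 0 x)%:E) = (fun x => (u0 x * bump_rV k a r x)%:E).
  by apply/funext => x; rewrite /test time_cutoff0 mul1r.
have ET : (fun x => (u T x * test k a r T T x)%:E) = cst 0%E.
  by apply/funext => x; rewrite /test time_cutoff_eq0// mul0r mulr0.
have Et : (fun z : ST => (u z.1 z.2 * (test k a r T ^~ z.2)^`()%classic z.1)%:E) =
    (fun z => (u z.1 z.2 * (dtime_cutoff T z.1 * bump_rV k a r z.2))%:E).
  by apply/funext => z; rewrite derive1_test.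
move=> /=; rewrite E0 Et ET => -[[_ L0] Lnl Llap Lt].
rewrite integral0 sub0e => E.
split => //; move: E; rewrite /initial_mass /source_mass.
have := ae_integrable_fin_num measurableT L0.
have := ae_integrable_fin_num (measurable_slab T) Lnl.
have := ae_integrable_fin_num (measurable_slab T) Llap.
have := ae_integrable_fin_num (measurable_slab T) Lt.
do 4!(move=> /fineK <-).
by rewrite -!EFinN -!EFinD /= => -[]; lra.
Qed.

(** The sign of [u] being unknown, both linear terms are bounded in absolute value; [G] is a common
    majorant of the operators applied to the test function. *)
Lemma weak_inequality k a r T (G : ST -> R) : 0 < r -> 0 < T ->
  measurable_fun setT G ->
  (forall t x, 0 < t < T ->
    `|neg_laplacian_pow beta (test k a r T t) x| + `|dtime_cutoff T t * bump_rV k a r x|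
      <= G (t, x)) ->
  ((initial_mass k a r + source_mass k a r T)%:E <=
    \int[W]_(z in slab T) (`|w z| * G z)%:E)%E.
Proof.
move=> r0 T0 mG HG; have [_ _ Llap Lt ->] := weak_formulation_test k a r0 T0.
have mS := measurable_slab T.
have G0 z : slab T z -> 0 <= G z.
  move=> -[/=]; rewrite in_itv/= => zT _.
  by case: z zT => t x /= tT; apply: le_trans (HG t x tT); rewrite addr_ge0.
have [gL igL EL] := Llap; have [gt igt Et] := Lt.
have mgL := measurable_int _ igL; have mgt := measurable_int _ igt.
rewrite (ae_eq_integral_nonmeasurable mS mgL EL) (ae_eq_integral_nonmeasurable mS mgt Et).
apply: (@le_trans _ _ (\int[W]_(z in slab T) (`|gL z| + `|gt z|)%E)%E).
  rewrite ge0_integralD//; last 2 first.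
  - exact: measurableT_comp.
  - exact: measurableT_comp.
  have := le_abse_integral W mS mgL; have := le_abse_integral W mS mgt.
  have := integrable_fin_num mS igL; have := integrable_fin_num mS igt.
  move: (\int[W]_(z in slab T) gL z)%E (\int[W]_(z in slab T) gt z)%E => [x| |] [y| |]//= _ _ h1 h2.
  apply: le_trans (leeD h2 h1); rewrite -EFinD lee_fin.
  by apply: le_trans (ler_normB _ _); exact: ler_norm.
apply: ae_ge0_le_integral => //.
- by move=> z _; rewrite adde_ge0.
- by apply: emeasurable_funD; exact: measurableT_comp.
- by move=> z /G0 ?; rewrite lee_fin mulr_ge0.
- apply/measurable_EFinP; apply: measurable_funTS; apply: measurable_funM => //.
  exact: measurableT_comp.
- apply: filterS3 EL Et uw => z ELz Etz uwz zS.
  have := zS => -[/=]; rewrite in_itv/= => /andP[z0 zT] _.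
  rewrite -ELz// -Etz// uwz// !abse_EFin -EFinD lee_fin !normrM -mulrDr ler_wpM2l//.
  by case: z {ELz Etz uwz zS} z0 zT => t x /= t0 tT; rewrite -normrM HG ?t0.
Qed.

Definition moment k a r e t : \bar R :=
  (\int[lebesgue_rV n]_x (bump_rV k a r x * `|w (t, x)| `^ e)%:E)%E.

Let measurable_moment_integrand k a r e :
  measurable_fun [set: ST] (fun z => (bump_rV k a r z.2 * `|w z| `^ e)%:E : \bar R).
Proof.
apply/measurable_EFinP; apply: measurable_funM.
  by apply: (@measurableT_comp _ _ _ _ _ _ (bump_rV k a r)) => //; exact: measurable_bump.
by apply: (@measurableT_comp _ _ _ _ _ _ (@powR R ^~ e)) => //; exact: measurableT_comp.
Qed.

Lemma measurable_moment k a r e : measurable_fun setT (moment k a r e).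
Proof.
apply: (measurable_fun_fubini_tonelli_F (m2 := lebesgue_rV n) _
  (measurable_moment_integrand k a r e)) => z.
by rewrite lee_fin mulr_ge0 ?bump_ge0 ?powR_ge0.
Qed.

Lemma moment_ge0 k a r e t : (0 <= moment k a r e t)%E.
Proof. by apply: integral_ge0 => x _; rewrite lee_fin mulr_ge0 ?bump_ge0 ?powR_ge0. Qed.

Lemma measurable_time_cutoff T : measurable_fun setT (time_cutoff T).
Proof. by apply: continuous_measurable_fun => t; exact: continuous_time_cutoff. Qed.

(** Two points of the support of the bump are at Euclidean distance at most [2 * n * r], so the
    kernel is at least [kappa] between them. Inserting the bump, which is at most 1, in the
    convolution variable turns the double integral into a product. *)
Lemma source_mass_ge k a r T kappa : (0 < n)%N -> 0 < r -> 0 < T -> 0 <= kappa ->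
  (forall rho, 0 < rho -> 0 < K rho) ->
  (forall rho, 0 < rho -> rho <= 2 * n%:R * r -> kappa <= K rho) ->
  (\int[lebesgue_measure]_(t in `]0%R, T[)
     ((kappa * time_cutoff T t)%:E * (moment k a r p t * moment k a r q t))
   <= (source_mass k a r T)%:E)%E.
Proof.
move=> n0 r0 T0 kap0 K0 Kkap.
have mS := measurable_slab T.
have [_ Lnl _ _ _] := weak_formulation_test k a r0 T0.
rewrite /source_mass fineK; last exact: ae_integrable_fin_num Lnl.
have [g ig fg] := Lnl.
rewrite (ae_eq_integral_nonmeasurable mS (measurable_int _ ig) fg).
rewrite [leRHS]integral_mkcond [leLHS]integral_mkcond.
have ig' := (integrable_mkcond g mS).1 ig.
rewrite -[leRHS](integral12_prod_meas1 ig').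
have h0 t : (0 <= (kappa * time_cutoff T t)%:E * (moment k a r p t * moment k a r q t))%E.
  by rewrite !mule_ge0 ?moment_ge0// lee_fin mulr_ge0 ?time_cutoff_ge0.
apply: ae_le_integral_nonmeasurable => //.
- apply: (measurable_restrictT _ (measurable_itv `]0, T[)).1; apply: measurable_funTS.
  apply: emeasurable_funM; last by apply: emeasurable_funM; exact: measurable_moment.
  by apply/measurable_EFinP; apply: measurable_funM => //; exact: measurable_time_cutoff.
- by move=> t _; rewrite patchE; case: ifP.
(* For almost every [t] both equalities hold almost everywhere on the slice. *)
apply: filterS2 (ae_product fg) (ae_product uw) => t fgt uwt _.
rewrite patchE; case: ifPn => [|t0T]; last first.
  rewrite /fubini_F; under eq_integral => x _.
    rewrite patchE memNset; last by move=> -[/= tT _]; move/negP: t0T; apply; exact/mem_set.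
    over.
  by rewrite integral0.
rewrite inE/= in_itv/= => t0T; have /andP[t0 tT] := t0T.
pose P := moment k a r p t.
rewrite -/P; have P0 : (0 <= P)%E by exact: moment_ge0.
have kP : (0 <= kappa%:E * P)%E by rewrite mule_ge0.
have mb : measurable_fun setT (fun x : 'rV[R]_n => (bump_rV k a r x * `|w (t, x)| `^ p)%:E : \bar R).
  exact: (measurable_fun_pair2 t (measurable_moment_integrand k a r p)).
have kPE : (kappa%:E * P =
    \int[lebesgue_rV n]_y (kappa%:E * (bump_rV k a r y * `|w (t, y)| `^ p)%:E))%E.
  rewrite ge0_integralZl_EFin// => y _.
  by rewrite lee_fin mulr_ge0 ?bump_ge0 ?powR_ge0.
have conv x : 0 < bump_rV k a r x ->
    (kappa%:E * P <= \int[lebesgue_rV n]_y (K (enorm (x - y)) * `|u t y| `^ p)%:E)%E.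
  move=> bx; rewrite kPE.
  have xa : `|x - a| < r.
    by rewrite ltNge; apply/negP => /(bump_eq0 k r0) bx0; move: bx; rewrite bx0 ltxx.
  (* [K 0] is unconstrained, so the diagonal [y = x] is discarded as a null set. *)
  have x0 : {ae lebesgue_rV n, forall y, y != x}.
    exists [set x]; split; first by rewrite -(_ : cube x 0 = [set x]);
      [exact: measurable_cube|apply/seteqP; split => y;
       rewrite /cube/= ?normr_le0 ?subr_eq0; [move/eqP|move->]].
      exact: lebesgue_rV_set1.
    by move=> y /= /negP; rewrite negbK => /eqP.
  apply: ae_le_integral_nonmeasurable => //.
  - exact: emeasurable_funM.
  - by move=> y _; rewrite mule_ge0// lee_fin mulr_ge0 ?bump_ge0 ?powR_ge0.
  apply: filterS2 uwt x0 => y uwy yx _.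
  rewrite -EFinM lee_fin -(uwy t0)/=.
  have e0 : 0 < enorm (x - y).
    by apply: lt_le_trans (norm_le_enorm _); rewrite normr_gt0 subr_eq0 eq_sym.
  have [ya|ya] := leP r `|y - a|.
    by rewrite bump_eq0// mul0r mulr0 mulr_ge0 ?powR_ge0// ltW// K0.
  rewrite mulrA ler_wpM2r ?powR_ge0//.
  apply: (@le_trans _ _ kappa); first by rewrite ler_piMr ?bump_le1.
  apply: Kkap => //; apply: le_trans (enorm_le_norm _) _.
  rewrite (mulrC 2) -mulrA ler_wpM2l//.
  have := ler_normD (x - a) (a - y); rewrite addrA subrK (distrC a); lra.
clearbody P; have ke0 : 0 <= kappa * time_cutoff T t by rewrite mulr_ge0 ?time_cutoff_ge0.
have mq := measurable_fun_pair2 t (measurable_moment_integrand k a r q).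
have kPe : (0 <= (kappa * time_cutoff T t)%:E * P)%E by exact: mule_ge0.
apply: (@le_trans _ _ (\int[lebesgue_rV n]_x ((kappa * time_cutoff T t)%:E * P *
    (bump_rV k a r x * `|w (t, x)| `^ q)%:E))%E).
  rewrite (ge0_integralZl _ measurableT mq _ kPe).
    by rewrite muleA.
  by move=> x _; rewrite lee_fin mulr_ge0 ?bump_ge0 ?powR_ge0.
rewrite /fubini_F; apply: (ae_le_integral_nonmeasurable measurableT).
- exact: emeasurable_funM.
- by move=> x _; rewrite (mule_ge0 kPe)// lee_fin mulr_ge0 ?bump_ge0 ?powR_ge0.
apply: filterS2 fgt uwt => x fgx uwx _.
have zS : slab T (t, x) by split => //=; rewrite in_itv.
rewrite patchE mem_set// -fgx//= /nonlocal_term/= uwx//.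
(* Where the bump vanishes both sides are 0, even if the convolution is infinite. *)
have [b0|b0] := leP (bump_rV k a r x) 0.
  have -> : bump_rV k a r x = 0 by apply/eqP; rewrite eq_le b0 bump_ge0.
  by rewrite /test mul0r mule0 (_ : bump_rV k a r x = 0) ?mulr0 ?mule0//;
     apply/eqP; rewrite eq_le b0 bump_ge0.
rewrite /test (_ : _ * _ * _ = (kappa%:E * P) * (`|w (t, x)| `^ q)%:E * (time_cutoff T t * bump_rV k a r x)%:E)%E.
  apply: lee_wpmul2r; first by rewrite lee_fin mulr_ge0 ?time_cutoff_ge0 ?bump_ge0.
  by apply: lee_wpmul2r; [rewrite lee_fin powR_ge0|exact: conv].
rewrite (muleC _%:E P) (muleC kappa%:E P) -!muleA -!EFinM.
by congr (P * _%:E)%E; ring.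
Qed.

Section absorption.
Context d (X : measurableType d) (m : {measure set X -> \bar R}).
Variables (b v : X -> R) (mb : measurable_fun setT b) (mv : measurable_fun setT v).
Hypotheses (b0 : forall x, 0 <= b x) (p0 : 0 < p) (q0 : 0 < q).

Let mom e : \bar R := (\int[m]_x (b x * `|v x| `^ e)%:E)%E.

Let measurable_mom e : measurable_fun setT (fun x => (b x * `|v x| `^ e)%:E : \bar R).
Proof.
apply/measurable_EFinP; apply: measurable_funM => //.
by apply: (@measurableT_comp _ _ _ _ _ _ (@powR R ^~ e)) => //; exact: measurableT_comp.
Qed.

Let integrand_ge0 e x : (0 <= (b x * `|v x| `^ e)%:E)%E.
Proof. by rewrite lee_fin mulr_ge0 ?powR_ge0. Qed.

Let mom_ge0 e : (0 <= mom e)%E.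
Proof. exact: integral_ge0. Qed.

(** Whether [b * |v| ^ e] vanishes almost everywhere is independent of the positive exponent [e]. *)
Let mom_eq0 e e' : 0 < e -> mom e = 0%E -> 0 < e' -> mom e' = 0%E.
Proof.
move=> e0 me e'0.
have : ae_eq m setT (fun x => (b x * `|v x| `^ e)%:E) (cst 0%E).
  apply/(ae_eq_integral_abs m measurableT (measurable_mom e)).
  by rewrite -[RHS]me; apply: eq_integral => x _; rewrite gee0_abs.
move=> h; rewrite /mom -(integral0 m setT).
apply: ae_eq_integral => //; apply: filterS h => x /(_ Logic.I) /= [].
move=> /eqP; rewrite mulf_eq0 => /orP[/eqP ->|]; first by rewrite mul0r.
by rewrite powR_eq0 => /andP[/eqP -> _]; rewrite powR0 ?gt_eqF// mulr0.
Qed.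

(** Cauchy-Schwarz and Young in one stroke: integrate [|v| ^ ((p + q) / 2) <= tau / 2 * |v| ^ p +
    |v| ^ q / (2 * tau)] against [b] and optimize [tau]. *)
Lemma moment_young lambda kappa : 0 <= lambda -> 0 < kappa ->
  (lambda%:E * mom ((p + q) / 2) <=
    kappa%:E * (mom p * mom q) + (lambda ^+ 2 / (4 * kappa))%:E)%E.
Proof.
move=> l0 k0; have s0 : 0 < (p + q) / 2 by rewrite divr_gt0// addr_gt0.
have rem0 : 0 <= lambda ^+ 2 / (4 * kappa) by rewrite divr_ge0 ?sqr_ge0// mulr_ge0// ltW.
have zero : mom ((p + q) / 2) = 0%E -> (lambda%:E * mom ((p + q) / 2) <=
    kappa%:E * (mom p * mom q) + (lambda ^+ 2 / (4 * kappa))%:E)%E.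
  by move=> ->; rewrite mule0 adde_ge0 ?lee_fin// !mule_ge0 ?mom_ge0// lee_fin ltW.
have [P0|P0] := eqVneq (mom p) 0%E; first by apply: zero; exact: mom_eq0 P0 _.
have [Q0|Q0] := eqVneq (mom q) 0%E; first by apply: zero; exact: mom_eq0 Q0 _.
have {}P0 : (0 < mom p)%E by rewrite lt_def P0 mom_ge0.
have [l00|lN0] := eqVneq lambda 0.
  by rewrite l00 mul0e adde_ge0 -?l00 ?lee_fin// !mule_ge0 ?mom_ge0// lee_fin ltW.
have {}l0 : 0 < lambda by rewrite lt_def lN0.
case EQ : (mom q) => [Q| |]; last by have := mom_ge0 q; rewrite EQ.
  2: by rewrite gt0_muley// gt0_muley ?lte_fin// addye ?leey.
have {}Q0 : 0 < Q by rewrite -lte_fin -EQ lt_def Q0 mom_ge0.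
(* After multiplication by [lambda], this choice turns the first term into [kappa * mom p * mom q]
   and the second into the remainder. *)
pose tau : R := 2 * kappa * Q / lambda.
have tau0 : 0 < tau by rewrite divr_gt0 ?mulr_gt0.
have : (mom ((p + q) / 2) <= (tau / 2)%:E * mom p + ((2 * tau)^-1)%:E * mom q)%E.
  rewrite -!ge0_integralZl_EFin//; last 2 first.
  - by rewrite invr_ge0 mulr_ge0 ?ltW.
  - by rewrite divr_ge0 ?ltW.
  rewrite -ge0_integralD//; last 4 first.
  - by move=> x _; rewrite mule_ge0// lee_fin divr_ge0 ?ltW.
  - exact: emeasurable_funM.
  - by move=> x _; rewrite mule_ge0// lee_fin invr_ge0 mulr_ge0 ?ltW.
  - exact: emeasurable_funM.
  apply: ge0_le_integral => //.
  - by apply: emeasurable_funD; exact: emeasurable_funM.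
  move=> x _; rewrite -!EFinM -EFinD lee_fin.
  have sq e : `|v x| `^ e = (`|v x| `^ (e / 2)) ^+ 2.
    by rewrite -powR_mulrn ?powR_ge0// -powRrM divfK.
  have -> : `|v x| `^ ((p + q) / 2) = `|v x| `^ (p / 2) * `|v x| `^ (q / 2).
    rewrite mulrDl powRD//; apply/implyP; rewrite gt_eqF// addr_gt0 ?divr_gt0//.
  rewrite (sq p) (sq q); move: (_ `^ _) (_ `^ _) => A B.
  rewrite [X in _ <= X + _]mulrCA [X in _ <= _ + X]mulrCA -mulrDr ler_wpM2l//.
  clearbody tau; rewrite -subr_ge0 [X in 0 <= X](_ : _ = (tau * B - A) ^+ 2 / (2 * tau)).
    by rewrite divr_ge0 ?sqr_ge0// mulr_ge0// ltW.
  by field; rewrite gt_eqF.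
move=> /(lee_wpmul2l (_ : 0 <= lambda%:E)%E); rewrite lee_fin => /(_ (ltW l0)).
move/le_trans; apply; rewrite EQ ge0_muleDr ?mule_ge0 ?mom_ge0 ?lee_fin//; last 3 first.
- by rewrite divr_ge0 ?ltW.
- by rewrite invr_ge0 mulr_ge0 ?ltW.
- exact: ltW.
apply: leeD; last first.
  rewrite -!EFinM lee_fin /tau le_eqVlt; apply/orP; left; apply/eqP; field.
  by rewrite !gt_eqF.
rewrite !muleA [X in (_ <= X)%E]muleAC -!EFinM.
by rewrite /tau (_ : lambda * _ = kappa * Q)//; field; rewrite gt_eqF.
Qed.

End absorption.

Lemma integral_slab T (F : ST -> \bar R) : measurable_fun setT F -> (forall z, 0 <= F z)%E ->
  (\int[W]_(z in slab T) F z =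
   \int[lebesgue_measure]_(t in `]0%R, T[) \int[lebesgue_rV n]_x F (t, x))%E.
Proof.
move=> mF F0; rewrite integral_mkcond.
rewrite (fubini_tonelli1 (m1 := lebesgue_measure) (m2 := lebesgue_rV n)); last 2 first.
- apply: (measurable_restrictT _ (measurable_slab T)).1; exact: measurable_funTS.
- by move=> z; rewrite patchE; case: ifP.
rewrite [RHS]integral_mkcond; apply: eq_integral => t _; rewrite /fubini_F patchE.
case: ifPn => [/set_mem tT|/negP tT].
  by apply: eq_integral => x _; rewrite patchE mem_set.
rewrite -[RHS](integral0 (lebesgue_rV n) setT); apply: eq_integral => x _.
by rewrite patchE memNset// => -[/= /mem_set].
Qed.

(** The additive constant is the threshold beyond which [theta * x ^ (sigma - 1) >= 1]. *)
Lemma young_le (x theta sigma : R) : 0 <= x -> 0 < theta -> 1 < sigma ->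
  x <= theta * x `^ sigma + theta `^ (- (sigma - 1)^-1).
Proof.
move=> x0 th0 s1; set c := theta `^ _; have c0 : 0 < c by rewrite powR_gt0.
have [xc|cx] := leP x c; first by rewrite ler_wpDl// mulr_ge0 ?powR_ge0// ltW.
rewrite ler_wpDr ?(ltW c0)//.
have {}x0 : 0 < x := lt_trans c0 cx.
have -> : x `^ sigma = x * x `^ (sigma - 1).
  by rewrite mulr_powRB1// ?ltW//; lra.
rewrite mulrCA ler_peMr ?(ltW x0)//.
have : c `^ (sigma - 1) <= x `^ (sigma - 1) by rewrite le_powR ?(ltW c0) ?(ltW cx)//; lra.
rewrite /c -powRrM mulNr mulVf; last by rewrite subr_eq0 gt_eqF.
rewrite powR_inv1 ?(ltW th0)// => h; apply: le_trans (ler_wpM2l (ltW th0) h).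
by rewrite mulfV// gt_eqF.
Qed.

(** [young_le] at each point, then [moment_young] at each time with [kappa * eta], where [eta] is
    the cutoff. The exponent [1 / (2 * sigma)] leaves [eta ^ (1 / 2)] in front of the moment; its
    square cancels the [eta] in the denominator, so the remainder does not degenerate as [t] tends
    to [T]. *)
Lemma absorption_time k a r T lambda kappa theta (sigma := (p + q) / 2) :
  0 < r -> 0 < T -> 0 < lambda -> 0 < kappa -> 0 < theta -> 0 < p -> 0 < q -> 2 < p + q ->
  (\int[W]_(z in slab T) (lambda * (`|w z| * (bump_rV k a r z.2 `^ sigma^-1 *
      time_cutoff T z.1 `^ (2 * sigma)^-1)))%:E <=
   \int[lebesgue_measure]_(t in `]0%R, T[)
     ((kappa * time_cutoff T t)%:E * (moment k a r p t * moment k a r q t)) +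
   (T * (lambda ^+ 2 * theta ^+ 2 / (4 * kappa) +
     lambda * theta `^ (- (sigma - 1)^-1) * (2 * r) ^+ n))%:E)%E.
Proof.
move=> r0 T0 l0 k0 th0 p0 q0 pq; have s1 : 1 < sigma by rewrite /sigma; lra.
have s0 : 0 < sigma by lra.
set c0 := _ + _ * _ ^+ n.
have c00 : 0 <= c0.
  by rewrite /c0 addr_ge0 ?divr_ge0 ?mulr_ge0 ?sqr_ge0 ?exprn_ge0 ?powR_ge0 ?mulr_ge0// ltW.
have mbp e : measurable_fun setT (fun z : ST => bump_rV k a r z.2 `^ e).
  apply: (@measurableT_comp _ _ _ _ _ _ (@powR R ^~ e)) => //.
  by apply: (@measurableT_comp _ _ _ _ _ _ (bump_rV k a r)) => //; exact: measurable_bump.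
have mtp e : measurable_fun setT (fun z : ST => time_cutoff T z.1 `^ e).
  apply: (@measurableT_comp _ _ _ _ _ _ (@powR R ^~ e)) => //.
  by apply: (@measurableT_comp _ _ _ _ _ _ (time_cutoff T)) => //; exact: measurable_time_cutoff.
have mF : measurable_fun setT (fun z : ST => (lambda * (`|w z| * (bump_rV k a r z.2 `^ sigma^-1 *
      time_cutoff T z.1 `^ (2 * sigma)^-1)))%:E : \bar R).
  apply/measurable_EFinP; apply: measurable_funM => //.
  apply: measurable_funM; first exact: measurableT_comp.
  exact: measurable_funM.
have F0 z : (0 <= (lambda * (`|w z| * (bump_rV k a r z.2 `^ sigma^-1 *
      time_cutoff T z.1 `^ (2 * sigma)^-1)))%:E)%E.
  by rewrite lee_fin !mulr_ge0 ?powR_ge0// ltW.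
rewrite integral_slab//.
have mPQ (D : set (measurableTypeR R)) : measurable_fun D (fun t : measurableTypeR R => (kappa * time_cutoff T t)%:E *
    (moment k a r p t * moment k a r q t))%E.
  apply: measurable_funTS; apply: emeasurable_funM; last by apply: emeasurable_funM; exact: measurable_moment.
  by apply/measurable_EFinP; apply: measurable_funM => //; exact: measurable_time_cutoff.
have PQ0 t : (0 <= (kappa * time_cutoff T t)%:E * (moment k a r p t * moment k a r q t))%E.
  apply: mule_ge0; first by rewrite lee_fin mulr_ge0 ?time_cutoff_ge0// ltW.
  by rewrite mule_ge0 ?moment_ge0.
have -> : (T * c0)%:E = (\int[lebesgue_measure]_(t in `]0%R, T[) (c0%:E))%E.
  rewrite integral_cst// [X in (_ * X)%E](lebesgue_measure_itv `]0, T[)/=.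
  by rewrite lte_fin T0 sube0 -EFinM mulrC.
rewrite -ge0_integralD//.
apply: ge0_le_integral => //.
- by move=> t _; exact: integral_ge0.
- by apply: measurable_funTS; apply: (measurable_fun_fubini_tonelli_F (m2 := lebesgue_rV n) _ mF).
- exact: emeasurable_funD.
move=> t /=; rewrite in_itv/= => /andP[t0 tT].
set eta := time_cutoff T t.
have eta0 : 0 < eta.
  rewrite /eta /time_cutoff exprn_gt0// /pospart lt_max; apply/orP; right.
  by rewrite subr_gt0 ltr_pdivrMr// mul1r.
have mb : measurable_fun setT (fun x : 'rV[R]_n => (bump_rV k a r x * `|w (t, x)| `^ sigma)%:E : \bar R).
  exact: (measurable_fun_pair2 t (measurable_moment_integrand k a r sigma)).
have mI : measurable_fun setT (fun x => (\1_(cube a r) x)%:E : \bar R).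
  by apply/measurable_EFinP; exact: measurable_indic (measurable_cube _ _).
have b0 x : 0 <= bump_rV k a r x by exact: bump_ge0.
pose l1 := lambda * theta * eta `^ 2^-1; pose l2 := lambda * theta `^ (- (sigma - 1)^-1).
have l10 : 0 <= l1 by rewrite !mulr_ge0 ?powR_ge0 ?ltW.
have l20 : 0 <= l2 by rewrite mulr_ge0 ?powR_ge0 ?ltW.
have I0 x : (0 <= (\1_(cube a r) x)%:E :> \bar R)%E by rewrite lee_fin.
have B0 x : (0 <= (bump_rV k a r x * `|w (t, x)| `^ sigma)%:E :> \bar R)%E.
  by rewrite lee_fin mulr_ge0 ?powR_ge0.
apply: (@le_trans _ _ (\int[lebesgue_rV n]_x (l1%:E * (bump_rV k a r x * `|w (t, x)| `^ sigma)%:E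
   + l2%:E * (\1_(cube a r) x)%:E))%E).
  apply: ge0_le_integral => //.
  - exact: (measurable_fun_pair2 t mF).
  - by apply: emeasurable_funD; exact: emeasurable_funM.
  move=> x _; rewrite -!EFinM -EFinD lee_fin /= -/eta.
  have [bx|bx] := leP (bump_rV k a r x) 0.
    have -> : bump_rV k a r x = 0 by apply/eqP; rewrite eq_le bx b0.
    rewrite powR0 ?invr_eq0 ?gt_eqF// !mul0r !mulr0 add0r mulr_ge0//.
  (* The constant of Young's inequality is paid on the support only, whence the volume
     [(2 * r) ^+ n]. *)
  have -> : \1_(cube a r) x = 1 :> R.
    rewrite indicE mem_set//= /cube/= leNgt; apply/negP => /ltW/(bump_eq0 k r0) bx0.
    by move: bx; rewrite bx0 ltxx.
  have A0 : 0 <= `|w (t, x)| * (bump_rV k a r x `^ sigma^-1 * eta `^ (2 * sigma)^-1).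
    by rewrite !mulr_ge0 ?powR_ge0.
  rewrite /l1 /l2 -!(mulrA lambda) -mulrDr ler_wpM2l ?(ltW l0)// mulr1.
  apply: le_trans (young_le A0 th0 s1) _; rewrite lerD2r -mulrA ler_wpM2l ?(ltW th0)//.
  rewrite powRM ?mulr_ge0 ?powR_ge0// powRM ?powR_ge0// -!powRrM mulVf ?gt_eqF// powRr1//.
  rewrite invfM -mulrA mulVf ?gt_eqF// mulr1 mulrC mulrAC mulrC//.
rewrite ge0_integralD//; last 4 first.
- by move=> x _; rewrite mule_ge0.
- exact: emeasurable_funM.
- by move=> x _; rewrite mule_ge0.
- exact: emeasurable_funM.
rewrite ge0_integralZl_EFin// ge0_integralZl_EFin// integral_indic//; last exact: measurable_cube.
rewrite setIT [X in (_ + _ * X <= _)%E]lebesgue_rV_cube ?(ltW r0)// -EFinM /c0 EFinD addeA.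
apply: leeD => //.
have := @moment_young _ _ (lebesgue_rV n) (bump_rV k a r) (fun x => w (t, x))
  (@measurable_bump R n k a r) (measurable_fun_pair2 t mw) b0 p0 q0 l1 (kappa * eta) l10
  (mulr_gt0 k0 eta0).
rewrite (_ : l1 ^+ 2 / _ = lambda ^+ 2 * theta ^+ 2 / (4 * kappa))//.
have -> : l1 ^+ 2 = lambda ^+ 2 * theta ^+ 2 * eta.
  rewrite /l1 exprMn exprMn; congr (_ * _).
  by rewrite -powR_mulrn ?powR_ge0// -powRrM mulVf// powRr1// ltW.
by field; rewrite !gt_eqF.
Qed.
End weak_inequality.

(** * Scaling and the local case *)

Section scaling.
Context {R : realType} (n : nat) (beta p q : R).
Implicit Types (r kappa t T : R).

Definition decay_bound kappa r : R :=
  r `^ n%:R * (kappa * r `^ (n%:R + beta)) `^ (- (p + q - 1)^-1).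

Lemma decay_bound_ge0 kappa r : 0 <= decay_bound kappa r.
Proof. by rewrite mulr_ge0 ?powR_ge0. Qed.

(** With [M = kappa * r ^ (n + beta) / Lambda] and [m = 1 / (p + q - 1)], the choice
    [theta = M ^ ((sigma - 1) * m)] balances the two summands: since [2 * (sigma - 1) * m = 1 - m],
    both become multiples of [r ^+ n * M ^ (- m)]. *)
Lemma optimal_theta Lambda (sigma := (p + q) / 2) : 2 < p + q -> 0 < Lambda ->
  exists2 C, 0 < C & forall kappa r, 0 < kappa -> 0 < r ->
  exists2 theta, 0 < theta &
    r `^ beta * ((Lambda * r `^ (- beta)) ^+ 2 * theta ^+ 2 / (4 * kappa) +
      Lambda * r `^ (- beta) * theta `^ (- (sigma - 1)^-1) * (2 * r) ^+ n)
    <= C * decay_bound kappa r.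
Proof.
move=> pq L0; pose m := (p + q - 1)^-1.
have m0 : 0 < m by rewrite invr_gt0; lra.
exists (Lambda * Lambda `^ m * (4^-1 + 2 ^+ n)).
  by rewrite !mulr_gt0 ?powR_gt0// addr_gt0 ?invr_gt0 ?exprn_gt0.
move=> kappa r k0 r0; have rb0 : 0 < r `^ beta by rewrite powR_gt0.
have rbN : r `^ (- beta) = (r `^ beta)^-1 by rewrite powRN.
pose M := kappa * r `^ (n%:R + beta) / Lambda.
have M0 : 0 < M by rewrite divr_gt0// mulr_gt0// powR_gt0.
have s1 : sigma - 1 != 0 by rewrite gt_eqF// /sigma; lra.
exists (M `^ ((sigma - 1) * m)); first by rewrite powR_gt0.
have -> : (M `^ ((sigma - 1) * m)) `^ (- (sigma - 1)^-1) = M `^ (- m).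
  by rewrite -powRrM; congr (_ `^ _); field.
have -> : (M `^ ((sigma - 1) * m)) ^+ 2 = M * M `^ (- m).
  rewrite -powR_mulrn ?powR_ge0// -powRrM; transitivity (M `^ (1 - m)).
    by congr (_ `^ _); rewrite /m /sigma; field; rewrite gt_eqF//; lra.
  by rewrite powRD ?powRr1 ?(ltW M0)//; apply/implyP => _; rewrite gt_eqF.
have Mm : M `^ (- m) = Lambda `^ m * (kappa * r `^ (n%:R + beta)) `^ (- m).
  rewrite /M powRM ?invr_ge0 ?mulr_ge0 ?powR_ge0 ?ltW// mulrC; congr (_ * _).
  by rewrite -powR_inv1 ?ltW// -powRrM mulN1r opprK.
have rn : r `^ (n%:R + beta) = r ^+ n * r `^ beta.
  by rewrite powRD ?powR_mulrn ?ltW//; apply/implyP => _; rewrite gt_eqF.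
rewrite Mm /decay_bound -/m powR_mulrn ?(ltW r0)// rbN (exprMn n 2 r) /M {1}rn.
move: (_ `^ (- m)) (Lambda `^ m) (r `^ beta) rb0 (r ^+ n) (2 ^+ n) => x y z z0 u v.
rewrite le_eqVlt; apply/orP; left; apply/eqP; field.
by rewrite !gt_eqF.
Qed.

(** The cutoff is a square with values in [[0, 1]]: its derivative is of the size of its square
    root, and a power with [e <= 1 / 2] is larger still. *)
Lemma time_cutoff_powR_le T t e : 0 < T -> 0 <= t -> 0 < e -> e <= 2^-1 ->
  time_cutoff T t <= time_cutoff T t `^ e /\
  `|dtime_cutoff T t| <= 2 / T * time_cutoff T t `^ e.
Proof.
move=> T0 t0 e0 e2; have eta01 : 0 <= time_cutoff T t <= 1.
  by rewrite time_cutoff_ge0 time_cutoff_le1.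
have /andP[eta0 _] := eta01.
split.
  rewrite -[leLHS]powRr1//; apply: le_powR_exponent => //; lra.
rewrite normrN normrM (ger0_norm (pospart_ge0 _)) ger0_norm; last by rewrite divr_ge0// ltW.
rewrite ler_wpM2l//; first by rewrite divr_ge0// ltW.
apply: le_trans (le_powR_exponent eta01 e0 e2).
by rewrite /time_cutoff -powR_mulrn ?pospart_ge0// -powRrM mulfV// powRr1// pospart_ge0.
Qed.

End scaling.

(** * Absorption at the scale [T = r ^ beta], and the local case *)

Section local_master.
Context {R : realType} (n : nat) (beta p q : R) (K : R -> R) (R0 : R).
Variables (u0 : 'rV[R]_n -> R) (u : R -> 'rV[R]_n -> R).
Hypotheses (n0 : (0 < n)%N) (beta0 : 0 < beta) (p0 : 0 < p) (q0 : 0 < q) (pq : 2 < p + q).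
Hypothesis Kpos : forall r : R, 0 < r -> 0 < K r.
Hypothesis Kinf : forall r : R, R0 < r -> inf (K @` `]0, r[) = K r.
Hypothesis uS : global_weak_solution beta p q K u0 u.
Local Notation ST := (measurableTypeR R * 'rV[R]_n)%type.
Variables (w : ST -> R) (mw : measurable_fun setT w).
Hypothesis uw : {ae @lebesgue_spacetime R n, forall z : ST, 0 < z.1 -> u z.1 z.2 = w z}.
Let sigma := (p + q) / 2.
Local Notation W := (@lebesgue_spacetime R n).
Implicit Types (a : 'rV[R]_n) (r : R) (k : nat).

Let s1 : 1 < sigma. Proof. by rewrite /sigma ltr_pdivlMr ?mul1r. Qed.
Let s0 : 0 < sigma. Proof. exact: lt_trans s1. Qed.
Let N0 : 0 < n%:R :> R. Proof. by rewrite ltr0n. Qed.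

Lemma kernel_lower_bound r rho : R0 < r -> 0 < rho -> rho < r -> K r <= K rho.
Proof.
move=> Rr rho0 rhor; rewrite -(Kinf Rr); apply: ge_inf.
  by exists 0 => _ /= [y + <-]; rewrite in_itv/= => /andP[/Kpos/ltW].
by exists rho => //=; rewrite in_itv/= rho0.
Qed.

(** The infimum in the hypothesis on [K] runs over an open interval; doubling [2 * n * r] provides
    the room. *)
Lemma kernel_scale r : 0 < r -> R0 < 4 * n%:R * r ->
  forall rho, 0 < rho -> rho <= 2 * n%:R * r -> K (4 * n%:R * r) <= K rho.
Proof.
move=> r0 Rr rho rho0 h; apply: kernel_lower_bound => //; apply: le_lt_trans h _.
by rewrite ltr_pM2r// ltr_pM2r//; lra.
Qed.

(** With the time scale [r ^ beta] both linear terms have size [r ^ (- beta)]. [Lambda] is arbitrary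
    and affects only [C]. *)
Lemma absorption_scaled k Lambda : 0 < Lambda ->
  exists2 C, 0 < C & forall a r, 0 < r -> R0 < 4 * n%:R * r ->
  (\int[W]_(z in slab (r `^ beta)) (Lambda * r `^ (- beta) *
     (`|w z| * (bump_rV k a r z.2 `^ sigma^-1 *
        time_cutoff (r `^ beta) z.1 `^ (2 * sigma)^-1)))%:E <=
   (source_mass p q K u k a r (r `^ beta) +
     C * decay_bound n beta p q (K (4 * n%:R * r)) r)%:E)%E.
Proof.
move=> L0; have [C C0 HC] := optimal_theta n beta pq L0.
exists C => // a r r0 Rr; have T0 : 0 < r `^ beta by rewrite powR_gt0.
have k0 : 0 < K (4 * n%:R * r) by apply: Kpos; rewrite !mulr_gt0.
have [theta th0 Hth] := HC _ r k0 r0.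
have l0 : 0 < Lambda * r `^ (- beta) by rewrite mulr_gt0// powR_gt0.
apply: le_trans (@absorption_time _ _ p q w mw k a r _ _ _ theta r0 T0 l0 k0 th0 p0 q0 pq) _.
rewrite EFinD; apply: leeD; last by rewrite lee_fin.
apply: (source_mass_ge uS mw uw) => //; first exact: ltW.
exact: kernel_scale.
Qed.

(* If [fraclap_const n (beta / 2)] were zero, [fraclap] would be the zero operator.
   This degenerate case is treated here, so that no property of the Gamma function is
   needed. *)
Lemma local_master k : k.+3%:R <= sigma * k.+1%:R ->
  beta = 2 \/ beta < 2 /\ fraclap_const n (beta / 2) = 0 ->
  exists2 C, 0 < C & forall r, 0 < r -> R0 < 4 * n%:R * r ->
    initial_mass u0 k 0 r <= C * decay_bound n beta p q (K (4 * n%:R * r)) r.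
Proof.
move=> ks hb; pose L0 : R := n%:R * 4 * k.+3%:R ^+ 2.
have L00 : 0 <= L0 by rewrite !mulr_ge0 ?sqr_ge0.
have lap r T t x : 0 < r -> `|neg_laplacian_pow beta (test k (0 : 'rV[R]_n) r T t) x| <=
    time_cutoff T t * (L0 * r `^ (- beta)) * bump_rV k 0 r x `^ sigma^-1.
  move=> r0; rewrite /neg_laplacian_pow; case: hb => [->|[b2 fc0]].
    rewrite eqxx normrN powRN powR_mulrn ?(ltW r0)//.
    exact: laplacian_test_le.
  rewrite lt_eqF// /fraclap fc0.
  rewrite mul0r normr0; apply: mulr_ge0; last exact: powR_ge0.
  by apply: mulr_ge0; [exact: time_cutoff_ge0|apply: mulr_ge0 => //; exact: powR_ge0].
have L20 : 0 < L0 + 2 by rewrite ltr_wpDl.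
have [C C0 HC] := absorption_scaled k L20.
exists C => // r r0 Rr; pose T := r `^ beta.
have T0 : 0 < T by rewrite powR_gt0.
(* The source mass, a finite number, stands on both sides and cancels. *)
suff : ((initial_mass u0 k 0 r + source_mass p q K u k 0 r T)%:E <=
    (source_mass p q K u k 0 r T + C * decay_bound n beta p q (K (4 * n%:R * r)) r)%:E)%E.
  by rewrite lee_fin addrC lerD2l.
apply: le_trans (HC 0 r r0 Rr).
pose G (z : ST) : R := (L0 + 2) * r `^ (- beta) *
   (bump_rV k 0 r z.2 `^ sigma^-1 * time_cutoff T z.1 `^ (2 * sigma)^-1).
have -> : (\int[W]_(z in slab T) ((L0 + 2) * r `^ (- beta) * (`|w z| * (bump_rV k 0 r z.2 `^ sigma^-1 *
    time_cutoff T z.1 `^ (2 * sigma)^-1)))%:E = \int[W]_(z in slab T) (`|w z| * G z)%:E)%E.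
  by apply: eq_integral => z _; rewrite /G mulrCA.
apply: (weak_inequality uS mw uw r0 T0).
  apply: measurable_funM => //; apply: measurable_funM.
    apply: (@measurableT_comp _ _ _ _ _ _ (@powR R ^~ sigma^-1)) => //.
    by apply: (@measurableT_comp _ _ _ _ _ _ (bump_rV k 0 r)) => //; exact: measurable_bump.
  apply: (@measurableT_comp _ _ _ _ _ _ (@powR R ^~ (2 * sigma)^-1)) => //.
  by apply: (@measurableT_comp _ _ _ _ _ _ (time_cutoff T)) => //; exact: measurable_time_cutoff.
move=> t x /andP[t0 tT].
have e0 : 0 < (2 * sigma)^-1 by rewrite invr_gt0 mulr_gt0.
have e2 : (2 * sigma)^-1 <= 2^-1.
  by rewrite invfM ler_piMr// invf_le1// ltW.
have [h1 h2] := time_cutoff_powR_le T0 (ltW t0) e0 e2.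
have bb : bump_rV k 0 r x <= bump_rV k 0 r x `^ sigma^-1.
  rewrite -[leLHS]powRr1 ?bump_ge0//; apply: le_powR_exponent.
  - by rewrite bump_ge0 bump_le1.
  - by rewrite invr_gt0.
  - by rewrite invf_le1// ltW.
have rb : 0 <= r `^ (- beta) by rewrite powR_ge0.
have TN : T^-1 = r `^ (- beta) by rewrite powRN.
rewrite /G /= mulrDl mulrDl; apply: lerD.
  apply: le_trans (lap r T t x r0) _; rewrite [leRHS]mulrA -[leRHS]mulrAC mulrC [leRHS]mulrC.
  by rewrite ler_wpM2l ?powR_ge0// mulrC ler_wpM2l// mulr_ge0.
rewrite normrM (ger0_norm (bump_ge0 _ _ _ _)) mulrA mulrAC -mulrA -TN.
by apply: le_trans (ler_pM _ _ h2 bb) _; rewrite ?bump_ge0// mulrA.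
Qed.

End local_master.

(** * The nonlocal case *)

Section weight.
Context {R : realType} (n : nat) (d : R).
Hypothesis d0 : 0 < d.
Implicit Types (a x y : 'rV[R]_n) (r : R) (k : nat).
Local Notation mu := (lebesgue_rV n).
Local Notation alpha := (n%:R + d).

Definition weight r x : R := (1 + `|x| / r) `^ (- alpha).

Let alpha0 : 0 < alpha. Proof. by rewrite ltr_pwDr. Qed.

Lemma weight_ge0 r x : 0 <= weight r x. Proof. exact: powR_ge0. Qed.

Lemma weight_le r x y : 0 < r -> `|x| <= `|y| -> weight r y <= weight r x.
Proof.
move=> r0 xy; apply: powR_ltr0; first by rewrite oppr_le0 ltW.
  by rewrite ltr_pwDl// divr_ge0// ltW.
by rewrite lerD2l ler_pM2r ?invr_gt0.
Qed.

Lemma weight_le1 r x : 0 < r -> weight r x <= 1.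
Proof.
move=> r0; apply: le_trans (weight_le (x := 0) r0 _) _; first by rewrite normr0.
by rewrite /weight normr0 mul0r addr0 powR1.
Qed.

Lemma weight_scale r x y (c : R) : 0 < r -> 0 < c -> 1 + `|y| / r <= c * (1 + `|x| / r) ->
  weight r x <= c `^ alpha * weight r y.
Proof.
move=> r0 c0 h; have yr : 0 < 1 + `|y| / r by rewrite ltr_pwDl// divr_ge0// ltW.
have xr : 0 < 1 + `|x| / r by rewrite ltr_pwDl// divr_ge0// ltW.
have -> : weight r x = c `^ alpha * (c * (1 + `|x| / r)) `^ (- alpha).
  rewrite powRM ?ltW// mulrA -powRD ?subrr ?powRr0 ?mul1r//.
  by rewrite (gt_eqF c0) implybT.
rewrite ler_wpM2l ?powR_ge0//; apply: powR_ltr0 => //.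
by rewrite oppr_le0 ltW.
Qed.

Lemma measurable_weight r a : measurable_fun setT (fun y => weight r (y - a)).
Proof.
apply: (@measurableT_comp _ _ _ _ _ _ (@powR R ^~ (- alpha))) => //.
apply: measurable_funD => //; apply: measurable_funM => //.
exact: measurable_rV_norm.
Qed.

(** The weight is at most 1 on the cube of radius [r] and at most [(|y - x| / r) ^ (- alpha)]
    outside. *)
Lemma integral_weight_le : exists2 C, 0 < C & forall x r, 0 < r ->
  (\int[mu]_y (weight r (y - x))%:E <= (C * r ^+ n)%:E)%E.
Proof.
have [C C0 HC] := @integral_far_le R n d d0.
exists (2 ^+ n + C); first by rewrite addr_gt0 ?exprn_gt0.
move=> x r r0; pose F := [set y : 'rV[R]_n | r < `|y - x|].
have mF : measurable F by exact: measurable_far.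
have mC := measurable_cube x r.
have mf D : measurable_fun D (fun y : 'rV[R]_n => (r `^ alpha * `|y - x| `^ (- alpha))%:E : \bar R).
  apply/measurable_EFinP; apply: measurable_funM => //; exact: measurable_powR_dist.
have rr : `|r `^ alpha * (C * r `^ (- d))| = C * r ^+ n.
  rewrite ger0_norm; last by rewrite !mulr_ge0 ?powR_ge0// ltW.
  rewrite mulrCA -powRD ?addrK ?powR_mulrn ?ltW//.
  by apply/implyP => _; rewrite gt_eqF.
apply: (@le_trans _ _ (\int[mu]_y ((\1_(cube x r) y)%:E +
    ((fun y => (r `^ alpha * `|y - x| `^ (- alpha))%:E) \_ F) y))%E).
  apply: ge0_le_integral => //.
  - by move=> y _; rewrite lee_fin weight_ge0.
  - by apply/measurable_EFinP; exact: measurable_weight.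
  - apply: emeasurable_funD; first by apply/measurable_EFinP; exact: measurable_indic.
    exact: (measurable_restrictT _ mF).1.
  move=> y _; have [yx|yx] := leP `|y - x| r.
    rewrite indicE mem_set// patchE memNset; last by rewrite /F/= ltNge yx.
    by rewrite adde0 lee_fin weight_le1.
  rewrite patchE mem_set// indicE memNset ?add0e; last by rewrite /cube/= leNgt yx.
  rewrite lee_fin /weight.
  have yx0 : 0 < `|y - x| := lt_trans r0 yx.
  have -> : r `^ alpha * `|y - x| `^ (- alpha) = (`|y - x| / r) `^ (- alpha).
    rewrite powRM ?invr_ge0 ?(ltW r0)// mulrC; congr (_ * _).
    by rewrite -powR_inv1 ?(ltW r0)// -powRrM mulN1r opprK.
  apply: powR_ltr0; [by rewrite oppr_le0 ltW|by rewrite divr_gt0|by rewrite lerDr].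
rewrite ge0_integralD//; last 3 first.
- by apply/measurable_EFinP; exact: measurable_indic.
- move=> y _; rewrite patchE; case: ifP => // _.
  by rewrite lee_fin mulr_ge0 ?powR_ge0.
- exact: (measurable_restrictT _ mF).1.
rewrite integral_indic// setIT mulrDl EFinD; apply: leeD.
  by rewrite [leLHS]lebesgue_rV_cube ?(ltW r0)// exprMn.
rewrite -integral_mkcond; under eq_integral do rewrite EFinM.
rewrite ge0_integralZl_EFin ?powR_ge0//; last first.
  by apply/measurable_EFinP; exact: measurable_powR_dist.
apply: le_trans (lee_wpmul2l _ (HC x r r0)) _; first by rewrite lee_fin powR_ge0.
by rewrite -EFinM lee_fin -rr ler_norm.
Qed.

(* [max(|a|, |x - a|) >= |x| / 2]. *)
Lemma weight_mul_le r x a : 0 < r ->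
  weight r a * weight r (x - a) <= 2 `^ alpha * weight r x * (weight r a + weight r (a - x)).
Proof.
move=> r0; have -> : weight r (a - x) = weight r (x - a) by rewrite /weight distrC.
have := weight_ge0 r a; have := weight_ge0 r (x - a); have := weight_ge0 r x.
have c0 : 0 <= 2 `^ alpha :> R by exact: powR_ge0.
have xa : `|x| <= `|x - a| + `|a| by rewrite -{1}(subrK a x) ler_normD.
have H y : `|x| <= 2 * `|y| -> weight r y <= 2 `^ alpha * weight r x.
  move=> xy; apply: weight_scale => //; rewrite mulrDr mulr1 mulrA.
  by apply: lerD; [rewrite lerDl|rewrite ler_pM2r// invr_gt0].
have [h|h] := leP `|x - a| `|a|.
  have AX : weight r a <= 2 `^ alpha * weight r x by apply: H; lra.
  move: AX; move: (weight r a) (weight r (x - a)) (weight r x) => A B X AX X0 B0 A0.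
  by apply: le_trans (ler_wpM2r B0 AX) _; rewrite mulrDr lerDr !mulr_ge0.
have AX : weight r (x - a) <= 2 `^ alpha * weight r x by apply: H; lra.
move: AX; move: (weight r a) (weight r (x - a)) (weight r x) => B A X AX X0 A0 B0.
by rewrite mulrC; apply: le_trans (ler_wpM2r B0 AX) _; rewrite mulrDr lerDl !mulr_ge0.
Qed.

(** [weight_mul_le] extracts [weight r x] and leaves two integrals of a single weight. *)
Lemma weight_subconvolution : exists2 C, 0 < C & forall x r, 0 < r ->
  (\int[mu]_a (weight r a * weight r (x - a))%:E <= (C * r ^+ n * weight r x)%:E)%E.
Proof.
have [C C0 HC] := integral_weight_le.
exists (2 `^ alpha * (C + C)); first by rewrite mulr_gt0 ?powR_gt0 ?addr_gt0.
move=> x r r0.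
have c0 : 0 <= 2 `^ alpha * weight r x by rewrite mulr_ge0 ?powR_ge0.
have mw y : measurable_fun setT (fun a : 'rV[R]_n => (weight r (a - y))%:E : \bar R).
  by apply/measurable_EFinP; exact: measurable_weight.
have mw0 : measurable_fun setT (fun a : 'rV[R]_n => (weight r a)%:E : \bar R).
  by apply: eq_measurable_fun (mw 0) => a _; rewrite subr0.
have mw1 : measurable_fun setT (fun a : 'rV[R]_n => (weight r (x - a))%:E : \bar R).
  by apply: eq_measurable_fun (mw x) => a _; rewrite /weight distrC.
have W0 y : (0 <= (weight r y)%:E)%E by rewrite lee_fin weight_ge0.
have mD : measurable_fun setT (fun a : 'rV[R]_n => (weight r a)%:E + (weight r (a - x))%:E)%E.
  exact: emeasurable_funD mw0 (mw x).
apply: (@le_trans _ _ (\int[mu]_a ((2 `^ alpha * weight r x)%:E *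
    ((weight r a)%:E + (weight r (a - x))%:E)))%E).
  apply: (ge0_le_integral _ measurableT).
  - by move=> a _; rewrite EFinM; exact: mule_ge0.
  - by apply: eq_measurable_fun (emeasurable_funM mw0 mw1) => a _; rewrite EFinM.
  - exact: emeasurable_funM (measurable_cst _) mD.
  - by move=> a _; rewrite -EFinD -EFinM lee_fin; exact: weight_mul_le.
rewrite (ge0_integralZl_EFin _ measurableT _ mD c0); last first.
  by move=> a _; exact: adde_ge0.
rewrite (ge0_integralD _ measurableT (fun a _ => W0 a) mw0 (fun a _ => W0 (a - x)) (mw x)).
have HC0 : (\int[mu]_a (weight r a)%:E <= (C * r ^+ n)%:E)%E.
  by apply: le_trans (HC 0 r r0); under [leRHS]eq_integral do rewrite subr0.
apply: le_trans (lee_wpmul2l _ (leeD HC0 (HC x r r0))) _; first by rewrite lee_fin.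
by rewrite -EFinD -EFinM lee_fin -mulrDl le_eqVlt; apply/orP; left; apply/eqP; ring.
Qed.

Lemma bump_sym k a r x : bump_rV k a r x = bump_rV k x r a.
Proof.
by apply: eq_bigr => i _; rewrite /bump_factor -opprB mulNr /bump1 sqrrN.
Qed.

(** Puts the time derivative term under the same weight as the fractional Laplacian: on the support
    [1 + |x - a| / r <= 2]. *)
Lemma bump_le_weight k a r x : 0 < r -> bump_rV k a r x <= 2 `^ alpha * weight r (x - a).
Proof.
move=> r0; have [h|h] := leP r `|x - a|.
  by rewrite bump_eq0// mulr_ge0 ?powR_ge0.
apply: le_trans (bump_le1 k a r x) _.
apply: (@le_trans _ _ (weight r (0 : 'rV[R]_n))).
  by rewrite /weight normr0 mul0r addr0 powR1.
apply: weight_scale => //; rewrite normr0 mul0r addr0 mulr1.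
have : `|x - a| / r <= 1 by rewrite ler_pdivrMr// mul1r ltW.
lra.
Qed.

(* For [|x| > 3r/4] the mass of the bumps containing [x] comes from the centres
   in the cube of radius [r/8] around the point [x (1 + 5r/(8|x|))], all of norm
   at least [5r/4] and at distance at most [3r/4] from [x]. *)
Lemma weight_cover k e : 0 < e -> exists2 C, 0 < C & forall x r, 0 < r ->
  ((weight r x)%:E <= C%:E * ((bump_rV k 0 r x `^ e)%:E + (r ^- n)%:E *
    \int[mu]_(a in [set a : 'rV[R]_n | (9 / 8 * r < `|a - 0|)%R])
      (weight r a * bump_rV k a r x `^ e)%:E))%E.
Proof.
move=> e0; pose m : R := ((7 / 16) ^+ (k.+3 * n)) `^ e.
have m0 : 0 < m by rewrite powR_gt0// exprn_gt0.
have bm a x r : 0 < r -> `|x - a| <= 3 / 4 * r -> m <= bump_rV k a r x `^ e.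
  by move=> r0 xa; apply: le_powR (ltW e0) _ (bump_ge k r0 xa); rewrite exprn_ge0.
(* [(4^-1) ^+ n] is the volume of a cube of radius [r / 8] divided by [r ^+ n]; [2 ^ (- alpha)]
   compares the weights at the centres of that cube with the weight at [x]; [m] bounds the bumps
   from below. *)
pose c : R := (4^-1) ^+ n * 2 `^ (- alpha) * m.
have c0 : 0 < c by rewrite !mulr_gt0 ?powR_gt0// exprn_gt0.
exists (m^-1 + c^-1); first by rewrite addr_gt0 ?invr_gt0.
move=> x r r0; set F := [set a | _]; set I := (\int[mu]_(a in F) _)%E.
have mF : measurable F by exact: measurable_far.
have mb : measurable_fun setT (fun a : 'rV[R]_n => bump_rV k a r x `^ e).
  apply: (@measurableT_comp _ _ _ _ _ _ (@powR R ^~ e)) => //.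
  by under eq_fun do rewrite bump_sym; exact: measurable_bump.
have mI D : measurable_fun D (fun a : 'rV[R]_n => (weight r a * bump_rV k a r x `^ e)%:E : \bar R).
  apply/measurable_EFinP; apply: measurable_funTS; apply: measurable_funM => //.
  by apply: eq_measurable_fun (measurable_weight r 0) => a _; rewrite subr0.
have I0 : (0 <= I)%E by apply: integral_ge0 => a _; rewrite lee_fin mulr_ge0 ?powR_ge0.
have rI0 : (0 <= (r ^- n)%:E * I)%E by rewrite mule_ge0// lee_fin invr_ge0 exprn_ge0 ?ltW.
have C0 : 0 <= m^-1 + c^-1 by rewrite addr_ge0 ?invr_ge0 ?ltW.
have [h|h] := leP `|x| (3 / 4 * r).
  apply: (@le_trans _ _ 1%E); first by rewrite lee_fin weight_le1.
  apply: (@le_trans _ _ ((m^-1 + c^-1)%:E * m%:E)%E).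
    by rewrite -EFinM lee_fin mulrDl mulVf ?gt_eqF// lerDl mulr_ge0 ?invr_ge0 ?ltW.
  apply: lee_wpmul2l; first by rewrite lee_fin.
  by rewrite -[leLHS]adde0; apply: leeD => //; rewrite lee_fin bm ?subr0.
have x0 : 0 < `|x| by apply: lt_trans h; rewrite mulr_gt0.
pose y := (1 + 5 * r / (8 * `|x|)) *: x.
have yx : `|y - x| = 5 / 8 * r.
  rewrite /y scalerDl scale1r addrC addKr normrZ ger0_norm; last by rewrite divr_ge0 ?mulr_ge0// ltW.
  by field; rewrite gt_eqF.
have y0 : `|y| = `|x| + 5 / 8 * r.
  rewrite /y normrZ ger0_norm; last by rewrite addr_ge0// divr_ge0 ?mulr_ge0// ltW.
  by field; rewrite gt_eqF.
clearbody y.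
have r8 : 0 <= r / 8 by rewrite divr_ge0// ltW.
pose Q := cube y (r / 8); have mQ : measurable Q by exact: measurable_cube.
have Qa a : Q a -> [/\ 9 / 8 * r < `|a - 0|, `|x - a| <= 3 / 4 * r & `|a| <= `|x| + 3 / 4 * r].
  rewrite /Q /cube/= subr0 => ay.
  have h1 := ler_normD (y - a) a; rewrite subrK (distrC y a) in h1.
  have h2 := ler_normD (x - y) (y - a); rewrite addrA subrK (distrC x y) (distrC y a) in h2.
  have h3 := ler_normD (a - y) y; rewrite subrK in h3.
  by split; lra.
have IQ : ((2 `^ (- alpha) * weight r x * m * (r / 4) ^+ n)%:E <= I)%E.
  apply: (@le_trans _ _ (\int[mu]_(a in Q) (weight r a * bump_rV k a r x `^ e)%:E)%E); last first.
    apply: ge0_subset_integral => //.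
      by move=> a _; rewrite lee_fin mulr_ge0 ?powR_ge0.
    by move=> a /Qa[].
  apply: (@le_trans _ _ (\int[mu]_(a in Q) (cst (2 `^ (- alpha) * weight r x * m)%:E a))%E); last first.
    apply: ge0_le_integral => //.
    - by move=> a _; rewrite lee_fin !mulr_ge0 ?powR_ge0// ltW.
    move=> a /Qa[_ xa ax]; rewrite lee_fin; apply: ler_pM.
    - by rewrite mulr_ge0 ?powR_ge0.
    - exact: ltW.
    - have : weight r x <= 2 `^ alpha * weight r a.
        apply: weight_scale => //; have : `|a| / r <= `|x| / r + 3 / 4.
          by rewrite ler_pdivrMr// mulrDl divfK ?gt_eqF.
        by have : 0 <= `|x| / r by [rewrite divr_ge0// ltW]; lra.
      by move=> h'; rewrite powRN [leLHS]mulrC ler_pdivrMr ?powR_gt0// [leRHS]mulrC.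
    - exact: bm.
  rewrite integral_cst// [X in (_ <= _ * X)%E]lebesgue_rV_cube//.
  rewrite -EFinM lee_fin ler_wpM2l// ?mulr_ge0 ?powR_ge0 ?(ltW m0)//.
  by rewrite le_eqVlt; apply/orP; left; apply/eqP; congr (_ ^+ _); field.
have cI : ((c * weight r x)%:E <= (r ^- n)%:E * I)%E.
  apply: le_trans (lee_wpmul2l _ IQ); last by rewrite lee_fin invr_ge0 exprn_ge0 ?ltW.
  rewrite -EFinM lee_fin /c exprMn le_eqVlt; apply/orP; left; apply/eqP.
  have : r ^+ n != 0 by rewrite expf_neq0// gt_eqF.
  by move: (r ^+ n) (4^-1 ^+ n) => A B A0; field.
apply: (@le_trans _ _ ((m^-1 + c^-1)%:E * (c * weight r x)%:E)%E).
  rewrite -EFinM lee_fin mulrA mulrDl mulVf ?(gt_eqF c0)// ler_peMl ?weight_ge0//.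
  by rewrite lerDr mulr_ge0 ?invr_ge0 ?ltW.
apply: lee_wpmul2l; first by rewrite lee_fin.
by rewrite -[leLHS]add0e; apply: leeD => //; rewrite lee_fin powR_ge0.
Qed.

End weight.

Section spacetime_sigma_finite.
Context {R : realType} (n : nat).

(** Tonelli's theorem is applied below to the product of the space of centres with space-time. *)
Let lebesgue_spacetime_sigma_finite : sigma_finite setT (@lebesgue_spacetime R n).
Proof.
have /sigma_finiteP[F [TF ndF Foo]] := sigma_finiteT (@lebesgue_measure R).
exists (fun k => F k `*` cube (0 : 'rV[R]_n) k%:R).
  apply/seteqP; split => // -[t x] _.
  have [i _ Fit] : (\bigcup_k F k) t by rewrite -TF.
  exists (maxn i (Num.truncn `|x|).+1) => //; split => /=.
    by move: t Fit; exact/subsetPset/ndF/leq_maxl.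
  rewrite /cube/= subr0; apply: le_trans (ltW (truncnS_gt _)) _.
  by rewrite ler_nat leq_maxr.
move=> k; have [mFk Fk] := Foo k; have mC := measurable_cube (0 : 'rV[R]_n) k%:R.
split; first exact: measurableX.
rewrite /lebesgue_spacetime product_measure1E// lte_mul_pinfty// ?ge0_fin_numE//.
by rewrite [X in (X < _)%E]lebesgue_rV_cube// ltry.
Qed.

HB.instance Definition _ := Measure_isSigmaFinite.Build _ _ _
  (@lebesgue_spacetime R n) lebesgue_spacetime_sigma_finite.

End spacetime_sigma_finite.

(** * Averaging over the centres *)

Section superposition.
Context {R : realType} (n : nat) (d e : R) (k : nat).
Context dX (X : measurableType dX) (m : {sigma_finite_measure set X -> \bar R}).
Variables (y : X -> 'rV[R]_n) (v : X -> R).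
Hypotheses (my : measurable_fun setT y) (mv : measurable_fun setT v) (v0 : forall z, 0 <= v z).
Implicit Types (a : 'rV[R]_n) (r : R).
Local Notation mu := (lebesgue_rV n).
Local Notation weight := (@weight R n d).

(** A bump of radius [r] centred beyond [9 / 8 * r] vanishes on the cube of radius [r / 8] around
    the origin. *)
Definition outer_weight r a : R := weight r a * \1_[set a : 'rV[R]_n | 9 / 8 * r < `|a - 0|] a.

(** In the application [X] is space-time, [y] the space coordinate and [v] the density carrying
    [|w|]. *)
Definition weighted_mass r a : \bar R := (\int[m]_z (v z * weight r (y z - a))%:E)%E.
Definition bump_mass r a : \bar R := (\int[m]_z (v z * bump_rV k a r (y z) `^ e)%:E)%E.

Lemma outer_weight_ge0 r a : 0 <= outer_weight r a.
Proof. by rewrite mulr_ge0 ?powR_ge0. Qed.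

Lemma outer_weight_le r a : outer_weight r a <= weight r a.
Proof. by rewrite ler_piMr ?powR_ge0// indicE; case: (_ \in _). Qed.

Let measurable_weight0 r : measurable_fun setT (weight r).
Proof. by apply: eq_measurable_fun (measurable_weight d r 0) => a _; rewrite subr0. Qed.

Lemma measurable_outer_weight r : measurable_fun setT (outer_weight r).
Proof.
apply: measurable_funM; first exact: measurable_weight0.
by apply: measurable_indic; exact: measurable_far.
Qed.

Lemma measurable_rV_sub dY (Y : measurableType dY) (f g : Y -> 'rV[R]_n) :
  measurable_fun setT f -> measurable_fun setT g -> measurable_fun setT (fun z => f z - g z).
Proof.
move=> mf mg; apply: measurable_fun_rVP => i.
rewrite (_ : _ \o _ = fun z => f z ord0 i - g z ord0 i); last first.
  by apply/funext => z /=; rewrite !mxE.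
have mc h : measurable_fun setT h -> measurable_fun setT (fun z : Y => (h z : 'rV[R]_n) ord0 i).
  move=> mh; apply: (@measurableT_comp _ _ _ _ _ _ (fun v : 'rV[R]_n => v ord0 i)) => //.
  exact: measurable_rV_coord.
by apply: measurable_funB; exact: mc.
Qed.

Let measurable_sub : measurable_fun setT (fun az : 'rV[R]_n * X => y az.2 - az.1).
Proof. by apply: measurable_rV_sub => //; exact: measurableT_comp. Qed.

Let wker r (az : 'rV[R]_n * X) : \bar R :=
  (outer_weight r az.1 * (v az.2 * weight r (y az.2 - az.1)))%:E.
Let bker r (az : 'rV[R]_n * X) : \bar R :=
  (outer_weight r az.1 * (v az.2 * bump_rV k az.1 r (y az.2) `^ e))%:E.

Let mo r : measurable_fun setT (fun az : 'rV[R]_n * X => outer_weight r az.1).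
Proof.
apply: (@measurableT_comp _ _ _ _ _ _ (outer_weight r)) => //.
exact: measurable_outer_weight.
Qed.

Let mv2 : measurable_fun setT (fun az : 'rV[R]_n * X => v az.2).
Proof. exact: measurableT_comp. Qed.

Let mwker r : measurable_fun setT (wker r).
Proof.
apply/measurable_EFinP; apply: measurable_funM => //; apply: measurable_funM => //.
apply: (@measurableT_comp _ _ _ _ _ _ (weight r)); first exact: measurable_weight0.
exact: measurable_sub.
Qed.

Lemma bump_translate a r x : bump_rV k a r x = bump_rV k 0 r (x - a).
Proof. by apply: eq_bigr => i _; rewrite /bump_factor !mxE subr0. Qed.

Let mbker r : measurable_fun setT (bker r).
Proof.
apply/measurable_EFinP; apply: measurable_funM => //; apply: measurable_funM => //.
apply: (@measurableT_comp _ _ _ _ _ _ (@powR R ^~ e)) => //.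
under eq_fun do rewrite bump_translate.
apply: (@measurableT_comp _ _ _ _ _ _ (bump_rV k 0 r)); first exact: measurable_bump.
exact: measurable_sub.
Qed.

Let wker0 r az : (0 <= wker r az)%E.
Proof. by rewrite lee_fin !mulr_ge0 ?powR_ge0. Qed.

Let bker0 r az : (0 <= bker r az)%E.
Proof. by rewrite lee_fin !mulr_ge0 ?powR_ge0. Qed.

Let mvw r a : measurable_fun setT (fun z => (v z * weight r (y z - a))%:E : \bar R).
Proof.
apply/measurable_EFinP; apply: measurable_funM => //.
apply: (@measurableT_comp _ _ _ _ _ _ (weight r)); first exact: measurable_weight0.
exact: (measurable_rV_sub my (measurable_cst a)).
Qed.

Let mvb r a : measurable_fun setT (fun z => (v z * bump_rV k a r (y z) `^ e)%:E : \bar R).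
Proof.
apply/measurable_EFinP; apply: measurable_funM => //.
apply: (@measurableT_comp _ _ _ _ _ _ (@powR R ^~ e)) => //.
by apply: (@measurableT_comp _ _ _ _ _ _ (bump_rV k a r)) => //; exact: measurable_bump.
Qed.

Let wkerE r a : (fubini_F m (wker r) a = (outer_weight r a)%:E * weighted_mass r a)%E.
Proof.
rewrite /fubini_F /weighted_mass -(ge0_integralZl_EFin m measurableT _ (mvw r a)).
- by [].
- by move=> z _; rewrite lee_fin mulr_ge0 ?powR_ge0.
- exact: outer_weight_ge0.
Qed.

Let bkerE r a : (fubini_F m (bker r) a = (outer_weight r a)%:E * bump_mass r a)%E.
Proof.
rewrite /fubini_F /bump_mass -(ge0_integralZl_EFin m measurableT _ (mvb r a)).
- by [].
- by move=> z _; rewrite lee_fin mulr_ge0 ?powR_ge0.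
- exact: outer_weight_ge0.
Qed.

Lemma measurable_weighted_mass r :
  measurable_fun setT (fun a => (outer_weight r a)%:E * weighted_mass r a)%E.
Proof.
apply: eq_measurable_fun (measurable_fun_fubini_tonelli_F _ (@mwker r) (@wker0 r)) => a _.
exact: wkerE.
Qed.

Lemma measurable_bump_mass r :
  measurable_fun setT (fun a => (outer_weight r a)%:E * bump_mass r a)%E.
Proof.
apply: eq_measurable_fun (measurable_fun_fubini_tonelli_F _ (@mbker r) (@bker0 r)) => a _.
exact: bkerE.
Qed.

Lemma weighted_mass_ge0 r a : (0 <= weighted_mass r a)%E.
Proof. by apply: integral_ge0 => z _; rewrite lee_fin mulr_ge0 ?powR_ge0. Qed.

Lemma bump_mass_ge0 r a : (0 <= bump_mass r a)%E.
Proof. by apply: integral_ge0 => z _; rewrite lee_fin mulr_ge0 ?powR_ge0. Qed.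

(** After Tonelli, for each fixed [z] the truncation of the weight is dropped and the subconvolution
    applies in the centre variable. *)
Lemma integral_weighted_mass_le C r : 0 < C -> 0 < r ->
  (forall x, \int[mu]_a (weight r a * weight r (x - a))%:E <= (C * r ^+ n * weight r x)%:E)%E ->
  (\int[mu]_a ((outer_weight r a)%:E * weighted_mass r a) <= (C * r ^+ n)%:E * weighted_mass r 0)%E.
Proof.
move=> C0 r0 HC.
under eq_integral do rewrite -wkerE.
rewrite (fubini_tonelli _ (@mwker r) (@wker0 r)).
have c0 : 0 <= C * r ^+ n by rewrite mulr_ge0 ?exprn_ge0 ?ltW.
rewrite /weighted_mass -(ge0_integralZl_EFin m measurableT _ (mvw r 0) c0); last first.
  by move=> z _; rewrite lee_fin mulr_ge0 ?powR_ge0.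
apply: ge0_le_integral_nonmeasurable => // [z _|z _|z _].
- by apply: integral_ge0 => a _; exact: wker0.
- by apply: mule_ge0; rewrite lee_fin// mulr_ge0 ?powR_ge0.
rewrite subr0 -EFinM mulrCA EFinM.
apply: (@le_trans _ _ ((v z)%:E * \int[mu]_a (weight r a * weight r (y z - a))%:E)%E); last first.
  by apply: lee_wpmul2l; [rewrite lee_fin|exact: HC].
have mww : measurable_fun setT (fun a => (weight r a * weight r (y z - a))%:E : \bar R).
  apply/measurable_EFinP; apply: measurable_funM; first exact: measurable_weight0.
  apply: (@measurableT_comp _ _ _ _ _ _ (weight r)); first exact: measurable_weight0.
  exact: (measurable_rV_sub (measurable_cst (y z)) (@measurable_id _ _ setT)).
rewrite -(ge0_integralZl_EFin _ measurableT _ mww (v0 z)); last first.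
  by move=> a _; rewrite lee_fin mulr_ge0 ?powR_ge0.
apply: ge0_le_integral_nonmeasurable => // a _.
  by apply: mule_ge0; rewrite lee_fin ?mulr_ge0 ?powR_ge0.
rewrite /wker/= -EFinM lee_fin mulrCA ler_wpM2l//.
by rewrite ler_wpM2r ?powR_ge0// outer_weight_le.
Qed.

(** The pointwise covering of the weight, integrated against [v]; Tonelli moves the integral over
    the centres outside. *)
Lemma weighted_mass_cover C r : 0 < C -> 0 < r ->
  (forall x, (weight r x)%:E <= C%:E * ((bump_rV k 0 r x `^ e)%:E + (r ^- n)%:E *
    \int[mu]_(a in [set a : 'rV[R]_n | (9 / 8 * r < `|a - 0|)%R])
      (weight r a * bump_rV k a r x `^ e)%:E))%E ->
  (weighted_mass r 0 <= C%:E * (bump_mass r 0 + (r ^- n)%:E *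
    \int[mu]_a ((outer_weight r a)%:E * bump_mass r a)))%E.
Proof.
move=> C0 r0 HC.
under eq_integral do rewrite -bkerE.
rewrite (fubini_tonelli _ (@mbker r) (@bker0 r)).
have rn0 : 0 <= r ^- n by rewrite invr_ge0 exprn_ge0 ?ltW.
have mG := measurable_fun_fubini_tonelli_G (m1 := mu) _ (@mbker r) (@bker0 r).
have G0 z : (0 <= \int[mu]_a bker r (a, z))%E by apply: integral_ge0 => a _; exact: bker0.
rewrite -(ge0_integralZl_EFin m measurableT (fun z _ => G0 z) mG rn0).
have mrG : measurable_fun setT (fun z => (r ^- n)%:E * \int[mu]_a bker r (a, z))%E.
  exact: emeasurable_funM (measurable_cst _) mG.
have rG0 z : (0 <= (r ^- n)%:E * \int[mu]_a bker r (a, z))%E by rewrite mule_ge0.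
have B0 z : (0 <= (v z * bump_rV k 0 r (y z) `^ e)%:E)%E by rewrite lee_fin mulr_ge0 ?powR_ge0.
rewrite /bump_mass -(ge0_integralD m measurableT (fun z _ => B0 z) (mvb r 0) (fun z _ => rG0 z) mrG).
have mBG : measurable_fun setT (fun z => (v z * bump_rV k 0 r (y z) `^ e)%:E +
    (r ^- n)%:E * \int[mu]_a bker r (a, z))%E.
  exact: emeasurable_funD (mvb r 0) mrG.
rewrite -(ge0_integralZl_EFin m measurableT _ mBG (ltW C0)); last first.
  by move=> z _; exact: adde_ge0.
apply: ge0_le_integral_nonmeasurable => // [z _|z _|z _].
- by rewrite lee_fin mulr_ge0 ?powR_ge0.
- by apply: mule_ge0; [rewrite lee_fin ltW|exact: adde_ge0].
have := lee_wpmul2l (_ : 0 <= (v z)%:E)%E (HC (y z)).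
rewrite lee_fin => /(_ (v0 z)); rewrite subr0 EFinM => /le_trans; apply.
set F := [set a | _]; have mF : measurable F by exact: measurable_far.
have mI : measurable_fun setT (fun a => (weight r a * bump_rV k a r (y z) `^ e)%:E : \bar R).
  apply/measurable_EFinP; apply: measurable_funM; first exact: measurable_weight0.
  apply: (@measurableT_comp _ _ _ _ _ _ (@powR R ^~ e)) => //.
  by under eq_fun do rewrite bump_sym; exact: measurable_bump.
have -> : (\int[mu]_a bker r (a, z) =
    (v z)%:E * \int[mu]_(a in F) (weight r a * bump_rV k a r (y z) `^ e)%:E)%E.
  rewrite -(ge0_integralZl_EFin _ mF _ (measurable_funTS mI) (v0 z)); last first.
    by move=> a _; rewrite lee_fin mulr_ge0 ?powR_ge0.
  rewrite integral_mkcond; apply: eq_integral => a _.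
  rewrite patchE /bker /outer_weight /= indicE -/F; case: (a \in F).
    by rewrite mulr1 -EFinM mulrCA.
  by rewrite mulr0 mul0r.
have J0 : (0 <= \int[mu]_(a in F) (weight r a * bump_rV k a r (y z) `^ e)%:E)%E.
  by apply: integral_ge0 => a _; rewrite lee_fin mulr_ge0 ?powR_ge0.
rewrite muleCA; apply: lee_wpmul2l; first by rewrite lee_fin ltW.
rewrite ge0_muleDr ?lee_fin ?powR_ge0//; last by rewrite mule_ge0.
by rewrite -EFinM muleCA.
Qed.

End superposition.

(** * The inequality for the initial mass when [beta < 2] *)

Section fractional_master.
Context {R : realType} (n : nat) (beta p q : R) (K : R -> R) (R0 : R).
Variables (u0 : 'rV[R]_n -> R) (u : R -> 'rV[R]_n -> R).
Hypotheses (n0 : (0 < n)%N) (beta0 : 0 < beta) (beta2 : beta < 2).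
Hypotheses (p0 : 0 < p) (q0 : 0 < q) (pq : 2 < p + q).
Hypothesis Kpos : forall r : R, 0 < r -> 0 < K r.
Hypothesis Kinf : forall r : R, R0 < r -> inf (K @` `]0, r[) = K r.
Hypothesis uS : global_weak_solution beta p q K u0 u.
Hypothesis fc : fraclap_const n (beta / 2) != 0.
Local Notation ST := (measurableTypeR R * 'rV[R]_n)%type.
Variables (w : ST -> R) (mw : measurable_fun setT w).
Hypothesis uw : {ae @lebesgue_spacetime R n, forall z : ST, 0 < z.1 -> u z.1 z.2 = w z}.
Local Notation W := (@lebesgue_spacetime R n).
Local Notation weight := (@weight R n beta).
Implicit Types (a : 'rV[R]_n) (r T : R) (k : nat).
Local Notation alpha := (n%:R + beta).

Let s0 : 0 < beta / 2. Proof. by rewrite divr_gt0. Qed.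
Let s1 : beta / 2 < 1. Proof. by rewrite ltr_pdivrMr ?mul1r. Qed.
Let s2 : 2 * (beta / 2) = beta. Proof. by rewrite mulrC divfK. Qed.

(** Extracts a finite integral of [|w|] from the mere integrability of a term of the weak
    formulation. *)
Lemma ae_integrable_dominated T (h h1 : ST -> R) :
  ae_integrable W (slab T) (fun z => (u z.1 z.2 * h z)%:E) ->
  measurable_fun setT h1 -> (forall z, slab T z -> 0 <= h1 z <= `|h z|) ->
  (\int[W]_(z in slab T) (`|w z| * h1 z)%:E < +oo)%E.
Proof.
move=> [g ig ug] mh1 h1h; have mS := @measurable_slab R n T.
have mg := measurable_int _ ig.
apply: (@le_lt_trans _ _ (\int[W]_(z in slab T) `|g z|)%E); last first.
  by have /integrableP[] := ig.
apply: ae_ge0_le_integral => //.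
- by move=> z zS; have /andP[h10 _] := h1h _ zS; rewrite lee_fin mulr_ge0.
- apply/measurable_EFinP; apply: measurable_funTS; apply: measurable_funM => //.
  exact: measurableT_comp.
- exact: measurableT_comp.
apply: filterS2 ug uw => z ugz uwz zS.
have := zS => -[/=]; rewrite in_itv/= => /andP[z0 _] _.
rewrite -ugz// uwz// abse_EFin lee_fin normrM ler_wpM2l//.
by have /andP[] := h1h _ zS.
Qed.

Let meas_t (f : R -> R) : measurable_fun setT f -> measurable_fun setT (fun z : ST => f z.1).
Proof. by move=> mf; exact: (@measurableT_comp _ _ _ _ _ _ f). Qed.

Let meas_x (f : 'rV[R]_n -> R) : measurable_fun setT f -> measurable_fun setT (fun z : ST => f z.2).
Proof. by move=> mf; exact: (@measurableT_comp _ _ _ _ _ _ f). Qed.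

Let mweight r : measurable_fun setT (weight r).
Proof. by apply: eq_measurable_fun (measurable_weight beta r 0) => a _; rewrite subr0. Qed.

(** Beyond [2 * r] the weight is controlled by the fractional Laplacian of a single bump; inside,
    where [fraclap_bump_ge] gives nothing, by the time derivative term of a bump of radius [3 * r].
    The time scale is doubled so that the cutoff stays away from 0 on []0, T[]. *)
Lemma weighted_mass_finite r T : 0 < r -> 0 < T ->
  (\int[W]_(z in slab T) (`|w z| * weight r z.2)%:E < +oo)%E.
Proof.
move=> r0 T0; have T20 : 0 < 2 * T by rewrite mulr_gt0.
have r30 : 0 < 3 * r by rewrite mulr_gt0.
have al0 : 0 < alpha by rewrite ltr_pwDr.
have [C C0 HC] := fraclap_bump_ge n0 s0 0 fc.
pose h1 (z : ST) := time_cutoff (2 * T) z.1 * (C * r ^+ n * `|z.2 - 0| `^ (- alpha)) *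
  \1_[set x : 'rV[R]_n | 2 * r < `|x - 0|] z.2.
pose h2 (z : ST) := pospart (1 - z.1 / (2 * T)) * bump_rV 0 0 (3 * r) z.2.
have c10 : 0 <= C * r ^+ n by rewrite mulr_ge0 ?exprn_ge0 ?ltW.
have h10 z : 0 <= h1 z.
  apply: mulr_ge0 => //; apply: mulr_ge0; first exact: time_cutoff_ge0.
  by apply: mulr_ge0 => //; exact: powR_ge0.
have h20 z : 0 <= h2 z by rewrite mulr_ge0 ?pospart_ge0 ?bump_ge0.
have mh1 : measurable_fun setT h1.
  apply: measurable_funM.
    apply: measurable_funM; first by apply: meas_t; exact: measurable_time_cutoff.
    apply: measurable_funM => //; apply: (@meas_x (fun x => `|x - 0| `^ (- alpha))).
    exact: measurable_powR_dist.
  apply: meas_x; apply: measurable_indic; exact: measurable_far.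
have mh2 : measurable_fun setT h2.
  apply: measurable_funM.
    apply: (@meas_t (fun t => pospart (1 - t / (2 * T)))).
    apply: (@measurableT_comp _ _ _ _ _ _ pospart).
      by apply: continuous_measurable_fun; exact: continuous_pospart.
    by apply: measurable_funB => //; exact: measurable_funM.
  by apply: meas_x; exact: measurable_bump.
have F1 : (\int[W]_(z in slab (2 * T)) (`|w z| * h1 z)%:E < +oo)%E.
  have [_ _ Llap _ _] := weak_formulation_test uS 0 0 r0 T20.
  apply: ae_integrable_dominated Llap mh1 _ => -[t x] [/= + _]; rewrite in_itv/= => /andP[t0 tT].
  rewrite h10 /h1/= indicE; have [xr|xr] := ltP (2 * r) `|x - 0|; last first.
    by rewrite memNset ?mulr0//= ltNge xr.
  rewrite mem_set// mulr1 /neg_laplacian_pow lt_eqF//.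
  have := HC 0 r _ x r0 (time_cutoff_ge0 (2 * T) t) (ltW xr).
  by rewrite s2.
have F2 : (\int[W]_(z in slab (2 * T)) (`|w z| * (T^-1 * h2 z))%:E < +oo)%E.
  have [_ _ _ Lt _] := weak_formulation_test uS 0 0 r30 T20.
  apply: ae_integrable_dominated Lt _ _; first exact: measurable_funM.
  move=> [t x] _; rewrite mulr_ge0 ?invr_ge0 ?(ltW T0)//=.
  rewrite normrM /dtime_cutoff normrN (ger0_norm (mulr_ge0 _ (pospart_ge0 _))); last by rewrite divr_ge0// ltW.
  rewrite (ger0_norm (bump_ge0 _ _ _ _)) /h2/= mulrA.
  rewrite (_ : 2 / (2 * T) = T^-1)//; by rewrite invfM mulrA mulfV ?mul1r.
pose m : R := (7 / 16) ^+ (3 * n); have m0 : 0 < m by rewrite exprn_gt0.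
pose A : R := 4 * r `^ alpha / (C * r ^+ n).
pose B : R := 2 * T / m.
have A0 : 0 <= A by rewrite divr_ge0// mulr_ge0// powR_ge0.
have B0 : 0 <= B by rewrite divr_ge0 ?mulr_ge0// ltW.
have wm (h : ST -> R) : measurable_fun setT h -> measurable_fun setT (fun z => (`|w z| * h z)%:E : \bar R).
  move=> mh; apply/measurable_EFinP; apply: measurable_funM => //; exact: measurableT_comp.
have mTh2 : measurable_fun setT (fun z => T^-1 * h2 z) by exact: measurable_funM.
have Th20 z : 0 <= T^-1 * h2 z by rewrite mulr_ge0// invr_ge0 ltW.
have w1 z : (0 <= (`|w z| * h1 z)%:E)%E by rewrite lee_fin mulr_ge0.
have w2 z : (0 <= (`|w z| * (T^-1 * h2 z))%:E)%E by rewrite lee_fin mulr_ge0.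
have A1 z : (0 <= A%:E * (`|w z| * h1 z)%:E)%E by rewrite mule_ge0.
have B1 z : (0 <= B%:E * (`|w z| * (T^-1 * h2 z))%:E)%E by rewrite mule_ge0.
apply: (@le_lt_trans _ _ (\int[W]_(z in slab (2 * T)) (A%:E * (`|w z| * h1 z)%:E +
    B%:E * (`|w z| * (T^-1 * h2 z))%:E))%E); last first.
  have mS := @measurable_slab R n (2 * T).
  have m1 : measurable_fun (slab (2 * T)) (fun z => A%:E * (`|w z| * h1 z)%:E)%E.
    exact: measurable_funTS (emeasurable_funM (measurable_cst _) (wm _ mh1)).
  have m2 : measurable_fun (slab (2 * T)) (fun z => B%:E * (`|w z| * (T^-1 * h2 z))%:E)%E.
    exact: measurable_funTS (emeasurable_funM (measurable_cst _) (wm _ mTh2)).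
  rewrite (ge0_integralD W mS (fun z _ => A1 z) m1 (fun z _ => B1 z) m2).
  rewrite (ge0_integralZl_EFin W mS (fun z _ => w1 z) (measurable_funTS (wm _ mh1)) A0).
  rewrite (ge0_integralZl_EFin W mS (fun z _ => w2 z) (measurable_funTS (wm _ mTh2)) B0).
  by rewrite lte_add_pinfty// lte_mul_pinfty// lee_fin.
apply: ge0_le_integral_nonmeasurable => [z [/= zT _]|z _|z _|[t x] [/= + _]].
- split => //=; move: zT; rewrite !in_itv/= => /andP[-> /lt_trans]; apply.
  by rewrite ltr_pMl// ltr1n.
- by rewrite lee_fin mulr_ge0 ?powR_ge0.
- exact: adde_ge0.
rewrite in_itv/= => /andP[t0 tT].
rewrite -!EFinM -EFinD lee_fin.
rewrite (mulrCA A) (mulrCA B) -mulrDr ler_wpM2l//.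
have tc : 2^-1 <= pospart (1 - t / (2 * T)).
  have : t / (2 * T) <= 2^-1 by rewrite ler_pdivrMr// mulKf// ltW.
  by rewrite /pospart le_max => ?; apply/orP; right; lra.
have [xr|xr] := leP `|x| (2 * r).
  apply: (@le_trans _ _ 1); first exact: weight_le1.
  rewrite -[leLHS]add0r; apply: lerD; first exact: mulr_ge0.
  (* [2 * r] is below [3 / 4] of the radius [3 * r]. *)
  have bx : m <= bump_rV 0 0 (3 * r) x by apply: bump_ge => //; rewrite subr0; lra.
  have mb : 2^-1 * m <= h2 (t, x) by apply: ler_pM => //; exact: ltW.
  have -> : B * (T^-1 * h2 (t, x)) = 2 / m * h2 (t, x).
    by rewrite /B; field; rewrite !gt_eqF.
  apply: le_trans (ler_wpM2l _ mb); last by rewrite divr_ge0// ltW.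
  by rewrite le_eqVlt; apply/orP; left; apply/eqP; field; rewrite gt_eqF.
rewrite -[leLHS]addr0; apply: lerD; last by rewrite mulr_ge0.
rewrite /h1/= subr0 indicE mem_set /= ?subr0// mulr1.
have x0 : 0 < `|x| by apply: lt_trans xr; rewrite mulr_gt0.
have wx : weight r x <= r `^ alpha * `|x| `^ (- alpha).
  have -> : r `^ alpha * `|x| `^ (- alpha) = (`|x| / r) `^ (- alpha).
    rewrite powRM ?invr_ge0 ?(ltW r0)// mulrC; congr (_ * _).
    by rewrite -powR_inv1 ?(ltW r0)// -powRrM mulN1r opprK.
  apply: powR_ltr0; [by rewrite oppr_le0 ltW|by rewrite divr_gt0|by rewrite lerDr].
have tc4 : 4^-1 <= time_cutoff (2 * T) t.
  have := ler_pM (_ : 0 <= 2^-1) (_ : 0 <= 2^-1) tc tc; rewrite -expr2 => /(_ _ _)/le_trans h.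
  have -> : 4^-1 = 2^-1 * 2^-1 :> R by field.
  by apply: h; rewrite ?invr_ge0.
apply: le_trans wx _.
have -> : A * (time_cutoff (2 * T) t * (C * r ^+ n * `|x| `^ (- alpha))) =
    4 * time_cutoff (2 * T) t * (r `^ alpha * `|x| `^ (- alpha)).
  have : r ^+ n != 0 by rewrite expf_neq0// gt_eqF.
  have : C != 0 by rewrite gt_eqF.
  rewrite /A; move: (_ `^ _) (_ `^ _) (time_cutoff _ _) (r ^+ n) => X Y Z U ? ?.
  by field; exact/andP.
rewrite ler_peMl ?mulr_ge0 ?powR_ge0//; lra.
Qed.

Let sigma := (p + q) / 2.
Let sg1 : 1 < sigma. Proof. by rewrite /sigma ltr_pdivlMr ?mul1r. Qed.
Let sg0 : 0 < sigma. Proof. exact: lt_trans sg1. Qed.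
Let et := (2 * sigma)^-1.
Let et0 : 0 < et. Proof. by rewrite invr_gt0 mulr_gt0. Qed.
Let et2 : et <= 2^-1. Proof. by rewrite /et invfM ler_piMr// invf_le1// ltW. Qed.

(** The part of the linear terms that does not depend on the centre, so that only the spatial factor
    varies in the averaging. *)
Let density r (z : ST) : R :=
  `|w z| * (r `^ (- beta) * time_cutoff (r `^ beta) z.1 `^ et) * \1_(slab (r `^ beta)) z.

Let density_ge0 r z : 0 <= density r z.
Proof. by rewrite mulr_ge0// mulr_ge0// mulr_ge0 ?powR_ge0. Qed.

Let measurable_cutoff_powR T : measurable_fun setT (fun z : ST => time_cutoff T z.1 `^ et).
Proof.
apply: (@measurableT_comp _ _ _ _ _ _ (@powR R ^~ et)) => //.
by apply: meas_t; exact: measurable_time_cutoff.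
Qed.

Let measurable_density r : measurable_fun setT (density r).
Proof.
apply: measurable_funM; last by apply: measurable_indic; exact: measurable_slab.
apply: measurable_funM; first exact: measurableT_comp.
by apply: measurable_funM => //; exact: measurable_cutoff_powR.
Qed.

Let integral_density r c (g : 'rV[R]_n -> R) : 0 <= c -> measurable_fun setT g ->
  (forall x, 0 <= g x) ->
  (\int[W]_(z in slab (r `^ beta)) (c * r `^ (- beta) *
     (`|w z| * (g z.2 * time_cutoff (r `^ beta) z.1 `^ et)))%:E =
   c%:E * \int[W]_z (density r z * g z.2)%:E)%E.
Proof.
move=> c0 mg g0.
have md : measurable_fun setT (fun z : ST => (density r z * g z.2)%:E : \bar R).
  apply/measurable_EFinP; apply: measurable_funM; first exact: measurable_density.
  exact: meas_x.
rewrite -(ge0_integralZl_EFin W measurableT _ md c0); last first.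
  by move=> z _; rewrite lee_fin mulr_ge0.
rewrite [LHS]integral_mkcond; apply: eq_integral => z _.
rewrite patchE /density indicE; case: ifP => _; last by rewrite mulr0 mul0r mule0.
by rewrite -EFinM; congr (_%:E); rewrite mulr1; ring.
Qed.

(** In [A], [C] comes from the fractional Laplacian and [2 * 2 ^ alpha] from the time derivative.
    [A] is the same for all centres, as the averaging requires. *)
Lemma weak_inequality_scaled k : exists2 A, 0 < A & forall a r, 0 < r ->
  ((initial_mass u0 k a r + source_mass p q K u k a r (r `^ beta))%:E <=
   A%:E * weighted_mass beta W snd (density r) r a)%E.
Proof.
have [C C0 HC] := fraclap_bump_le n0 s0 s1 k.
have q2 : 0 < 2 `^ alpha :> R by rewrite powR_gt0.
pose A := C + 2 * 2 `^ alpha.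
have A0 : 0 < A by rewrite addr_gt0// mulr_gt0.
exists A => // a r r0; pose T := r `^ beta; have T0 : 0 < T by rewrite powR_gt0.
have mwa : measurable_fun setT (fun x : 'rV[R]_n => weight r (x - a)) by exact: measurable_weight.
rewrite /weighted_mass -(@integral_density r A (fun x => weight r (x - a)) (ltW A0) mwa);
  last by move=> x; exact: weight_ge0.
pose G (z : ST) := A * r `^ (- beta) * (weight r (z.2 - a) * time_cutoff T z.1 `^ et).
have -> : (\int[W]_(z in slab T) (A * r `^ (- beta) * (`|w z| * (weight r (z.2 - a) *
    time_cutoff T z.1 `^ et)))%:E = \int[W]_(z in slab T) (`|w z| * G z)%:E)%E.
  by apply: eq_integral => z _; rewrite /G mulrCA.
apply: (weak_inequality uS mw uw r0 T0).
  apply: measurable_funM => //; apply: measurable_funM.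
    exact: (@meas_x (fun x => weight r (x - a))).
  exact: measurable_cutoff_powR.
move=> t x /andP[t0 tT].
have [h1 h2] := time_cutoff_powR_le T0 (ltW t0) et0 et2.
have TN : T^-1 = r `^ (- beta) by rewrite powRN.
have lap : `|neg_laplacian_pow beta (test k a r T t) x| <=
    time_cutoff T t * (C * r `^ (- beta) * weight r (x - a)).
  rewrite /neg_laplacian_pow lt_eqF//.
  by have := HC a r _ r0 (time_cutoff_ge0 T t) x; rewrite s2.
have bb := bump_le_weight beta0 k a x r0.
have rb : 0 <= r `^ (- beta) by rewrite powR_ge0.
have wx := weight_ge0 beta r (x - a).
apply: (@le_trans _ _ (time_cutoff T t `^ et * (C * r `^ (- beta) * weight r (x - a)) +
    2 / T * time_cutoff T t `^ et * (2 `^ alpha * weight r (x - a)))).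
  apply: lerD.
    by apply: le_trans lap _; rewrite ler_wpM2r// !mulr_ge0// ltW.
  by rewrite normrM (ger0_norm (bump_ge0 _ _ _ _)); apply: ler_pM; rewrite ?bump_ge0.
rewrite TN /G /= le_eqVlt; apply/orP; left; apply/eqP; rewrite /A.
by move: (weight _ _) (_ `^ et) => X Y; ring.
Qed.

(* The outer bumps are only used for [|a| > 9r/8]: they vanish near the origin, so
   that [M] can be taken as the mass of [u0] far from the origin. *)
Lemma fractional_master k : exists2 C, 0 < C & forall r M, 0 < r -> R0 < 4 * n%:R * r ->
  0 <= M -> (forall a, 9 / 8 * r < `|a| -> - M <= initial_mass u0 k a r) ->
  initial_mass u0 k 0 r <= C * (decay_bound n beta p q (K (4 * n%:R * r)) r + M).
Proof.
have [A A0 HA] := weak_inequality_scaled k.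
have sgV0 : 0 < sigma^-1 by rewrite invr_gt0.
have [C6 C60 H6] := integral_weight_le n beta0.
have [C2 C20 H2] := weight_subconvolution n beta0.
have [C4 C40 H4] := weight_cover n beta0 k sgV0.
(* Chosen so that [A * Hm 0], from the bump at the origin, and [A * C2 * Hm 0], from the averaged
   bumps, are together absorbed through the covering with constant [C4]. *)
pose L := A * (1 + C2) * C4.
have L0 : 0 < L by rewrite !mulr_gt0// addr_gt0.
have [C5 C50 H5] := absorption_scaled n0 p0 q0 pq Kpos Kinf uS mw uw k L0.
exists (C5 + C6 * C5 + C6); first by rewrite !addr_gt0// mulr_gt0.
move=> r M r0 Rr M0 HM; set D := decay_bound _ _ _ _ _ _.
have D0 : 0 <= D by exact: decay_bound_ge0.
pose Hm := weighted_mass beta W snd (density r) r.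
pose Fm := bump_mass sigma^-1 k W snd (density r) r.
pose ow a := outer_weight beta r a.
have Hm0 a : (0 <= Hm a)%E by apply: weighted_mass_ge0; exact: density_ge0.
have Fm0 a : (0 <= Fm a)%E by apply: bump_mass_ge0; exact: density_ge0.
have ow0 a : (0 <= (ow a)%:E)%E by rewrite lee_fin outer_weight_ge0.
have LFm a : (L%:E * Fm a <= (source_mass p q K u k a r (r `^ beta) + C5 * D)%:E)%E.
  have mb : measurable_fun setT (fun x => bump_rV k a r x `^ sigma^-1).
    apply: (@measurableT_comp _ _ _ _ _ _ (@powR R ^~ sigma^-1)) => //.
    exact: measurable_bump.
  apply: le_trans (H5 a r r0 Rr).
  rewrite (@integral_density r L (fun x => bump_rV k a r x `^ sigma^-1) (ltW L0) mb) //.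
  by move=> x; exact: powR_ge0.
(* Adding the weak inequality and the absorption cancels the source mass. *)
have key a : ((initial_mass u0 k a r)%:E + L%:E * Fm a <= A%:E * Hm a + (C5 * D)%:E)%E.
  apply: le_trans (leeD2l _ (LFm a)) _.
  by rewrite -EFinD addrA EFinD; apply: leeD2r; exact: HA.
have keyM a : 9 / 8 * r < `|a - 0| -> (L%:E * Fm a <= A%:E * Hm a + (C5 * D + M)%:E)%E.
  rewrite subr0 => /HM MA; rewrite EFinD addeA -leeBlDr//.
  by apply: le_trans (key a); rewrite addeC -EFinN; apply: leeD2r; rewrite lee_fin.
have mF := measurable_bump_mass beta sigma^-1 k W measurable_snd (measurable_density r) (density_ge0 r) r.
have mH := measurable_weighted_mass beta W measurable_snd (measurable_density r) (density_ge0 r) r.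
have mow : measurable_fun setT (fun a => (ow a)%:E : \bar R).
  by apply/measurable_EFinP; exact: measurable_outer_weight.
have owF a : (0 <= (ow a)%:E * Fm a)%E := mule_ge0 (ow0 a) (Fm0 a).
have owH a : (0 <= (ow a)%:E * Hm a)%E := mule_ge0 (ow0 a) (Hm0 a).
have CM0 : 0 <= C5 * D + M by rewrite addr_ge0// mulr_ge0// ltW.
pose FF := (\int[lebesgue_rV n]_a ((ow a)%:E * Fm a))%E.
pose HH := (\int[lebesgue_rV n]_a ((ow a)%:E * Hm a))%E.
have FF0 : (0 <= FF)%E by exact: integral_ge0.
(* [keyM] averaged against [outer_weight], whose total mass is at most [C6 * r ^+ n]. *)
have LFF : (L%:E * FF <= A%:E * HH + ((C5 * D + M) * (C6 * r ^+ n))%:E)%E.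
  apply: (@le_trans _ _ (A%:E * HH + (C5 * D + M)%:E * \int[lebesgue_rV n]_a (ow a)%:E)%E); last first.
    apply: leeD2l; rewrite EFinM; apply: lee_wpmul2l; first by rewrite lee_fin.
    apply: le_trans (H6 0 r r0); apply: ge0_le_integral_nonmeasurable => // a _.
      by rewrite lee_fin weight_ge0.
    by rewrite lee_fin subr0 outer_weight_le.
  have mAH : measurable_fun setT (fun a => A%:E * ((ow a)%:E * Hm a))%E.
    exact: emeasurable_funM (measurable_cst _) mH.
  have mCo : measurable_fun setT (fun a => (C5 * D + M)%:E * (ow a)%:E)%E.
    exact: emeasurable_funM (measurable_cst _) mow.
  have CME : (0 <= (C5 * D + M)%:E)%E by rewrite lee_fin.
  have AE : (0 <= A%:E)%E by rewrite lee_fin ltW.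
  have AH0 a : (0 <= A%:E * ((ow a)%:E * Hm a))%E := mule_ge0 AE (owH a).
  have Co0 a : (0 <= (C5 * D + M)%:E * (ow a)%:E)%E := mule_ge0 CME (ow0 a).
  rewrite -(ge0_integralZl_EFin _ measurableT (fun a _ => owF a) mF (ltW L0)).
  rewrite -(ge0_integralZl_EFin _ measurableT (fun a _ => owH a) mH (ltW A0)).
  rewrite -(ge0_integralZl_EFin _ measurableT (fun a _ => ow0 a) mow CM0).
  rewrite -(ge0_integralD _ measurableT (fun a _ => AH0 a) mAH (fun a _ => Co0 a) mCo).
  apply: ge0_le_integral_nonmeasurable => // [a _|a _|a _].
  - by rewrite mule_ge0// lee_fin ltW.
  - exact: adde_ge0.
  have [ar|ar] := ltP (9 / 8 * r) `|a - 0|; last first.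
    have -> : ow a = 0 by rewrite /ow /outer_weight indicE memNset ?mulr0//= ltNge ar.
    by move: (Fm a) (Hm a) => X Y; rewrite !mul0e !mule0 add0e.
  rewrite (muleCA L%:E) (muleCA A%:E) (muleC (C5 * D + M)%:E).
  rewrite -ge0_muleDr ?lee_fin//; last by rewrite mule_ge0// lee_fin ltW.
  by apply: lee_wpmul2l => //; exact: keyM.
have HHX : (HH <= (C2 * r ^+ n)%:E * Hm 0%R)%E.
  by apply: integral_weighted_mass_le => // x; exact: H2.
have XF : (Hm 0%R <= C4%:E * (Fm 0%R + (r ^- n)%:E * FF))%E.
  by apply: weighted_mass_cover => // x; exact: H4.
have Xfin : (Hm 0%R < +oo)%E.
  have T0 : 0 < r `^ beta by rewrite powR_gt0.
  rewrite -[X in (X < _)%E]mul1e.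
  rewrite -(@integral_density r 1 (fun x => weight r (x - 0)) ler01); last 2 first.
  - exact: measurable_weight.
  - by move=> x; exact: weight_ge0.
  have mw1 : measurable_fun setT (fun z : ST => (`|w z| * weight r z.2)%:E : \bar R).
    apply/measurable_EFinP; apply: measurable_funM; first exact: measurableT_comp.
    by apply: meas_x; exact: mweight.
  have rb0 : 0 <= r `^ (- beta) by exact: powR_ge0.
  apply: (@le_lt_trans _ _ (\int[W]_(z in slab (r `^ beta))
      ((r `^ (- beta))%:E * (`|w z| * weight r z.2)%:E))%E).
    apply: ge0_le_integral_nonmeasurable => // [z _|z _|[t x] [/= + _]].
    - by rewrite lee_fin !mulr_ge0 ?powR_ge0.
    - by rewrite mule_ge0// lee_fin mulr_ge0 ?powR_ge0.
    rewrite in_itv/= => /andP[t0 tT].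
    rewrite -EFinM lee_fin mul1r subr0 ler_wpM2l// ler_wpM2l//.
    rewrite ler_piMr ?powR_ge0//.
    have : 0 <= time_cutoff (r `^ beta) t <= 1.
      by rewrite time_cutoff_ge0 time_cutoff_le1// ltW.
    move=> /andP[c0 c1]; apply: (@le_trans _ _ (1 `^ et)); last by rewrite powR1.
    exact: le_powR (ltW et0) c0 c1.
  have mS := @measurable_slab R n (r `^ beta).
  rewrite (ge0_integralZl_EFin W mS _ (measurable_funTS mw1) rb0); last first.
    by move=> z _; rewrite lee_fin mulr_ge0 ?powR_ge0.
  by rewrite lte_mul_pinfty// weighted_mass_finite.
have := key 0; move: LFF HHX XF Xfin (Fm0 0) FF0 (Hm0 0).
have rn0 : 0 < r ^+ n by rewrite exprn_gt0.
have rnV0 : 0 < r ^- n by rewrite invr_gt0.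
move: (initial_mass _ _ _ _) (Hm 0%R) (Fm 0%R) (FF) (HH) =>
  i0 [x| |]// [f0| |]// [ff| |]// [hh| |]//.
(* The weighted mass being finite, any other infinite value contradicts one of the inequalities. *)
all: rewrite ?gt0_muley ?gt0_muleNy ?addNye ?lte_fin// -?EFinM -?EFinD ?lee_fin//.
move=> LFF HHX XF _ f00 ff0 x0 key0.
have g0 : 0 <= r ^- n * ff by rewrite mulr_ge0// invr_ge0 ltW.
have LFF' : L * (r ^- n * ff) <= A * (C2 * x) + (C5 * D + M) * C6.
  have -> : A * (C2 * x) + (C5 * D + M) * C6 =
      r ^- n * (A * (C2 * r ^+ n * x) + (C5 * D + M) * (C6 * r ^+ n)).
    by field; rewrite gt_eqF.
  rewrite mulrCA ler_wpM2l ?invr_ge0 ?(ltW rn0)//; apply: le_trans LFF _.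
  by rewrite lerD2r ler_wpM2l// ltW.
have XF' : A * (1 + C2) * x <= L * (f0 + r ^- n * ff).
  by rewrite /L -[leRHS]mulrA ler_wpM2l// mulr_ge0 ?addr_ge0// ltW.
have C6M : 0 <= C5 * M + C6 * C5 * M by rewrite addr_ge0 ?mulr_ge0// ltW.
have C6D : 0 <= C6 * D by rewrite mulr_ge0// ltW.
move: (r ^- n * ff) LFF' XF' C6M C6D key0 => g.
(* Adding [key0] and [LFF'] and inserting [XF'], the terms in [x] cancel; [C6M] and [C6D] fill the
   gap to the claimed constant. *)
clearbody L D; lra.
Qed.

End fractional_master.

(** * Nonexistence *)

Section nonexistence.
Context {R : realType} (n : nat) (beta p q : R) (K : R -> R) (R0 : R).
Hypotheses (n0 : (0 < n)%N) (beta02 : 0 < beta <= 2).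
Hypotheses (p0 : 0 < p) (q0 : 0 < q) (pq : 2 < p + q).
Hypothesis Kpos : forall r : R, 0 < r -> 0 < K r.
Hypothesis R0gt1 : 1 < R0.
Hypothesis Kinf : forall r : R, R0 < r -> inf (K @` `]0, r[) = K r.
Variables (u0 : 'rV[R]_n -> R) (u : R -> 'rV[R]_n -> R).
Hypothesis uS : global_weak_solution beta p q K u0 u.
Implicit Types (a x : 'rV[R]_n) (r M B : R) (k : nat).
Local Notation mu := (lebesgue_rV n).
Local Notation m := (p + q - 1).

Let m0 : 0 < m. Proof. by rewrite subr_gt0 (lt_trans _ pq)// ltr1n. Qed.
Let N0 : 0 < n%:R :> R. Proof. by rewrite ltr0n. Qed.

Lemma limf_esup_pinfty_le (f : R -> \bar R) B (M : \bar R) :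
  (forall r, B < r -> (f r <= M)%E) -> (limf_esup f +oo_R <= M)%E.
Proof.
move=> fM; rewrite /limf_esup; apply: (@le_trans _ _ (ereal_sup [set f x | x in `]B, +oo[])).
  apply: ereal_inf_lbound; exists `]B, +oo[%classic => //; exists B; split; first exact: num_real.
  by move=> x /= Bx; rewrite in_itv/= Bx.
by apply: ub_ereal_sup => _ [r + <-]; rewrite /= in_itv/= andbT => /fM.
Qed.

(** Solving for [kappa] turns a lower bound on the initial mass into an upper bound on the kernel,
    which is what the growth hypotheses on [K] contradict. *)
Lemma kernel_le_decay_bound kappa r y : 0 < kappa -> 0 < r -> 0 < y ->
  y <= decay_bound n beta p q kappa r ->
  kappa <= y `^ (- m) * r `^ (n%:R * m - (n%:R + beta)).
Proof.
move=> k0 r0 y0; rewrite /decay_bound; set X := kappa * _.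
have X0 : 0 < X by rewrite mulr_gt0// powR_gt0.
rewrite [X `^ _]powRN ler_pdivlMr ?powR_gt0// => /(le_powR (ltW m0) (mulr_ge0 (ltW y0) (powR_ge0 _ _))).
move=> h; rewrite powRM ?powR_ge0 ?(ltW y0)// in h.
rewrite -!powRrM mulVf ?gt_eqF// powRr1 ?(ltW X0)// in h.
have -> : r `^ (n%:R * m - (n%:R + beta)) = r `^ (n%:R * m) / r `^ (n%:R + beta).
  by rewrite powRD ?powRN//; apply/implyP => _; rewrite gt_eqF.
rewrite mulrA ler_pdivlMr ?powR_gt0// -/X powRN [leRHS]mulrC ler_pdivlMr ?powR_gt0//.
by rewrite mulrC.
Qed.

Lemma master_inequality : exists k, exists2 C, 0 < C & forall r M, 0 < r ->
  R0 < 4 * n%:R * r -> 0 <= M ->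
  (forall a, 9 / 8 * r < `|a| -> - M <= initial_mass u0 k a r) ->
  initial_mass u0 k 0 r <= C * (decay_bound n beta p q (K (4 * n%:R * r)) r + M).
Proof.
have [w mw uw] := measurable_representative uS.
case/andP: beta02 => beta0 beta2.
have s1 : 0 < (p + q) / 2 - 1 by rewrite subr_gt0 ltr_pdivlMr ?mul1r.
(* With [sigma = (p + q) / 2], the condition [k.+3 <= sigma * k.+1] amounts to
   [2 / (sigma - 1) <= k.+1]. *)
pose k := Num.truncn (2 / ((p + q) / 2 - 1)).
have ks : k.+3%:R <= (p + q) / 2 * k.+1%:R.
  have : 2 / ((p + q) / 2 - 1) <= k.+1%:R by apply/ltW; exact: truncnS_gt.
  have -> : k.+3%:R = 2 + k.+1%:R :> R by rewrite -natrD.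
  by rewrite ler_pdivrMr// => ?; lra.
exists k.
have [local|/not_orP[b2 fc]] := pselect (beta = 2 \/ beta < 2 /\ fraclap_const n (beta / 2) = 0).
  have [C C0 HC] := local_master n0 p0 q0 pq Kpos Kinf uS mw uw ks local.
  exists C => // r M r0 Rr M0 _; apply: le_trans (HC r r0 Rr) _.
  by rewrite ler_wpM2l ?(ltW C0)// lerDl.
have {}b2 : beta < 2 by rewrite lt_neqAle beta2 andbT; apply/eqP.
have {}fc : fraclap_const n (beta / 2) != 0 by apply/eqP => fc0; apply: fc.
exact: (fractional_master n0 beta0 b2 p0 q0 pq Kpos Kinf uS fc mw uw k).
Qed.

Lemma initial_mass_fin_num k a r : 0 < r ->
  (\int[mu]_x (u0 x * bump_rV k a r x)%:E)%E \is a fin_num.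
Proof.
move=> r0; have [L0 _ _ _ _] := weak_formulation_test uS k a r0 ltr01.
exact: ae_integrable_fin_num L0.
Qed.

(** Nonnegative data allow [M = 0]. As [r > R0 > 1], on the inner cube
    [1 + enorm x ^+ 2 <= (1 + n ^ 2) * r ^ 2], so the initial mass is at least a multiple of
    [r ^ (n - gamma)]. Solving for the kernel, the terms [n * m] in the exponent cancel. *)
Lemma slow_decay_kernel_lower_bound gamma eps : 0 < gamma -> 0 < eps ->
  (forall x, eps * (1 + enorm x ^+ 2) `^ (- gamma / 2) <= u0 x) ->
  exists2 C, 0 < C & forall rho, 4 * n%:R * R0 < rho ->
    C <= (K rho)^-1 * rho `^ (gamma * m - n%:R - beta).
Proof.
move=> g0 e0 u0e; have [k [C C0 HC]] := master_inequality.
have u00 x : 0 <= u0 x by apply: le_trans (u0e x); rewrite mulr_ge0 ?powR_ge0// ltW.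
pose bm : R := (7 / 16) ^+ (k.+3 * n); have bm0 : 0 < bm by rewrite exprn_gt0.
pose c := eps * (1 + n%:R ^+ 2) `^ (- gamma / 2) * bm * (3 / 2) ^+ n.
have n1 : 0 < 1 + n%:R ^+ 2 :> R by rewrite ltr_pwDl// sqr_ge0.
have c0 : 0 < c by rewrite !mulr_gt0 ?powR_gt0// exprn_gt0.
pose E := gamma * m - n%:R - beta.
exists ((c / C) `^ m * (4 * n%:R) `^ E); first by rewrite mulr_gt0 ?powR_gt0 ?divr_gt0 ?mulr_gt0.
move=> rho hrho; have n40 : 0 < 4 * n%:R :> R by rewrite mulr_gt0.
pose r := rho / (4 * n%:R); have rhoE : rho = 4 * n%:R * r by rewrite /r mulrC divfK ?gt_eqF.
have rR : R0 < r by rewrite /r ltr_pdivlMr// mulrC.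
have r1 : 1 < r := lt_trans R0gt1 rR.
have r0 : 0 < r := lt_trans ltr01 r1.
have Rr : R0 < 4 * n%:R * r.
  apply: lt_le_trans rR _; rewrite ler_peMl ?(ltW r0)//.
  by have : 1 <= n%:R :> R; [rewrite ler1n|lra].
rewrite rhoE; clearbody r; move: {rho hrho rhoE} (Kpos (mulr_gt0 n40 r0)).
have := HC r 0 r0 Rr (lexx 0); rewrite addr0 oppr0.
have ib a : 0 <= initial_mass u0 k a r.
  by apply: fine_ge0; apply: integral_ge0 => x _; rewrite lee_fin mulr_ge0 ?bump_ge0.
move=> /(_ (fun a _ => ib a)); move: (K _) => kappa mass k0.
have lower : c * (r ^+ n * r `^ (- gamma)) <= initial_mass u0 k 0 r.
  pose delta := eps * (1 + n%:R ^+ 2) `^ (- gamma / 2) * r `^ (- gamma) * bm.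
  have d0 : 0 <= delta by rewrite !mulr_ge0 ?powR_ge0// ltW.
  have mC := measurable_cube (0 : 'rV[R]_n) (3 / 4 * r).
  have r34 : 0 <= 3 / 4 * r by rewrite mulr_ge0// ltW.
  rewrite -lee_fin /initial_mass fineK ?initial_mass_fin_num//.
  apply: (@le_trans _ _ (\int[mu]_x (delta%:E * (\1_(cube 0 (3 / 4 * r)) x)%:E))%E).
    rewrite ge0_integralZl_EFin//; last first.
      by apply/measurable_EFinP; exact: measurable_indic.
    rewrite integral_indic// setIT [X in (_ <= _ * X)%E]lebesgue_rV_cube// -EFinM lee_fin.
    have -> : 2 * (3 / 4 * r) = 3 / 2 * r by field.
    rewrite exprMn /c /delta le_eqVlt; apply/orP; left; apply/eqP.
    by move: (_ `^ _) (_ `^ _) => A B; ring.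
  apply: ae_le_integral_nonmeasurable => //.
  - apply: emeasurable_funM => //; apply/measurable_EFinP; exact: measurable_indic.
  - by move=> x _; rewrite mule_ge0.
  apply/aeW => x _; rewrite -EFinM lee_fin indicE.
  have [xr|xr] := leP `|x| (3 / 4 * r); last first.
    by rewrite memNset ?mulr0 ?mulr_ge0 ?bump_ge0//= /cube/= subr0; apply/negP; rewrite -ltNge.
  rewrite mem_set ?mulr1; last by rewrite /cube/= subr0.
  apply: ler_pM; rewrite ?(ltW bm0)//; last by apply: bump_ge => //; rewrite subr0.
    by rewrite !mulr_ge0 ?powR_ge0// ltW.
  apply: le_trans (u0e x); rewrite -mulrA ler_wpM2l ?(ltW e0)//.
  have -> : r `^ (- gamma) = (r ^+ 2) `^ (- gamma / 2).
    by rewrite -powR_mulrn ?(ltW r0)// -powRrM mulrC divfK.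
  rewrite -powRM ?(ltW n1) ?sqr_ge0//; apply: powR_ltr0.
  - by rewrite mulNr oppr_le0 divr_ge0// ltW.
  - by rewrite ltr_pwDl// sqr_ge0.
  have en : enorm x <= n%:R * r.
    apply: le_trans (enorm_le_norm _) _; rewrite ler_wpM2l//; lra.
  rewrite mulrDl mul1r -exprMn lerD//; first by rewrite exprn_ege1// ltW.
  by rewrite ler_pXn2r ?nnegrE ?sqrtr_ge0// mulr_ge0// ltW.
have y0 : 0 < c / C * (r ^+ n * r `^ (- gamma)).
  by rewrite mulr_gt0 ?divr_gt0// mulr_gt0 ?powR_gt0 ?exprn_gt0.
have yd : c / C * (r ^+ n * r `^ (- gamma)) <= decay_bound n beta p q kappa r.
  by rewrite mulrAC ler_pdivrMr// [leRHS]mulrC; exact: le_trans lower mass.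
have h := kernel_le_decay_bound k0 r0 y0 yd.
have cC : 0 < c / C by rewrite divr_gt0.
have Z : (r ^+ n * r `^ (- gamma)) `^ (- m) = r `^ (- (n%:R * m) + gamma * m).
  rewrite -powR_mulrn ?(ltW r0)// -powRD; last by rewrite (gt_eqF r0) implybT.
  by rewrite -powRrM; congr (_ `^ _); ring.
move: h; rewrite (powRM _ (ltW cC)) ?mulr_ge0 ?powR_ge0 ?exprn_ge0 ?(ltW r0)// Z.
rewrite -mulrA -powRD; last by rewrite (gt_eqF r0) implybT.
have -> : - (n%:R * m) + gamma * m + (n%:R * m - (n%:R + beta)) = E by rewrite /E; ring.
move=> h; rewrite (powRM _ (ltW n40) (ltW r0)) mulrCA [leLHS]mulrC ler_wpM2l ?powR_ge0//.
move: h; rewrite (powRN (c / C)) !ler_pdivlMl ?powR_gt0//.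
by rewrite mulrC.
Qed.

Lemma bump_scale k r x : 0 < r -> bump_rV k 0 r x = bump_rV k 0 1 (r^-1 *: x).
Proof.
move=> r0; apply: eq_bigr => i _.
by rewrite /bump_factor !mxE !subr0 divr1 mulrC.
Qed.

(** Rescaling reduces this to the continuity of the unit bump at the origin, where it equals 1. *)
Lemma bump_cvg1 k (r : nat -> R) x : (forall j, j.+1%:R < r j) ->
  bump_rV k 0 (r j) x @[j --> \oo] --> (1 : R).
Proof.
move=> rj; have r0 j : 0 < r j by apply: lt_trans (rj j).
under eq_fun do rewrite bump_scale//.
have e1 : bump_rV k 0 1 (0 *: x) = 1 :> R.
  rewrite scale0r; apply/big1 => i _.
  by rewrite /bump_factor !mxE subrr mul0r /bump1 expr0n subr0 /pospart max_r// expr1n.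
have cb : continuous (bump_rV k 0 1 : 'rV[R]_n -> R).
  by apply: continuous_rV_prod => i; exact: continuous_bump_factor.
have cz : (r j)^-1 *: x @[j --> \oo] --> 0 *: x.
  apply: cvgZr_tmp.
  apply: (@squeeze_cvgr _ _ _ _ (fun=> 0) (fun j => j.+1%:R^-1)); last 2 first.
  - exact: cvg_cst.
  - exact: cvg_harmonic.
  by near=> j; rewrite invr_ge0 ltW//= lef_pV2 ?posrE// ltW.
suff H (v : R) : bump_rV k 0 1 (0 *: x) = v ->
    bump_rV k 0 1 ((r j)^-1 *: x) @[j --> \oo] --> v by exact: H e1.
move=> <-; exact: (@continuous_cvg _ _ _ _ _ (fun j => (r j)^-1 *: x) _ _ (cb (0 *: x)) cz).
Unshelve. all: by end_near. Qed.

(** Along radii tending to infinity the masses of [u0] against the bumps tend to its integral, while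
    the mass of [|u0|] seen by far bumps tends to 0. Hence [decay_bound] stays away from 0, which
    bounds the kernel. *)
Lemma positive_mass_kernel_bounded : Lone (fun x => (u0 x)%:E) ->
  (0 < \int[mu]_x (u0 x)%:E)%E ->
  ~ forall B M, exists rho, B < rho /\ M < K rho * rho `^ (- n%:R * (p + q - 2) + beta).
Proof.
move=> [g ig ug] I0 Kunb; have [k [C C0 HC]] := master_inequality.
pose h x := fine (g x).
have mg := measurable_int _ ig.
have mh : measurable_fun setT h by exact: measurableT_comp.
have ih : mu.-integrable setT (fun x => (h x)%:E).
  apply: le_integrable ig => //; first exact/measurable_EFinP.
  by move=> x _; rewrite /h; case: (g x) => //= *; rewrite ?normr0 ?leey.
have uh : {ae mu, forall x, u0 x = h x}.
  by apply: filterS ug => x /(_ Logic.I) e; rewrite /h -e.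
have mb a r : measurable_fun setT (bump_rV k a r) by exact: measurable_bump.
have massE a r : initial_mass u0 k a r = fine (\int[mu]_x (h x * bump_rV k a r x)%:E).
  rewrite /initial_mass; congr fine; apply: ae_eq_integral_nonmeasurable => //.
    by apply/measurable_EFinP; exact: measurable_funM.
  by apply: filterS uh => x e _; rewrite e.
have IE : (\int[mu]_x (u0 x)%:E = \int[mu]_x (h x)%:E)%E.
  apply: ae_eq_integral_nonmeasurable => //; first exact/measurable_EFinP.
  by apply: filterS uh => x e _; rewrite e.
rewrite IE in I0; have Ifin := integrable_fin_num measurableT ih.
pose I := fine (\int[mu]_x (h x)%:E); have {}I0 : 0 < I by rewrite fine_gt0// I0 ltey_eq Ifin.
pose far r := [set x : 'rV[R]_n | r < `|x - 0|].
have mfar r : measurable (far r) by exact: measurable_far.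
have iabs : mu.-integrable setT (fun x => `|h x|%:E) by exact: integrable_abse ih.
have mtail r : measurable_fun setT (fun x => (`|h x| * \1_(far r) x)%:E : \bar R).
  apply/measurable_EFinP; apply: measurable_funM; first exact: measurableT_comp.
  exact: measurable_indic.
pose tail r := fine (\int[mu]_x (`|h x| * \1_(far r) x)%:E).
have tail0 r : 0 <= tail r.
  by apply: fine_ge0; apply: integral_ge0 => x _; rewrite lee_fin mulr_ge0.
have itail r : mu.-integrable setT (fun x => (`|h x| * \1_(far r) x)%:E).
  apply: le_integrable iabs => // x _; rewrite lee_fin normrM normr_id ler_piMr//.
  by rewrite indicE; case: (_ \in _); rewrite ?normr1 ?normr0.
have tailP a r : 0 < r -> 9 / 8 * r < `|a| -> - tail (r / 8) <= initial_mass u0 k a r.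
  move=> r0 ar; rewrite massE; apply: lerNnormlW.
  apply: norm_fine_le; rewrite fineK; last exact: integrable_fin_num.
  apply: le_trans (le_abse_integral _ measurableT _) _.
    by apply/measurable_EFinP; exact: measurable_funM.
  apply: ge0_le_integral_nonmeasurable => [//|x _|x _|x _].
  - exact: abse_ge0.
  - by rewrite lee_fin mulr_ge0.
  rewrite abse_EFin lee_fin normrM (ger0_norm (bump_ge0 _ _ _ _)) ler_wpM2l//.
  rewrite indicE; have [xr|xr] := ltP (r / 8) `|x - 0|.
    by rewrite mem_set ?bump_le1.
  rewrite bump_eq0//; rewrite subr0 in xr.
  by have := ler_normD (a - x) x; rewrite subrK (distrC a); lra.
have N40 : 0 < 4 * n%:R :> R by rewrite mulr_gt0.
(* The shift by [R0 + j.+1] makes every radius [r j] admissible and forces [r j] to infinity. *)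
have /choice[rho Hrho] : forall j : nat, exists rho, 4 * n%:R * (R0 + j.+1%:R) < rho /\
    j%:R < K rho * rho `^ (- n%:R * (p + q - 2) + beta) by move=> j; exact: Kunb.
pose r j := rho j / (4 * n%:R).
have rhoE j : rho j = 4 * n%:R * r j by rewrite /r mulrC divfK ?gt_eqF.
have rj j : R0 + j.+1%:R < r j by rewrite /r ltr_pdivlMr// mulrC; case: (Hrho j).
have rj1 j : j.+1%:R < r j by apply: le_lt_trans (rj j); rewrite lerDr ltW// (lt_trans ltr01).
have r0 j : 0 < r j by apply: lt_trans (rj1 j).
have Rr j : R0 < 4 * n%:R * r j.
  have : R0 < r j by apply: le_lt_trans (rj j); rewrite lerDl.
  move=> /lt_le_trans; apply; rewrite ler_peMl ?ltW//.
  by have : 1 <= n%:R :> R; [rewrite ler1n|lra].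
have cmass : initial_mass u0 k 0 (r j) @[j --> \oo] --> I.
  under eq_fun do rewrite massE; apply: fine_cvg; rewrite fineK//.
  apply: (@dominated_cvg _ _ _ _ _ measurableT _ _ (fun x => `|h x|%:E)) => //.
  - by move=> j; apply/measurable_EFinP; exact: measurable_funM.
  - move=> x _; apply/cvg_EFin; first by near=> j.
    have : h x * bump_rV k 0 (r j) x @[j --> \oo] --> h x * 1.
      by apply: cvgM; [exact: cvg_cst|exact: bump_cvg1].
    by rewrite mulr1.
  - move=> j x _; rewrite abse_EFin lee_fin normrM (ger0_norm (bump_ge0 _ _ _ _)).
    by rewrite ler_piMr ?bump_le1.
have ctail : tail (r j / 8) @[j --> \oo] --> (0 : R).
  apply: fine_cvg; rewrite -[X in _ --> X](integral0 mu setT).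
  apply: (@dominated_cvg _ _ _ _ _ measurableT _ _ (fun x => `|h x|%:E)) => //.
  - move=> x _; apply: cvg_near_cst; near=> j.
    rewrite indicE memNset ?mulr0//= /far/= subr0; apply/negP; rewrite -leNgt.
    rewrite ler_pdivlMr//; apply/ltW/lt_trans/(rj1 j).
    apply: lt_le_trans (truncnS_gt _) _; rewrite ler_nat ltnS.
    by near: j; exact: nbhs_infty_ge.
  - move=> j x _; rewrite abse_EFin lee_fin normrM normr_id ler_piMr//.
    by rewrite indicE; case: (_ \in _); rewrite ?normr1 ?normr0.
(* The mass eventually exceeds [I / 2] and [C * tail] falls below [I / 4], which leaves
   [I / 4 = C * y] as a lower bound for [C * decay_bound]. *)
pose y := I / (4 * C); have y0 : 0 < y by rewrite divr_gt0// mulr_gt0.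
pose e := n%:R * m - (n%:R + beta).
(* The resulting upper bound for the quantity chosen to exceed [j] at [rho j]: a contradiction once
   [bnd <= j]. *)
pose bnd := y `^ (- m) * (4 * n%:R) `^ (- e).
have : \forall j \near \oo, False.
  near=> j.
  have h1 : I / 2 < initial_mass u0 k 0 (r j).
    by near: j; apply: cvgr_gt cmass _ _; rewrite ltr_pdivrMr// ltr_pMr// ltr1n.
  have h2 : tail (r j / 8) < y by near: j; exact: cvgr_lt ctail _ _.
  have h3 : bnd <= j%:R by near: j; exact: nbhs_infty_ger.
  have := HC (r j) (tail (r j / 8)) (r0 j) (Rr j) (tail0 _) (fun a => @tailP a _ (r0 j)).
  move=> /(lt_le_trans h1) h4.
  have yd : y <= decay_bound n beta p q (K (4 * n%:R * r j)) (r j).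
    have : C * tail (r j / 8) < C * y by rewrite ltr_pM2l.
    have -> : C * y = I / 4 by rewrite /y; field; rewrite gt_eqF.
    move=> h5; rewrite -(ler_pM2l C0) (_ : C * y = I / 4); first by lra.
    by rewrite /y; field; rewrite gt_eqF.
  have k0 : 0 < K (4 * n%:R * r j) by apply: Kpos; rewrite mulr_gt0.
  have := kernel_le_decay_bound k0 (r0 j) y0 yd.
  have [_] := Hrho j; rewrite rhoE.
  have -> : - n%:R * (p + q - 2) + beta = - e by rewrite /e; ring.
  rewrite -/e (powRM _ (ltW N40) (ltW (r0 j))) => h5 h6.
  have := le_lt_trans h3 h5; apply/negP; rewrite -leNgt /bnd mulrCA [leRHS]mulrC.
  rewrite ler_wpM2l ?powR_ge0// [r j `^ _]powRN ler_pdivrMr ?powR_gt0//.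
by case=> N _ /(_ N (leqnn N)).
Unshelve. all: by end_near. Qed.

End nonexistence.

Theorem theorem1p2 (R : realType) (n : nat) (beta p q : R) (K : R -> R)
    (hn : (1 <= n)%N) (hbeta : 0 < beta <= 2)
    (hp : 0 < p) (hq : 0 < q) (hpq : 2 < p + q)
    (hKpos : forall r : R, 0 < r -> 0 < K r)
    (hKcont : {within `]0, +oo[, continuous K})
    (hKloc : Lone_loc (fun x : 'rV[R]_n => (K (enorm x))%:E))
    (hKinf : exists2 R0 : R, 1 < R0 &
       forall r : R, R0 < r -> inf (K @` `]0, r[) = K r) :
  (forall u0 : 'rV[R]_n -> R,
     Lone (fun x => (u0 x)%:E) ->
     (0 < \int[lebesgue_rV n]_x (u0 x)%:E)%E ->
     limf_esup (fun r : R => (K r * r `^ (- n%:R * (p + q - 2) + beta))%:E)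
       +oo_R = +oo%E ->
     ~ exists u : R -> 'rV[R]_n -> R, global_weak_solution beta p q K u0 u) /\
  (forall (gamma : R) (u0 : 'rV[R]_n -> R),
     0 < gamma ->
     Lone_loc (fun x => (u0 x)%:E) ->
     (exists2 eps : R, 0 < eps &
        forall x, eps * (1 + enorm x ^+ 2) `^ (- gamma / 2) <= u0 x) ->
     limf_einf (fun r : R =>
       ((K r)^-1 * r `^ (gamma * (p + q - 1) - n%:R - beta))%:E)
       +oo_R = 0%E ->
     ~ exists u : R -> 'rV[R]_n -> R, global_weak_solution beta p q K u0 u).
Proof.
have [R0 R01 Kinf] := hKinf; split=> [u0 L0 I0 sup [u uS]|gamma u0 g0 _ [eps e0 u0e] infK [u uS]].
  apply: (positive_mass_kernel_bounded hn hbeta hp hq hpq hKpos R01 Kinf uS L0 I0) => B M.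
  apply: contrapT => /forallNP H.
  have : (limf_esup (fun r : R => (K r * r `^ (- n%:R * (p + q - 2) + beta))%:E) +oo_R <= M%:E)%E.
    apply: (@limf_esup_pinfty_le _ _ B) => r Br; rewrite lee_fin leNgt; apply/negP => h.
    exact: (H r).
  by rewrite sup leye_eq.
have [C C0 HC] := slow_decay_kernel_lower_bound hn hbeta hp hq hpq hKpos R01 Kinf uS g0 e0 u0e.
(* The limit inferior is by definition the opposite of the limit superior of the opposite
   function. *)
have : (limf_esup (fun r : R =>
    - ((K r)^-1 * r `^ (gamma * (p + q - 1) - n%:R - beta))%:E)%E +oo_R <= (- C)%:E)%E.
  apply: (@limf_esup_pinfty_le _ _ (4 * n%:R * R0)) => r Br.
  by rewrite -EFinN lee_fin lerN2 HC.
by rewrite EFinN leeNr -[X in (_ <= X)%E]/(limf_einf _ _) infK lee_fin leNgt C0.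
Qed.
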